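(* For any $(\mu,\mathrm j)\in\mathsf{CE}$ with $\mathcal E(\mu(0))<\infty$ it holds $\mathcal L(\mu,\mathrm j)\ge 0$.
   Context: Graph. $(V,E)$ is a finite connected graph: $V$ is a finite node set, $E\subset V\times V$, $vv\notin E$, and $vw\in E$ implies $wv\notin E$. For $e=vw\in E$, $v$ is the tail, $w$ the head, $V(e)=\{v,w\}$; $E(v)$ is the set of edges containing $v$. Edge lengths $\ell^e>0$ are given, $L=\bigsqcup_{e\in E}[0,\ell^e]$, $M=(V,E,L)$. A function (measure) on $L$ is a family $(\varphi^e)_{e\in E}$ of functions (measures) on the intervals $[0,\ell^e]$; $\varphi\in C^1(L)$ means $\varphi^e\in C^1([0,\ell^e])$ for all $e$ (no continuity across nodes). For $e=vw$ put $\varphi^e|_v=\varphi^e(0)$, $\varphi^e|_w=\varphi^e(\ell^e)$. $\mathcal P(M)$ is the set of $\mu=(\gamma,\rho)$ with $\gamma=(\gamma_v)_{v\in V}$ a nonnegative measure on $V$, $\rho$ a nonnegative measure on $L$ and $\sum_v\gamma_v+\sum_e\rho^e([0,\ell^e])=1$. A measure and its Lebesgue density are denoted by the same symbol. Data. $(\omega,\pi)\in\mathcal P(M)$ with $\omega_v>0$ and $\pi^e(dx)=e^{-P^e(x)}dx$, $P^e$ Lipschitz; constants $d^e>0$ ($e\in E$) and $\kappa^e_v>0$ ($e\in E$, $v\in V(e)$); $T>0$. Continuity equation. $\mathsf{CE}$ is the set of pairs $(\mu,\mathrm j)$ with $\mu=(\gamma,\rho):[0,T]\to\mathcal P(M)$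 narrowly continuous and $\mathrm j=(\bar\jmath,j)$ a measurable family of reals $\bar\jmath^e_v(t)$ ($e\in E,v\in V(e)$) and finite signed measures $j^e(t)$ on $[0,\ell^e]$ with $\int_0^T\big(\sum_{e}\sum_{v\in V(e)}|\bar\jmath^e_v|+\sum_e|j^e|([0,\ell^e])\big)dt<\infty$, such that for all $\phi:V\to\mathbb R$, $\varphi\in C^1(L)$ and a.e. $t$ $$\frac{d}{dt}\Big[\sum_{v}\phi_v\gamma_v(t)+\sum_e\int_0^{\ell^e}\varphi^e d\rho^e(t)\Big]=\sum_{v}\sum_{e\in E(v)}(\phi_v-\varphi^e|_v)\bar\jmath^e_v(t)+\sum_e\int_0^{\ell^e}\partial_x\varphi^e\,dj^e(t).$$ Functionals. $\eta(r)=r\log r-r+1$; $\mathcal H(\mu|\nu)=\int\eta(\frac{d\mu}{d\nu})d\nu$ if $\mu\ll\nu$, $+\infty$ otherwise; $\mathcal E(\mu)=\sum_e\mathcal H(\rho^e|\pi^e)+\sum_v\mathcal H(\gamma_v|\omega_v)$. $\mathsf C(r)=2r\log\frac{r+\sqrt{r^2+4}}2-2\sqrt{r^2+4}+4$, $\mathsf C(r|s)=s\,\mathsf C(r/s)$ for $s>0$, $\mathsf C(0|0)=0$, $\mathsf C(r|0)=+\infty$ for $r\ne0$. $$\mathcal R(\mu,\mathrm j)=\sum_e\sum_{v\in V(e)}\mathsf C\big(\bar\jmath^e_v\,\big|\,\kappa^e_v\sqrt{\gamma_v\,\rho^e|_v}\big)+\sum_e\frac1{2d^e}\int_0^{\ell^e}\Big|\frac{dj^e}{d\rho^e}\Big|^2d\rho^e$$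 ($+\infty$ if $j^e\not\ll\rho^e$ for some $e$), $$\mathcal I(\mu)=\sum_e\sum_{v\in V(e)}2\kappa^e_v\sqrt{\omega_v\pi^e|_v}\,\Big|\sqrt{\tfrac{\rho^e}{\pi^e}}\Big|_v-\sqrt{\tfrac{\gamma_v}{\omega_v}}\Big|^2+\sum_e2d^e\int_0^{\ell^e}\Big|\partial_x\sqrt{\tfrac{\rho^e}{\pi^e}}\Big|^2d\pi^e$$ ($+\infty$ if $\rho^e\not\ll\pi^e$ or $\sqrt{\rho^e/\pi^e}\notin H^1(0,\ell^e)$ for some $e$; otherwise boundary values are those of the continuous representative). $\mathcal D(\mu,\mathrm j)=\int_0^T[\mathcal R(\mu,\mathrm j)+\mathcal I(\mu)]dt$ and $\mathcal L(\mu,\mathrm j)=\mathcal E(\mu(T))-\mathcal E(\mu(0))+\mathcal D(\mu,\mathrm j)$.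
   Formalization: The continuity equation is also required in integrated form (the tested quantity is absolutely continuous in t); with only an a.e. derivative the claim fails, e.g. for a Cantor-function interpolation from a smooth state to (ω,π) with j=0 and small T. *)

(* Defs.v *)
From HB Require Import structures.
From mathcomp Require Import all_boot all_order all_algebra.
From mathcomp Require Import all_classical all_reals all_analysis.
From mathcomp Require Import measurable_realfun.

Set Implicit Arguments.
Unset Strict Implicit.
Unset Printing Implicit Defensive.

Import Order.TTheory GRing.Theory Num.Theory.
Import numFieldNormedType.Exports.

Local Open Scope classical_set_scope.
Local Open Scope ring_scope.
Local Open Scope charge_scope.

Notation line R := (measurableTypeR R).
Notation lebesgue := (@lebesgue_measure _).

(* An edge [e = (v, w)] has tail [v = e.1] and head [w = e.2].  Families
   indexed by the edges are functions on [V * V]; only their values on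
   [edges M] are ever used or constrained. *)
Record metric_graph (R : realType) (V : finType) := MetricGraph {
  edges : {set V * V};
  len : V * V -> R;
  edges_irrefl : forall v, (v, v) \notin edges;
  edges_oriented : forall v w, (v, w) \in edges -> (w, v) \notin edges;
  edges_connected : forall v w,
    connect (fun x y => ((x, y) \in edges) || ((y, x) \in edges)) v w;
  len_gt0 : forall e, e \in edges -> 0 < len e }.

Definition ends {V : finType} (e : V * V) (v : V) : bool :=
  (v == e.1) || (v == e.2).

(* Boundary value at [v], meaningful for [v] in [ends e], of a function on the
   interval [0, len M e]. *)
Definition at_node {R : realType} {V : finType} (M : metric_graph R V)
    (f : R -> R) (e : V * V) (v : V) : R :=
  if v == e.1 then f 0 else f (len M e).

(* Measures on [0, l] are Borel measures on the line for which the complement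
   of [0, l] is a null set. *)
Record state (R : realType) (V : finType) := State {
  node_mass : V -> R;
  edge_meas : V * V -> {finite_measure set (line R) -> \bar R} }.

Record flux (R : realType) (V : finType) := Flux {
  node_flux : V * V -> V -> R;
  edge_flux : V * V -> {charge set (line R) -> \bar R} }.

Definition is_prob {R : realType} {V : finType} (M : metric_graph R V)
    (mu : state R V) : Prop :=
  [/\ forall v, 0 <= node_mass mu v,
      forall e, e \in edges M ->
        (edge_meas mu e).-null_set (~` `[0, len M e]) &
      (\sum_v (node_mass mu v)%:E
        + \sum_(e in edges M) edge_meas mu e `[0%R, len M e]%classic = 1)%E].

Definition is_gibbs {R : realType} {V : finType} (M : metric_graph R V)
    (P : V * V -> R -> R) (nu : state R V) : Prop :=
  forall e, e \in edges M ->
    [lipschitz P e x | x in `[0, len M e]] /\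
    forall A : set (line R), measurable A ->
      edge_meas nu e A =
      (\int[lebesgue]_(x in A `&` `[0%R, len M e]%classic) (expR (- P e x))%:E)%E.

(* Membership of [f] in C^1([0, l]), with [df] its derivative on the closed
   interval: [df] is the continuous extension of the derivative in the
   interior, i.e. one-sided derivatives at the end points. *)
Definition is_C1 {R : realType} (l : R) (f df : R -> R) : Prop :=
  [/\ {within `[0, l], continuous f},
      {within `[0, l], continuous df} &
      forall x, x \in `]0, l[ -> is_derive x 1 f (df x)].

Section charges.
Context {R : realType} (j : {charge set (line R) -> \bar R}).

Definition hahn_pos : set (line R) := projT1 (cid (Hahn_decomposition j)).

Definition hahn_neg : set (line R) :=
  projT1 (cid (projT2 (cid (Hahn_decomposition j)))).

Definition hahn_posneg : hahn_decomposition j hahn_pos hahn_neg :=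
  projT2 (cid (projT2 (cid (Hahn_decomposition j)))).

Definition charge_norm (A : set (line R)) : \bar R :=
  charge_variation hahn_posneg A.

Definition charge_integral (D : set (line R)) (f : R -> R) : R :=
  \int[jordan_pos hahn_posneg]_(x in D) f x
  - \int[jordan_neg hahn_posneg]_(x in D) f x.

End charges.

Section continuity_equation.
Context {R : realType} {V : finType} (M : metric_graph R V).

Definition pairing (phi : V -> R) (vphi : V * V -> R -> R) (mu : state R V)
    : R :=
  \sum_v phi v * node_mass mu v
  + \sum_(e in edges M) \int[edge_meas mu e]_(x in `[0, len M e]) vphi e x.

Definition flux_pairing (phi : V -> R) (vphi dvphi : V * V -> R -> R)
    (j : flux R V) : R :=
  \sum_v \sum_(e in edges M | ends e v)
    (phi v - at_node M (vphi e) e v) * node_flux j e v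
  + \sum_(e in edges M) charge_integral (edge_flux j e) `[0, len M e] (dvphi e).

Definition flux_size (j : flux R V) : \bar R :=
  (\sum_(e in edges M) \sum_(v | ends e v) `|node_flux j e v|%:E
   + \sum_(e in edges M) charge_norm (edge_flux j e) `[0%R, len M e]%classic)%E.

Definition narrowly_continuous (T : R) (mu : R -> state R V) : Prop :=
  forall (phi : V -> R) (vphi : V * V -> R -> R),
    (forall e, e \in edges M -> {within `[0, len M e], continuous (vphi e)}) ->
    {within `[0, T], continuous (fun t => pairing phi vphi (mu t))}.

(* dF/dt = G for almost every t, for an absolutely continuous F: pointwise
   differentiability almost everywhere does not suffice (F could be a Cantor
   function), so the fundamental theorem of calculus is required as well. *)
Definition ae_derivative (T : R) (F G : R -> R) : Prop :=
  {ae lebesgue, forall t : line R, t \in `]0, T[ -> is_derive (t : R) 1 F (G t)}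
  /\ forall s t, 0 <= s -> s <= t -> t <= T ->
       F t - F s = \int[lebesgue]_(r in `[s, t]) G r.

Record CE (T : R) (mu : R -> state R V) (j : R -> flux R V) : Prop := {
  CE_prob : forall t, t \in `[0, T] -> is_prob M (mu t);
  CE_narrow : narrowly_continuous T mu;
  CE_conc : forall t e, t \in `[0, T] -> e \in edges M ->
    (edge_flux (j t) e).-null_set (~` `[0, len M e]);
  CE_node_meas : forall e v, e \in edges M -> ends e v ->
    measurable_fun (`[0, T] : set (line R))
      (fun t => node_flux (j t) e v : line R);
  CE_edge_meas : forall e (A : set (line R)), e \in edges M -> measurable A ->
    measurable_fun (`[0, T] : set (line R)) (fun t => edge_flux (j t) e A);
  CE_finite : (\int[lebesgue]_(t in `[0%R, T]) flux_size (j t) < +oo)%E;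
  CE_eq : forall (phi : V -> R) (vphi dvphi : V * V -> R -> R),
    (forall e, e \in edges M -> is_C1 (len M e) (vphi e) (dvphi e)) ->
    ae_derivative T (fun t => pairing phi vphi (mu t))
                    (fun t => flux_pairing phi vphi dvphi (j t)) }.

End continuity_equation.

Section sobolev.
Context {R : realType} (l : R).

Definition is_L2 (u : R -> R) : Prop :=
  measurable_fun (`]0, l[ : set (line R)) (u : line R -> line R) /\
  lebesgue.-integrable `]0, l[ (fun x : line R => (u x ^+ 2)%:E).

(* C^1 functions with compact support in ]0, l[ *)
Definition is_test (psi : R -> R) : Prop :=
  [/\ forall x, derivable psi x 1,
      continuous (derive1 psi) &
      exists a b, [/\ 0 < a, b < l & forall x, x \notin `[a, b] -> psi x = 0]].

Definition is_weak_derivative (u w : R -> R) : Prop :=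
  is_L2 w /\
  forall psi, is_test psi ->
    \int[lebesgue]_(x in `]0, l[) (u x * derive1 psi x)
    = - \int[lebesgue]_(x in `]0, l[) (w x * psi x).

Definition is_H1 (u : R -> R) : Prop :=
  is_L2 u /\ exists w, is_weak_derivative u w.

(* Determined almost everywhere in ]0, l[ when [u] is in H^1. *)
Definition weak_derivative (u : R -> R) : R -> R :=
  xget (fun=> 0) [set w | is_weak_derivative u w].

(* Its values on [0, l] are uniquely determined when a continuous
   representative of [u] on [0, l] exists. *)
Definition cont_rep (u : R -> R) : R -> R :=
  xget (fun=> 0) [set g : R -> R | {within `[0, l], continuous g} /\
    ae_eq lebesgue `]0, l[%classic (g : line R -> R) u].

End sobolev.

Definition density {R : realType}
    (rho : {finite_measure set (line R) -> \bar R})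
    (pi : {sigma_finite_measure set (line R) -> \bar R}) (x : R) : R :=
  fine (('d (charge_of_finite_measure rho) '/d pi) x).

(* [ln 0 = 0], so that [eta 0 = 1]. *)
Definition eta {R : realType} (r : R) : R := r * ln r - r + 1.

Definition edge_entropy {R : realType}
    (rho pi : {finite_measure set (line R) -> \bar R}) : \bar R :=
  (if `[< rho `<< pi >] then \int[pi]_x (eta (density rho pi x))%:E
   else +oo)%E.

Definition node_entropy {R : realType} (g w : R) : \bar R :=
  if (w == 0) ==> (g == 0) then (w * eta (g / w))%:E else +oo%E.

Definition cost {R : realType} (r : R) : R :=
  2 * r * ln ((r + Num.sqrt (r ^+ 2 + 4)) / 2)
  - 2 * Num.sqrt (r ^+ 2 + 4) + 4.

Definition cost_persp {R : realType} (r s : R) : \bar R :=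
  if 0 < s then (s * cost (r / s))%:E else if r == 0 then 0%E else +oo%E.

Section functionals.
Context {R : realType} {V : finType} (M : metric_graph R V).
Variables (nu : state R V) (P : V * V -> R -> R).
Variables (d : V * V -> R) (kappa : V * V -> V -> R).

Definition entropy (mu : state R V) : \bar R :=
  (\sum_(e in edges M) edge_entropy (edge_meas mu e) (edge_meas nu e)
   + \sum_v node_entropy (node_mass mu v) (node_mass nu v))%E.

(* Boundary value of the Lebesgue density of [rho^e]; it is well defined
   whenever [fisher mu] below is finite.  Where no continuous density exists
   the value is arbitrary, and irrelevant for [dissipation]. *)
Definition rho_at (mu : state R V) (e : V * V) (v : V) : R :=
  at_node M (cont_rep (len M e) (density (edge_meas mu e) lebesgue)) e v.

Definition pi_at (e : V * V) (v : V) : R :=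
  at_node M (fun x => expR (- P e x)) e v.

Definition sqrt_density (mu : state R V) (e : V * V) (x : R) : R :=
  Num.sqrt (density (edge_meas mu e) (edge_meas nu e) x).

Definition rate (mu : state R V) (j : flux R V) : \bar R :=
  (if `[< forall e, e \in edges M -> edge_flux j e `<< edge_meas mu e >] then
     \sum_(e in edges M) \sum_(v | ends e v)
       cost_persp (node_flux j e v)
         (kappa e v * Num.sqrt (node_mass mu v * rho_at mu e v))
     + \sum_(e in edges M) ((2 * d e)^-1)%:E *
         \int[edge_meas mu e]_(x in `[0%R, len M e])
           (fine (('d (edge_flux j e) '/d (edge_meas mu e)) x) ^+ 2)%:E
   else +oo)%E.

Definition fisher (mu : state R V) : \bar R :=
  (if `[< forall e, e \in edges M ->
          edge_meas mu e `<< edge_meas nu e /\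
          is_H1 (len M e) (sqrt_density mu e) >] then
     \sum_(e in edges M) \sum_(v | ends e v)
       (2 * kappa e v * Num.sqrt (node_mass nu v * pi_at e v) *
        `| at_node M (cont_rep (len M e) (sqrt_density mu e)) e v
           - Num.sqrt (node_mass mu v / node_mass nu v) | ^+ 2)%:E
     + \sum_(e in edges M) (2 * d e)%:E *
         \int[edge_meas nu e]_(x in `]0%R, len M e[)
           (weak_derivative (len M e) (sqrt_density mu e) x ^+ 2)%:E
   else +oo)%E.

Definition dissipation (T : R) (mu : R -> state R V) (j : R -> flux R V)
    : \bar R :=
  (\int[lebesgue]_(t in `[0%R, T]) (rate (mu t) (j t) + fisher (mu t)))%E.

Definition energy_dissipation (T : R) (mu : R -> state R V)
    (j : R -> flux R V) : \bar R :=
  (entropy (mu T) - entropy (mu 0%R) + dissipation T mu j)%E.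

End functionals.

(* Main.v *)
Require Import Defs.
From mathcomp Require Import all_boot all_order all_algebra.
From mathcomp Require Import all_classical all_reals all_analysis.
From mathcomp Require Import measurable_realfun ring lra.

Set Implicit Arguments.
Unset Strict Implicit.
Unset Printing Implicit Defensive.

Import Order.TTheory GRing.Theory Num.Theory.
Import numFieldNormedType.Exports.

Local Open Scope classical_set_scope.
Local Open Scope ring_scope.
Local Open Scope charge_scope.

(** The total dissipation has to be compared with the loss of entropy along a
    curve that is only narrowly continuous.  No chain rule for the entropy is
    used; the argument is by duality and by discretization in time.

    The entropy is the supremum of [pairing phi vphi - legendre phi vphi] over the
    edgewise continuous potentials ([entropy_ge_legendre], [entropy_le_legendre]).
    It is therefore enough to bound this expression at time 0, for an arbitrary
    potential, by the entropy at time [T] plus the total dissipation ([chain]).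

    For a potential that does not depend on time, the continuity equation gives
    the speed of the pairing.  Young's inequality ([cost_persp_young], [node_young],
    [charge_young]) bounds it by the dissipation plus an excess, which is linear
    in the densities once the quadratic Fisher information on the edges has been
    linearized by means of a multiplier ([edge_static], [static_estimate]).  If the
    densities were constant in time, the logarithm of the density would make the
    excess nonpositive.  As they are not, a time average is fixed first and the
    potential is the logarithm of the averaged density, shifted by a small number
    and smoothed on a grid: by linearity the average of the excess is the excess
    of the averaged density, which is almost nonpositive ([node_dissipation],
    [cell_dissipation]).  The same potential almost maximizes the Legendre
    expression for the averaged state.  Hence any potential can be replaced, at
    arbitrarily small cost, by one for which the average of the speed is at most
    the average of the dissipation ([edge_step], [one_step]).

    The averages are those with geometric weights of ratio [theta], on short
    cells of time, over all the cells not earlier than a given one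
    ([backward_average]).  Moving the first cell backwards by one changes the average
    of a function by the same average of its speed ([backward_average_step]), which is
    the quantity that the choice of the potential controls.  The contributions of
    all the steps sum up to [theta^-1] times the integral of the dissipation and
    boundary terms ([backward_average_sum]); the cells shrink and then [theta] tends
    to 1.

    The dissipation is not known to be measurable in time, so that its integral
    is a lower integral.  It is replaced by a maximal measurable minorant of the
    same integral ([measurable_minorant]), which suffices because the estimates
    all bound measurable functions of time by the dissipation. *)

#[local] Hint Extern 0 (measurable _) =>
  solve [exact: measurableT | exact: measurable_itv] : core.

(** * Measurable minorants of non-measurable functions *)

Section minorant.
Local Open Scope ereal_scope.
Context {dT : measure_display} {T : measurableType dT} {R : realType}.
Variable m : {measure set T -> \bar R}.

(** The integral of a nonnegative function is by definition a supremum over the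
    simple functions below it, hence monotone even where the functions are not
    measurable. *)
Lemma ge0_le_lower_integral (D : set T) (f g : T -> \bar R) :
  (forall x, D x -> 0 <= f x) -> (forall x, D x -> f x <= g x) ->
  \int[m]_(x in D) f x <= \int[m]_(x in D) g x.
Proof.
move=> f0 fg; have g0 x : D x -> 0 <= g x.
  by move=> Dx; exact: le_trans (f0 _ Dx) (fg _ Dx).
rewrite !ge0_integralE//; apply: le_ereal_sup => _ [h /= hf <-].
exists h => //= x; apply: (le_trans (hf x)).
by rewrite !patchE; case: ifPn => // /set_mem; exact: fg.
Qed.

Import HBNNSimple.

(** The supremum [gs] of a maximizing sequence of simple functions is as large as
    any measurable minorant [h]: the maximum of [h] and [gs] is still below [g],
    so its integral cannot exceed that of [gs]. *)
Lemma measurable_minorant (D : set T) (g : T -> \bar R) : measurable D ->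
  (forall x, D x -> 0 <= g x) -> \int[m]_(x in D) g x < +oo ->
  exists gs : T -> R, [/\ measurable_fun D gs, (forall x, (0 <= gs x)%R),
    m.-integrable D (EFin \o gs),
    \int[m]_(x in D) (gs x)%:E <= \int[m]_(x in D) g x &
    forall h : T -> R, measurable_fun D h ->
      (forall x, D x -> (h x)%:E <= g x) ->
      {ae m, forall x, D x -> (h x <= gs x)%R}].
Proof.
move=> mD g0 gfin.
set I := \int[m]_(x in D) g x in gfin *.
have IE : I = ereal_sup [set sintegral m h
    | h in [set h : {nnsfun T >-> R} | forall x, (h x)%:E <= (g \_ D) x]].
  by rewrite /I ge0_integralE.
set S := [set _ | _ in _] in IE.
have S0 : S != set0.
  apply/set0P; exists (sintegral m (nnsfun0 : {nnsfun T >-> R})).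
  exists nnsfun0 => //= x; rewrite patchE; case: ifPn => // /set_mem; exact: g0.
have [u uS ucvg] := ereal_sup_seq S0.
pose H n : {nnsfun T >-> R} := projT1 (cid2 (uS n)).
have Hg n x : (H n x)%:E <= (g \_ D) x by rewrite /H; case: cid2.
have Hu n : sintegral m (H n) = u n by rewrite /H; case: cid2.
pose k x := esups (fun n => (H n x)%:E) 0%N.
have mk : measurable_fun setT k.
  apply: (measurable_fun_esups (f := fun n x => (H n x)%:E)) => n.
  exact/measurable_EFinP.
have kE x : k x = ereal_sup (range (fun n => (H n x)%:E)).
  by rewrite /k /esups/= /sdrop; congr ereal_sup; apply/seteqP; split => y [n _ <-];
    exists n.
have Hk n x : (H n x)%:E <= k x by rewrite kE; apply: ereal_sup_ubound; exists n.
have kg x : D x -> k x <= g x.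
  move=> Dx; rewrite kE; apply: ge_ereal_sup => _ [n _ <-].
  by have := Hg n x; rewrite patchE mem_set.
have k0 x : 0 <= k x by apply: le_trans (Hk 0%N x); rewrite lee_fin.
have kI : \int[m]_(x in D) k x = I.
  apply/eqP; rewrite eq_le; apply/andP; split.
    exact: ge0_le_lower_integral.
  have -> : I = ereal_sup S by [].
  have <- := cvg_lim _ ucvg => //.
  apply: lime_le; first by apply/cvg_ex; eexists; exact: ucvg.
  apply: nearW => n; rewrite -Hu -integralT_nnsfun.
  rewrite [leRHS]integral_mkcond. apply: ge0_le_lower_integral.
    by move=> x _; rewrite lee_fin.
  move=> x _; rewrite patchE; case: ifPn => xD; first exact: Hk.
  by have := Hg n x; rewrite patchE (negbTE xD).
have intk : m.-integrable D k.
  apply/integrableP; split; first exact: measurable_funTS.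
  by under eq_integral do rewrite gee0_abs//; rewrite kI.
pose gs x := fine (k x).
have gs0 x : (0 <= gs x)%R by exact: fine_ge0.
have gsk x : (gs x)%:E <= k x.
  by rewrite /gs; case: (k x) (k0 x) => //= r _; rewrite leey.
have mgs : measurable_fun D gs.
  by apply: measurableT_comp => //; exact: measurable_funTS.
have intgs : m.-integrable D (EFin \o gs).
  apply: (le_integrable mD _ _ intk); first exact/measurable_EFinP.
  by move=> x _; rewrite /= ger0_norm// gee0_abs.
have gsI : \int[m]_(x in D) (gs x)%:E = I.
  rewrite -kI; apply: ge0_ae_eq_integral => //.
  - exact/measurable_EFinP.
  - exact: measurable_funTS.
  - by move=> x _; rewrite lee_fin.
  - have kfin0 := integrable_ae mD intk; apply: filterS kfin0 => x kfin Dx.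
    by rewrite fineK// kfin.
exists gs; split => // [|h mh hg]; first by rewrite gsI.
pose M x := Num.max (h x) (gs x).
have mM : measurable_fun D M by exact: measurable_maxr.
have gsM x : (gs x <= M x)%R by rewrite /M le_max lexx orbT.
(* [M] lies below [g], so it competes in the supremum that defines [I] *)
have MI : \int[m]_(x in D) (M x)%:E <= I.
  apply: ge0_le_lower_integral => x Dx.
    by rewrite lee_fin; exact: le_trans (gsM x).
  rewrite /M /Num.max; case: ifPn => _; last exact: hg.
  exact: le_trans (gsk x) (kg _ Dx).
have intM : m.-integrable D (EFin \o M).
  apply/integrableP; split; first exact/measurable_EFinP.
  under eq_integral do rewrite /= ger0_norm ?(le_trans _ (gsM _)) //.
  exact: le_lt_trans MI gfin.
have Mgs : ae_eq m D (fun x => (M x)%:E - (gs x)%:E) (cst 0).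
  apply/(ae_eq_integral_abs m mD).
    by apply: emeasurable_funB => //; exact/measurable_EFinP.
  apply/eqP; rewrite eq_le integral_ge0 ?andbT //.
  under eq_integral do rewrite gee0_abs ?sube_ge0 ?lee_fin //.
  rewrite integralB// gsI sube_le0//.
apply: filterS Mgs => x Mx Dx.
have /eqP := Mx Dx; rewrite -EFinB eqe subr_eq0 => /eqP <-.
by rewrite /M le_max lexx.
Qed.

End minorant.

(** * Integrals of real-valued functions *)

Section real_integrable.
Context {dT : measure_display} {T : measurableType dT} {R : realType}.
Variable m : {measure set T -> \bar R}.
Implicit Types (D : set T) (f g h : T -> R).

Lemma integrable_realD D f g : measurable D ->
  m.-integrable D (EFin \o f) -> m.-integrable D (EFin \o g) ->
  m.-integrable D (EFin \o (fun x => f x + g x)).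
Proof.
by move=> mD fi gi; have := integrableD mD fi gi.
Qed.

Lemma integrable_realB D f g : measurable D ->
  m.-integrable D (EFin \o f) -> m.-integrable D (EFin \o g) ->
  m.-integrable D (EFin \o (fun x => f x - g x)).
Proof.
by move=> mD fi gi; have := integrableB mD fi gi.
Qed.

Lemma integrable_realZ D f c : measurable D ->
  m.-integrable D (EFin \o f) ->
  m.-integrable D (EFin \o (fun x => c * f x)).
Proof.
by move=> mD fi; have := integrableZl mD c fi.
Qed.

Lemma integrable_realM D f h C : measurable D ->
  m.-integrable D (EFin \o f) -> measurable_fun D h ->
  (forall x, D x -> `|h x| <= C) ->
  m.-integrable D (EFin \o (fun x => f x * h x)).
Proof.
move=> mD fi mh hC; have /integrableP[/measurable_EFinP mf _] := fi.
apply: (@le_integrable _ _ _ m D mD _ (fun x => (`|C| * `|f x|)%:E)).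
- by apply/measurable_EFinP; exact: measurable_funM.
- move=> x Dx; rewrite /= lee_fin normrM [leRHS]ger0_norm ?mulr_ge0//.
  by rewrite mulrC ler_wpM2r// (le_trans (hC _ Dx))// ler_norm.
- by apply: integrable_realZ => //; exact: integrable_norm.
Qed.

Lemma integrable_real_sum D I (s : seq I) (P : pred I) (f : I -> T -> R) :
  measurable D -> (forall i, P i -> m.-integrable D (EFin \o f i)) ->
  m.-integrable D (EFin \o (fun x => \sum_(i <- s | P i) f i x)).
Proof.
move=> mD fi.
have -> : EFin \o (fun x => \sum_(i <- s | P i) f i x) =
    fun x => (\sum_(i <- s | P i) (f i x)%:E)%E.
  by apply/funext => x; rewrite /= sumEFin.
exact: (integrable_sum mD s fi).
Qed.

Lemma Rintegral_sum D I (s : seq I) (P : pred I) (f : I -> T -> R) :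
  measurable D -> (forall i, P i -> m.-integrable D (EFin \o f i)) ->
  \int[m]_(x in D) (\sum_(i <- s | P i) f i x) =
  \sum_(i <- s | P i) \int[m]_(x in D) f i x.
Proof.
move=> mD fi; elim: s => [|i s IH].
  under eq_Rintegral do rewrite big_nil.
  by rewrite big_nil -(mul0r (\int[m]_(x in D) 0)) Rintegral_cst// !mul0r.
rewrite big_cons; under eq_Rintegral do rewrite big_cons.
case: ifPn => // Pi; rewrite RintegralD ?IH//; first exact: fi.
exact: integrable_real_sum.
Qed.

Lemma measurable_sum_cond D I (s : seq I) (P : pred I) (h : I -> T -> R) :
  (forall i, P i -> measurable_fun D (h i)) ->
  measurable_fun D (fun x => \sum_(i <- s | P i) h i x).
Proof.
move=> mh.
have -> : (fun x => \sum_(i <- s | P i) h i x) =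
    (fun x => \sum_(i <- s) (if P i then h i x else 0)).
  by apply/funext => x; exact: big_mkcond.
by apply: measurable_sum => i; have [Pi|_] := boolP (P i); [exact: mh|exact: measurable_cst].
Qed.

End real_integrable.

Section real_integrable_finite.
Context {dT : measure_display} {T : measurableType dT} {R : realType}.
Variable m : {measure set T -> \bar R}.
Implicit Types (D : set T) (f g h : T -> R).

Lemma integrable_real_cst D c : measurable D -> (m D < +oo)%E ->
  m.-integrable D (EFin \o (fun=> c)).
Proof.
move=> mD mDoo; apply/integrableP; split; first exact: measurable_cst.
by rewrite integral_cst// lte_mul_pinfty// ?lee_fin.
Qed.

Lemma integrable_real_bounded D h C : measurable D -> (m D < +oo)%E ->
  measurable_fun D h -> (forall x, D x -> `|h x| <= C) ->
  m.-integrable D (EFin \o h).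
Proof.
move=> mD mDoo mh hC.
have := @integrable_realM _ _ _ m D (fun=> 1) h C mD (integrable_real_cst _ mD mDoo) mh hC.
by apply: eq_integrable => // x _; rewrite /= mul1r.
Qed.

End real_integrable_finite.

Lemma lebesgue_itv_lty {R : realType} (b0 b1 : bool) (a b : R) :
  (@lebesgue_measure R [set` Interval (BSide b0 a) (BSide b1 b)] < +oo)%E.
Proof. by rewrite lebesgue_measure_itv/=; case: ifPn => _; rewrite ?ltry. Qed.

Lemma Rintegral_itv_cst {R : realType} (b0 b1 : bool) (a b c : R) : a <= b ->
  \int[@lebesgue_measure R]_(x in [set` Interval (BSide b0 a) (BSide b1 b)]) c =
  c * (b - a).
Proof.
move=> ab; rewrite Rintegral_cst; last exact: measurable_itv.
rewrite /= lebesgue_measure_itv/= lte_fin; case: ltP => ab'.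
  by rewrite -EFinB.
have -> : b = a by apply/eqP; rewrite eq_le ab' ab.
by rewrite subrr mulr0.
Qed.

(** Replacing [g - f] by its positive part on a null set reduces the claim to the
    integral of a nonnegative function. *)
Lemma ae_le_Rintegral {dT : measure_display} {T : measurableType dT}
    {R : realType} (m : {measure set T -> \bar R}) (D : set T) (f g : T -> R) :
  measurable D -> m.-integrable D (EFin \o f) -> m.-integrable D (EFin \o g) ->
  {ae m, forall x, D x -> f x <= g x} ->
  \int[m]_(x in D) f x <= \int[m]_(x in D) g x.
Proof.
move=> mD fi gi fg; rewrite -subr_ge0 -RintegralB//.
have gfi := integrable_realB mD gi fi.
have /measurable_EFinP mgf : measurable_fun D (EFin \o (fun x => g x - f x)).
  by case/integrableP : gfi.
have -> : \int[m]_(x in D) (g x - f x) = \int[m]_(x in D) Num.max 0 (g x - f x).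
  congr fine; apply: ae_eq_integral => //.
  - exact/measurable_EFinP.
  - by apply/measurable_EFinP; exact: measurable_maxr.
  - case: fg => N [mN N0 NU]; exists N; split => // x /= nx; apply: NU => /= fg.
    by apply: nx => Dx; rewrite max_r// subr_ge0 fg.
by apply: Rintegral_ge0 => x _; rewrite le_max lexx.
Qed.

(** * Smooth steps *)

Section smooth_step.
Context {R : realType}.
Implicit Types a b k x : R.

Definition pospart x : R := Num.max 0 x.

(** A uniform quadratic remainder gives differentiability without a case analysis
    at the points where a piecewise quadratic function changes its formula. *)
Lemma is_derive_quadratic_error (f : R -> R) x df C :
  (forall h, `|f (h + x) - f x - h * df| <= C * h ^+ 2) ->
  is_derive x 1 f df.
Proof.
move=> fC; have C0 : 0 <= C.
  by have := fC 1; rewrite expr1n mulr1; apply: le_trans.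
have cvg : h^-1 *: ((f (h *: 1 + x) - f x) : R) @[h --> 0^'] --> df.
  apply/cvgrPdist_le => /= e e0; near=> h.
  have h0 : h != 0 by near: h; exact: nbhs_dnbhs_neq.
  have he : `|h| <= e / (C + 1).
    by near: h; apply: dnbhs0_le; rewrite divr_gt0// ltr_wpDl.
  rewrite /GRing.scale /= mulr1.
  rewrite -[X in X - _](mulKf h0) -mulrBr normrM normfV.
  rewrite ler_pdivrMl ?normr_gt0// distrC.
  apply: (le_trans (fC h)); rewrite -real_normK ?num_real// expr2 mulrCA.
  rewrite ler_wpM2l//; apply: (@le_trans _ _ (C * (e / (C + 1)))).
    by rewrite ler_wpM2l.
  by rewrite mulrCA ger_pMr// ler_pdivrMr ?mul1r ?ltr_wpDl// lerDl.
apply: DeriveDef; first by apply/cvg_ex; exists df.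
exact: cvg_lim.
Unshelve. all: by end_near. Qed.

Lemma continuous_pospart : continuous pospart.
Proof. by move=> x; apply: (@continuous_max R R (cst 0) id); [exact: cvg_cst|exact: cvg_id]. Qed.

(** The primitive of a normalized trapezoid on [[a, b]] with ramps of width [k],
    written with positive parts so that one formula covers all the pieces.  This
    is the simplest C^1 function that climbs from 0 to 1 with a bounded and
    almost constant slope. *)
Definition smooth_step a b k x : R :=
  (pospart (x - a) ^+ 2 / 2 - pospart (x - a - k) ^+ 2 / 2
   - pospart (x - b + k) ^+ 2 / 2 + pospart (x - b) ^+ 2 / 2) / (k * (b - a - k)).

Definition smooth_bump a b k x : R :=
  (pospart (x - a) - pospart (x - a - k)
   - pospart (x - b + k) + pospart (x - b)) / (k * (b - a - k)).

Lemma half_sqr_pospart_error x h :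
  `|pospart (h + x) ^+ 2 / 2 - pospart x ^+ 2 / 2 - h * pospart x| <= h ^+ 2.
Proof.
rewrite /pospart /Num.max ler_norml; apply/andP.
by split; case: ifPn; case: ifPn; rewrite -?leNgt => *; nra.
Qed.

Lemma is_derive_smooth_step a b k x :
  is_derive x 1 (smooth_step a b k) (smooth_bump a b k x).
Proof.
set c := (k * (b - a - k))^-1.
apply: (@is_derive_quadratic_error _ _ _ (4 * `|c|)) => h.
pose E y := pospart (h + y) ^+ 2 / 2 - pospart y ^+ 2 / 2 - h * pospart y.
have -> : smooth_step a b k (h + x) - smooth_step a b k x
    - h * smooth_bump a b k x =
    c * (E (x - a) - E (x - a - k) - E (x - b + k) + E (x - b)).
  by rewrite /smooth_step /smooth_bump -/c /E !addrA; ring.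
rewrite normrM mulrAC mulrC ler_wpM2r//.
have EE y : - (h ^+ 2) <= E y <= h ^+ 2.
  by rewrite -ler_norml; exact: half_sqr_pospart_error.
have /andP[? ?] := EE (x - a); have /andP[? ?] := EE (x - a - k).
have /andP[? ?] := EE (x - b + k); have /andP[? ?] := EE (x - b).
by rewrite ler_norml; apply/andP; split; lra.
Qed.

Lemma continuous_smooth_bump a b k : continuous (smooth_bump a b k).
Proof.
have C c : continuous (fun x : R => pospart (x + c)).
  move=> x; apply: (@continuous_comp _ _ _ (fun x : R => x + c) pospart).
    by apply: cvgD; [exact: cvg_id|exact: cvg_cst].
  exact: continuous_pospart.
have -> : smooth_bump a b k = fun x => (pospart (x + - a) - pospart (x + (- a - k))
   - pospart (x + (- b + k)) + pospart (x + - b)) * (k * (b - a - k))^-1.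
  by apply/funext => x; rewrite /smooth_bump !addrA.
move=> x; apply: cvgM; last exact: cvg_cst.
by apply: cvgD; [apply: cvgB; [apply: cvgB|]|]; exact: C.
Qed.

Lemma smooth_bump_ge0 a b k x : 0 < k -> 2 * k <= b - a ->
  0 <= smooth_bump a b k x.
Proof.
move=> k0 kab.
have D0 : 0 < b - a - k by lra.
apply: divr_ge0; last by rewrite mulr_ge0 ?ltW.
rewrite /pospart /Num.max.
by do 4![case: ifPn; rewrite -?leNgt => ?]; lra.
Qed.

Lemma smooth_bump_le a b k x : 0 < k -> 2 * k <= b - a ->
  smooth_bump a b k x <= (b - a - k)^-1.
Proof.
move=> k0 kab.
have D0 : 0 < b - a - k by lra.
rewrite /smooth_bump invfM mulrA ler_piMl ?invr_ge0 ?(ltW D0)//.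
rewrite ler_pdivrMr// mul1r.
rewrite /pospart /Num.max.
by do 4![case: ifPn; rewrite -?leNgt => ?]; lra.
Qed.

Lemma smooth_bump_eq0 a b k x : 0 < k -> 2 * k <= b - a ->
  (x <= a) || (b <= x) -> smooth_bump a b k x = 0.
Proof.
move=> k0 kab xab.
rewrite /smooth_bump.
suff -> : pospart (x - a) - pospart (x - a - k)
   - pospart (x - b + k) + pospart (x - b) = 0 by rewrite mul0r.
rewrite /pospart /Num.max.
by case/orP : xab => ?; do 4![case: ifPn; rewrite -?leNgt => ?]; lra.
Qed.

Lemma smooth_step_eq0 a b k x : 0 < k -> 2 * k <= b - a ->
  x <= a -> smooth_step a b k x = 0.
Proof.
move=> k0 kab xab.
rewrite /smooth_step.
suff -> : pospart (x - a) ^+ 2 / 2 - pospart (x - a - k) ^+ 2 / 2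
   - pospart (x - b + k) ^+ 2 / 2 + pospart (x - b) ^+ 2 / 2 = 0 by rewrite mul0r.
rewrite /pospart /Num.max.
by do 4![case: ifPn; rewrite -?leNgt => ?]; lra.
Qed.

Lemma smooth_step_eq1 a b k x : 0 < k -> 2 * k <= b - a ->
  b <= x -> smooth_step a b k x = 1.
Proof.
move=> k0 kab xab.
have D0 : 0 < b - a - k by lra.
rewrite /smooth_step.
suff -> : pospart (x - a) ^+ 2 / 2 - pospart (x - a - k) ^+ 2 / 2
   - pospart (x - b + k) ^+ 2 / 2 + pospart (x - b) ^+ 2 / 2 = k * (b - a - k).
  by rewrite divff// mulf_neq0 ?gt_eqF.
rewrite /pospart /Num.max.
by do 4![case: ifPn; rewrite -?leNgt => ?]; nra.
Qed.

Lemma smooth_step_itv a b k x : 0 < k -> 2 * k <= b - a ->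
  0 <= smooth_step a b k x <= 1.
Proof.
move=> k0 kab.
have D0 : 0 < b - a - k by lra.
have K0 : 0 < k * (b - a - k) by exact: mulr_gt0.
rewrite /smooth_step ler_pdivlMr// mul0r ler_pdivrMr// mul1r.
rewrite /pospart /Num.max.
by do 4![case: ifPn; rewrite -?leNgt => ?]; apply/andP; split; nra.
Qed.

End smooth_step.

(** * Sobolev functions on an interval *)

Section sobolev_representative.
Context {R : realType}.
Local Notation mu := (@lebesgue_measure R).
Implicit Types (a b x y : R) (U W : R -> R).

Lemma integral_smooth_bump a b k : 0 < k -> 2 * k <= b - a ->
  \int[mu]_(x in `[a, b]) smooth_bump a b k x = 1.
Proof.
move=> k0 kab; have ab : a < b by lra.
have D x := is_derive_smooth_step a b k x.
have cS x : {for x, continuous (smooth_step a b k)}.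
  by apply/differentiable_continuous/derivable1_diffP; case: (D x).
rewrite /Rintegral (@continuous_FTC2 _ (smooth_bump a b k) (smooth_step a b k))//.
- by rewrite smooth_step_eq1// smooth_step_eq0// sube0.
- by apply: continuous_subspaceT; exact: continuous_smooth_bump.
- split.
  + by move=> x _; case: (D x).
  + exact/cvg_at_right_filter/cS.
  + exact/cvg_at_left_filter/cS.
- by move=> x _; rewrite derive1E; exact: derive_val.
Qed.

Local Notation kap n := (n.+1%:R^-1 : R).

(** The bumps are dominated by a multiple of the normalized indicator of a
    shrinking ball, so the convergence is that of the averages at a Lebesgue
    point. *)
Lemma cvg_integral_smooth_bump U a : mu.-integrable [set: R] (EFin \o U) ->
  lebesgue_pt U a ->
  (\int[mu]_x (U x * smooth_bump a (a + kap n) (kap n / 2) x))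
    @[n --> \oo] --> U a.
Proof.
move=> iU Ua; have mU : measurable_fun (setT : set (line R)) U.
  by case/integrableP : iU => /measurable_EFinP.
have kap0 n : 0 < kap n by rewrite invr_gt0.
have kab n : 2 * (kap n / 2) <= a + kap n - a by rewrite addrAC subrr add0r mulrC divfK.
have k20 n : 0 < kap n / 2 by rewrite divr_gt0.
pose I n := `[a, a + kap n]%classic : set R.
have mI n : measurable (I n) by exact: measurable_itv.
pose bmp n := smooth_bump a (a + kap n) (kap n / 2).
have bmp0 n x : 0 <= bmp n x by exact: smooth_bump_ge0.
have bmple n x : bmp n x <= 2 / kap n.
  apply: le_trans (smooth_bump_le _ _ _) _ => //.
  have -> : a + kap n - a - kap n / 2 = kap n / 2.
    by rewrite (addrC a) addrK [X in X - _](splitr (kap n)) addrK.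
  by rewrite invf_div.
have mbmp n : measurable_fun (setT : set (line R)) (bmp n).
  by apply: continuous_measurable_fun; exact: continuous_smooth_bump.
have int n : \int[mu]_x (U x * bmp n x) = \int[mu]_(x in I n) (U x * bmp n x).
  rewrite [RHS]Rintegral_mkcond; apply: eq_Rintegral => x _.
  rewrite patchE; case: ifPn => //; rewrite notin_setE /I /= in_itv/= => /negP.
  rewrite negb_and -!ltNge => xab; rewrite /bmp smooth_bump_eq0 ?mulr0//.
  by case/orP : xab => /ltW ->//; rewrite orbT.
have iUI n : mu.-integrable (I n) (EFin \o U) by apply: (integrableS _ _ _ iU).
have ibmp n : mu.-integrable (I n) (EFin \o bmp n).
  apply: continuous_compact_integrable; first exact: segment_compact.
  exact/continuous_subspaceT/continuous_smooth_bump.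
have key n : (`|\int[mu]_x (U x * bmp n x) - U a|%:E <= 8%:E * davg U a (kap n * 2))%E.
  have iUc : mu.-integrable (I n) (EFin \o (fun x => U x - U a)).
    apply: integrable_realB => //; apply: integrable_real_cst; first exact: mI.
    exact: lebesgue_itv_lty.
  have ibc : mu.-integrable (I n) (EFin \o (fun x => (U x - U a) * bmp n x)).
    apply: (integrable_realM (C := 2 / kap n)) => //.
      exact: measurable_funTS.
    by move=> x _; rewrite ger0_norm.
  have -> : \int[mu]_x (U x * bmp n x) - U a =
      \int[mu]_(x in I n) ((U x - U a) * bmp n x).
    under [RHS]eq_Rintegral do rewrite mulrBl.
    rewrite RintegralB//; last 2 first.
    - apply: (integrable_realM (C := 2 / kap n)) => //.
        exact: measurable_funTS.
      by move=> x _; rewrite ger0_norm.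
    - exact: integrable_realZ.
    by rewrite int RintegralZl// integral_smooth_bump// mulr1.
  rewrite EFin_normr_Rintegral//.
  apply: (le_trans (le_abse_integral _ _ _)) => //; first by case/integrableP : ibc.
  rewrite /davg /iavg lebesgue_measure_ball; last by rewrite mulr_ge0 ?ltW.
  have I_ball : I n `<=` ball a (kap n * 2).
    move=> x; rewrite /I /= in_itv/= /ball/= => /andP[ax xa].
    by move: (kap n) (kap0 n) xa => t t0 xa; rewrite ler0_norm; lra.
  have mUc (D : set (line R)) : measurable_fun D (fun x => `|(U x - U a)%:E|%E).
    apply: measurableT_comp => //; apply/measurable_EFinP.
    by apply: measurable_funB => //; apply: measurable_funTS.
  apply: (@le_trans _ _ (\int[mu]_(x in I n) ((2 / kap n)%:E * `|(U x - U a)%:E|))%E).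
    apply: ge0_le_integral => //.
    - by apply: measurableT_comp => //; case/integrableP : ibc.
    - exact: measurable_funeM.
    - move=> x _; rewrite EFinM abseM muleC; apply: lee_wpmul2r => //=.
      by rewrite lee_fin ger0_norm.
  rewrite ge0_integralZl//.
  rewrite muleA inver; case: ifPn => [/eqP h|_].
    by move: (kap0 n); move: h => /eqP; rewrite mulrn_eq0/= mulf_eq0 => /orP[/eqP->|]; 
      rewrite ?ltxx// pnatr_eq0.
  have -> : (8%:E * (kap n * 2 *+ 2)^-1%:E = (2 / kap n)%:E)%E.
    rewrite -EFinM; congr EFin; have := kap0 n; move: (kap n) => t t0.
    by rewrite mulr2n; field; apply/andP; split; apply: lt0r_neq0; lra.
  apply: lee_wpmul2l; first by rewrite lee_fin divr_ge0 // ltW.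
  apply: ge0_subset_integral => //; first exact: measurable_ball.
have kap2 : (kap n * 2) @[n --> \oo] --> (0:R)^'+.
  have c : (kap n * 2) @[n --> \oo] --> (0:R).
    by rewrite -(mul0r 2); apply: cvgM; [exact: cvg_harmonic|exact: cvg_cst].
  move=> A; rewrite /at_right /within /= => H.
  suff : \forall n \near \oo, A (kap n * 2) by [].
  have cH : \forall n \near \oo, 0 < kap n * 2 -> A (kap n * 2) by exact: (c _ H).
  by apply: filterS cH => n; apply; exact: mulr_gt0.
have /fine_cvgP[dfin dcvg] := cvg_comp _ _ kap2 Ua.
apply/cvgrPdist_le => /= e e0.
have e8 : 0 < e / 8 by rewrite divr_gt0.
near=> n.
have dn : davg U a (kap n * 2) \is a fin_num by near: n; exact: dfin.
have dle : `|fine (davg U a (kap n * 2))| <= e / 8.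
  by near: n; exact: (cvgr0_norm_le _ dcvg _ e8).
rewrite distrC -lee_fin; apply: (le_trans (key n)).
rewrite -(fineK dn) -EFinM lee_fin.
by rewrite mulrC -ler_pdivlMr// (le_trans (ler_norm _)).
Unshelve. all: by end_near. Qed.

Lemma cvg_integral_smooth_step W a : mu.-integrable [set: R] (EFin \o W) ->
  (\int[mu]_x (W x * smooth_step a (a + kap n) (kap n / 2) x))
    @[n --> \oo] --> \int[mu]_(x in `]a, +oo[) W x.
Proof.
move=> iW; have /integrableP[/measurable_EFinP mW _] := iW.
have kap0 n : 0 < kap n by rewrite invr_gt0.
have kab n : 2 * (kap n / 2) <= a + kap n - a.
  by rewrite addrAC subrr add0r mulrC divfK.
have k20 n : 0 < kap n / 2 by rewrite divr_gt0.
pose f n x := (W x * smooth_step a (a + kap n) (kap n / 2) x)%:E.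
pose f0 := EFin \o (W \_ `]a, +oo[).
have mS n : measurable_fun (setT : set (line R)) (smooth_step a (a + kap n) (kap n / 2)).
  apply: continuous_measurable_fun => x.
  by apply/differentiable_continuous/derivable1_diffP; case: (is_derive_smooth_step a (a + kap n) (kap n / 2) x).
have [] := @dominated_convergence _ _ _ mu setT _ f f0 (fun x => `|W x|%:E).
- by [].
- by move=> n; apply/measurable_EFinP/measurable_funM.
- apply/measurable_EFinP; apply/(measurable_restrictT _ _).1 => //.
  exact: measurable_funTS.
- apply: aeW => x _ /=; rewrite /f /f0 /= patchE; case: ifPn => xa; last first.
    have -> : (fun n => (W x * smooth_step a (a + kap n) (kap n / 2) x)%:E) = cst 0%:E.
      apply/funext => n; rewrite smooth_step_eq0 ?mulr0//.
      by move: xa; rewrite notin_setE/= in_itv/= andbT => /negP; rewrite -leNgt.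
    exact: cvg_cst.
  apply: cvg_near_cst; have xa' : 0 < x - a by move: xa; rewrite inE/= in_itv/= andbT subr_gt0.
  near=> n; rewrite smooth_step_eq1 ?mulr1//.
  have : `|kap n| <= x - a by near: n; exact: (cvgr0_norm_le _ cvg_harmonic).
  by move=> /(le_trans (ler_norm _)); rewrite lerBrDl.
- exact: integrable_norm.
- apply: aeW => x n _ /=; rewrite lee_fin normrM ler_piMr//.
  by have /andP[? ?] := smooth_step_itv x (k20 n) (kab n); rewrite ger0_norm.
move=> if0 _ H; have := H; rewrite -(fineK (integrable_fin_num _ if0))//.
move=> /fine_cvgP[_].
by rewrite [X in _ -> _ --> X]Rintegral_mkcond.
Unshelve. all: by end_near. Qed.

(** Testing the weak derivative against the
    difference of two smooth steps and letting the steps become sharp at two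
    Lebesgue points [a < b] gives [u b - u a] as the integral of the weak
    derivative over [a, b]. *)
Lemma H1_increment l u w a b :
  is_L2 l u -> is_weak_derivative l u w ->
  lebesgue_pt (u \_ `]0, l[) a -> lebesgue_pt (u \_ `]0, l[) b ->
  0 < a -> a < b -> b < l ->
  mu.-integrable [set: R] (EFin \o (u \_ `]0, l[)) ->
  mu.-integrable [set: R] (EFin \o (w \_ `]0, l[)) ->
  u b - u a = \int[mu]_(x in `]a, b]) w x.
Proof.
move=> uL2 [wL2 uw] La Lb a0 ab bl iU iW.
set U := u \_ _ in La Lb iU; set W := w \_ _ in iW.
have kap0 n : 0 < kap n by rewrite invr_gt0.
have kab c n : 2 * (kap n / 2) <= c + kap n - c.
  by rewrite addrAC subrr add0r mulrC divfK.
have k20 n : 0 < kap n / 2 by rewrite divr_gt0.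
pose S c n := smooth_step c (c + kap n) (kap n / 2).
pose B c n := smooth_bump c (c + kap n) (kap n / 2).
pose psi n x := S a n x - S b n x.
have dpsi n x : is_derive x 1 (psi n) (B a n x - B b n x).
  have Da := is_derive_smooth_step a (a + kap n) (kap n / 2) x.
  have Db := is_derive_smooth_step b (b + kap n) (kap n / 2) x.
  exact: is_deriveB.
have psi1 n : derive1 (psi n) = fun x => B a n x - B b n x.
  by apply/funext => x; rewrite derive1E; exact: derive_val.
have test n : b + kap n < l -> is_test l (psi n).
  move=> bn; split.
  - by move=> x; case: (dpsi n x).
  - by rewrite psi1 => x; apply: cvgB; exact: continuous_smooth_bump.
  - exists a, (b + kap n); split => // x.
    rewrite in_itv/= negb_and -!ltNge => /orP[xa|xb].
      by rewrite /psi /S !smooth_step_eq0 ?subrr// ltW// (lt_trans xa).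
    rewrite /psi /S !smooth_step_eq1 ?subrr// ltW//.
    by apply: le_lt_trans xb; rewrite lerD2r ltW.
have BU c n : mu.-integrable [set: R] (EFin \o (fun x => U x * B c n x)).
  apply: (integrable_realM (C := 2 / kap n)) => //.
    by apply: continuous_measurable_fun; exact: continuous_smooth_bump.
  move=> x _; rewrite ger0_norm ?smooth_bump_ge0//.
  apply: le_trans (smooth_bump_le _ _ _) _ => //.
  have -> : c + kap n - c - kap n / 2 = kap n / 2.
    by rewrite (addrC c) addrK [X in X - _](splitr (kap n)) addrK.
  by rewrite invf_div.
have SW c n : mu.-integrable [set: R] (EFin \o (fun x => W x * S c n x)).
  apply: (integrable_realM (C := 1)) => //.
    apply: continuous_measurable_fun => x.
    by apply/differentiable_continuous/derivable1_diffP;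
      case: (is_derive_smooth_step c (c + kap n) (kap n / 2) x).
  move=> x _; have /andP[? ?] := smooth_step_itv x (k20 n) (kab c n).
  by rewrite ger0_norm.
have E n : b + kap n < l ->
    \int[mu]_x (U x * B a n x) - \int[mu]_x (U x * B b n x) =
    - (\int[mu]_x (W x * S a n x) - \int[mu]_x (W x * S b n x)).
  move=> bn; have := uw _ (test n bn).
  rewrite Rintegral_mkcond [in X in _ = - X -> _]Rintegral_mkcond.
  rewrite -!RintegralB// => H.
  transitivity (\int[mu]_x ((fun x : R => u x * derive1 (psi n) x) \_ `]0, l[) x).
    apply: eq_Rintegral => x _; rewrite psi1 /U !patchE.
    by case: ifPn => _; rewrite ?mulrBr// !mul0r subrr.
  rewrite H; congr (- _); apply: eq_Rintegral => x _; rewrite /W !patchE.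
  by case: ifPn => _; rewrite ?mulrBr// !mul0r subrr.
have lim1 : \int[mu]_x (U x * B a n x) - \int[mu]_x (U x * B b n x)
    @[n --> \oo] --> U a - U b.
  by apply: cvgB; exact: cvg_integral_smooth_bump.
have lim2 : - (\int[mu]_x (W x * S a n x) - \int[mu]_x (W x * S b n x))
    @[n --> \oo] --> - (\int[mu]_(x in `]a, +oo[) W x - \int[mu]_(x in `]b, +oo[) W x).
  by apply: cvgN; apply: cvgB; exact: cvg_integral_smooth_step.
have near_eq : \forall n \near \oo, b + kap n < l.
  have lb : 0 < l - b by rewrite subr_gt0.
  near=> n.
  have : `|kap n| < l - b by near: n; exact: (cvgr0_norm_lt _ cvg_harmonic).
  by rewrite ger0_norm ?ltW// ltrBrDl.
have lim1' : \int[mu]_x (U x * B a n x) - \int[mu]_x (U x * B b n x)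
    @[n --> \oo] --> - (\int[mu]_(x in `]a, +oo[) W x - \int[mu]_(x in `]b, +oo[) W x).
  by apply: cvg_trans lim2; apply: near_eq_cvg; apply: filterS near_eq => n /E.
have := cvg_unique _ lim1 lim1' => /(_ _)/= UE.
have Uu c : 0 < c -> c < l -> U c = u c.
  by move=> c0 cl; rewrite /U patchE ifT// inE/= in_itv/= c0 cl.
rewrite -(Uu b) ?(lt_trans a0)// -(Uu a) ?(lt_trans ab)//.
rewrite -[LHS]opprB UE ?opprK//.
have iWa : mu.-integrable `]a, +oo[ (EFin \o W) by apply: (integrableS _ _ _ iW).
have /(_ _ _)/= := @Rintegral_itvB _ W (BRight a) +oo%O b iWa.
rewrite !bnd_simp => /(_ (ltW ab) isT) <-.
rewrite opprB addrC subrK; apply: eq_Rintegral => x; rewrite inE/= in_itv/= => /andP[ax xb].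
by rewrite /W patchE ifT// inE/= in_itv/= (lt_trans a0 ax) (le_lt_trans xb).
Unshelve. all: by end_near. Qed.

Lemma is_L2_integrable l u : is_L2 l u ->
  mu.-integrable `]0, l[ (EFin \o u).
Proof.
move=> [mu_ u2]; have l1 : mu.-integrable `]0, l[ (EFin \o (fun x => 1 + u x ^+ 2)).
  apply: integrable_realD => //.
  by apply: integrable_real_cst => //; exact: lebesgue_itv_lty.
apply: (@le_integrable _ _ _ mu `]0, l[%classic _ _ _ _ _ l1) => //.
  exact/measurable_EFinP.
move=> x _; rewrite /= lee_fin [leRHS]ger0_norm; last by rewrite addr_ge0 ?sqr_ge0.
by rewrite ler_norml; apply/andP; split; nra.
Qed.

Lemma integrable_patch (D : set (line R)) (f : R -> R) : measurable D ->
  mu.-integrable D (EFin \o f) -> mu.-integrable [set: R] (EFin \o (f \_ D)).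
Proof.
by move=> mD; rewrite integrable_mkcond// restrict_EFin.
Qed.

(** The representative is the primitive of the weak derivative, normalized at one
    Lebesgue point; it agrees with [u] at every other one by [H1_increment]. *)
Lemma H1_representative l u w : 0 < l ->
  is_L2 l u -> is_weak_derivative l u w ->
  exists g, [/\ {within `[0, l], continuous g},
    ae_eq mu `]0, l[%classic (g : line R -> R) u &
    forall x y, 0 <= x -> x <= y -> y <= l ->
      g y - g x = \int[mu]_(t in `]x, y]) (w \_ `]0, l[) t].
Proof.
move=> l0 uL2 wu; have [wL2 _] := wu.
have iU : mu.-integrable [set: R] (EFin \o (u \_ `]0, l[)).
  by apply: integrable_patch => //; exact: is_L2_integrable.
have iW : mu.-integrable [set: R] (EFin \o (w \_ `]0, l[)).
  by apply: integrable_patch => //; exact: is_L2_integrable.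
set U := u \_ _ in iU; set W := w \_ _ in iW.
have leb : {ae mu, forall x, lebesgue_pt U x}.
  apply: lebesgue_differentiation.
  by apply: integrable_locally_restrict => //; exact: is_L2_integrable.
have [a [a0 al La]] : exists a, [/\ 0 < a, a < l & lebesgue_pt U a].
  apply: contrapT => /forallNP na.
  have [N [mN N0 NU]] := leb.
  have : (mu `]0%R, l[ <= mu N)%E.
    apply: (@le_measure _ _ _ mu);
      [by rewrite inE; exact: measurable_itv|by rewrite inE|].
    move=> x /=; rewrite in_itv/= => /andP[x0 xl]; apply: NU => /= Lx.
    by apply: (na x).
  by rewrite N0 lebesgue_measure_itv/= lte_fin l0 sube0 lee_fin leNgt l0.
pose g x := u a + (\int[mu]_(t in `[0, x]) W t - \int[mu]_(t in `[0, a]) W t).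
have iWs (i : interval R) : mu.-integrable [set` i] (EFin \o W).
  by apply: (integrableS _ _ _ iW).
have inc x y : 0 <= x -> x <= y ->
    \int[mu]_(t in `[0, y]) W t - \int[mu]_(t in `[0, x]) W t =
    \int[mu]_(t in `]x, y]) W t.
  by move=> x0 xy; rewrite Rintegral_itvB ?bnd_simp.
exists g; split.
- move=> x; apply: cvgD; first exact: cvg_cst.
  apply: cvgB; last exact: cvg_cst.
  exact: (parameterized_integral_continuous (ltW l0) (iWs _)).
- have [N [mN N0 NU]] := leb; exists N; split => // x /= nx; apply: NU => /= Lx.
  apply: nx; rewrite in_itv/= => /andP[x0 xl].
  have wW c e : 0 <= c -> e < l ->
      \int[mu]_(t in `]c, e]) w t = \int[mu]_(t in `]c, e]) W t.
    move=> c0 el; apply: eq_Rintegral => t; rewrite inE/= in_itv/= => /andP[ct te].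
    by rewrite /W patchE ifT// inE/= in_itv/= (le_lt_trans c0) ?(le_lt_trans te).
  have [ax|xa|<-] := ltgtP a x; last by rewrite /g subrr addr0.
  + rewrite /g inc ?(ltW a0) ?(ltW ax)// -wW ?(ltW a0)//.
    by rewrite -(H1_increment uL2 wu La Lx a0 ax xl iU iW) addrC subrK.
  + rewrite /g -opprB inc ?(ltW x0) ?(ltW xa)// -wW ?(ltW x0)//.
    by rewrite -(H1_increment uL2 wu Lx La x0 xa al iU iW) opprB addrC subrK.
- move=> x y x0 xy yl; rewrite /g -inc//; ring.
Qed.

End sobolev_representative.

(** * Measures with densities *)

Section has_density.
Context {dT : measure_display} {T : measurableType dT} {R : realType}.
Implicit Types (nu : {finite_measure set T -> \bar R})
  (mu : {sigma_finite_measure set T -> \bar R}) (p f : T -> R).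

(** Unlike an equality almost everywhere with a Radon-Nikodym derivative, this
    form of the relation composes and transports integrals directly. *)
Definition has_density nu mu p := [/\ measurable_fun setT p,
  forall x, 0 <= p x &
  forall A, measurable A -> nu A = (\int[mu]_(x in A) (p x)%:E)%E].

Lemma has_density_integrable nu mu p : has_density nu mu p ->
  mu.-integrable setT (EFin \o p).
Proof.
move=> [mp p0 nup]; apply/integrableP; split; first exact/measurable_EFinP.
under eq_integral do rewrite /= ger0_norm//.
by rewrite -nup// -ge0_fin_numE// fin_num_measure.
Qed.

Lemma has_density_dominates nu mu p : has_density nu mu p -> nu `<< mu.
Proof.
move=> [mp p0 nup]; apply/null_content_dominatesP => A mA A0.
rewrite nup//; apply: null_set_integral => //.
by apply/measurable_EFinP; exact: measurable_funTS.
Qed.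

Lemma has_density_unique nu mu p : has_density nu mu p ->
  ae_eq mu setT ('d (charge_of_finite_measure nu) '/d mu) (EFin \o p).
Proof.
move=> h; have numu := has_density_dominates h.
have ip := has_density_integrable h; have [mp p0 nup] := h.
apply: integral_ae_eq => //.
- exact: Radon_Nikodym_integrable.
- exact/measurable_EFinP.
- by move=> A _ mA; rewrite -Radon_Nikodym_integral//; exact: nup.
Qed.

Lemma ge0_integral_density nu mu p E (f : T -> \bar R) :
  has_density nu mu p -> measurable E -> measurable_fun E f ->
  (forall x, E x -> (0 <= f x)%E) ->
  (\int[nu]_(x in E) f x = \int[mu]_(x in E) (f x * (p x)%:E))%E.
Proof.
move=> h mE mf f0; have numu := has_density_dominates h.
have [mp p0 nup] := h.
have mfE : measurable_fun setT (f \_ E) by apply/(measurable_restrictT _ _).1.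
have fE0 x : (0 <= (f \_ E) x)%E.
  by rewrite patchE; case: ifPn => // /set_mem; exact: f0.
transitivity (\int[nu]_x (f \_ E) x)%E; first by rewrite integral_mkcond.
rewrite -(Radon_Nikodym_SigmaFinite.change_of_variables numu)//.
transitivity (\int[mu]_x ((f \_ E) x * (p x)%:E))%E.
  apply: ae_eq_integral => //.
  - apply: emeasurable_funM => //.
    exact: measurable_int (Radon_Nikodym_SigmaFinite.f_integrable numu).
  - by apply: emeasurable_funM => //; exact/measurable_EFinP.
  - have h1 := ae_eq_Radon_Nikodym_SigmaFinite numu (@measurableT _ T).
    have h2 := has_density_unique h.
    exact/ae_eqe_mul2l/(ae_eq_trans h1 h2).
rewrite [RHS]integral_mkcond; apply: eq_integral => x _.
by rewrite !patchE; case: ifPn => // _; rewrite mul0e.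
Qed.

Lemma integrable_density nu mu p E f : has_density nu mu p -> measurable E ->
  measurable_fun E f ->
  nu.-integrable E (EFin \o f) = mu.-integrable E (EFin \o (fun x => f x * p x)).
Proof.
move=> h mE mf; have [mp p0 nup] := h.
have mfp : measurable_fun E (EFin \o (fun x => f x * p x)).
  by apply/measurable_EFinP; apply: measurable_funM => //; exact: measurable_funTS.
have mf' : measurable_fun E (EFin \o f) by exact/measurable_EFinP.
have eq : (\int[nu]_(x in E) `|(f x)%:E| =
    \int[mu]_(x in E) `|(f x * p x)%:E|)%E.
  rewrite (ge0_integral_density h)//; last exact: measurableT_comp.
  apply: eq_integral => x _.
  by rewrite /= -EFinM normrM (ger0_norm (p0 x)).
apply/idP/idP => /integrableP[_ H]; apply/integrableP; split => //.
  exact: (eq_ind _ (fun z => z < +oo)%E H _ eq).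
exact: (eq_ind _ (fun z => z < +oo)%E H _ (esym eq)).
Qed.

Lemma Rintegral_density nu mu p E f : has_density nu mu p -> measurable E ->
  nu.-integrable E (EFin \o f) ->
  \int[nu]_(x in E) f x = \int[mu]_(x in E) (f x * p x).
Proof.
move=> h mE fi; have [mp p0 nup] := h.
have /measurable_EFinP mf : measurable_fun E (EFin \o f) by case/integrableP : fi.
suff E1 : (\int[nu]_(x in E) (f x)%:E = \int[mu]_(x in E) (f x * p x)%:E)%E.
  by rewrite /Rintegral E1.
rewrite [LHS]integralE [RHS]integralE; congr (_ - _)%E.
- rewrite (ge0_integral_density h mE);
    [|exact/measurable_funepos/measurable_EFinP|by move=> x _; exact: funepos_ge0].
  apply: eq_integral => x _; rewrite !funeposE /= -EFin_max -EFinM -EFin_max.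
  by congr EFin; rewrite maxr_pMl// mul0r.
- rewrite (ge0_integral_density h mE);
    [|exact/measurable_funeneg/measurable_EFinP|by move=> x _; exact: funeneg_ge0].
  apply: eq_integral => x _; rewrite !funenegE /= -EFin_max -EFinM -EFin_max.
  by congr EFin; rewrite maxr_pMl// mul0r mulNr.
Qed.

Lemma has_density_trans (rho nu : {finite_measure set T -> \bar R}) mu u p :
  has_density rho nu u -> has_density nu mu p ->
  has_density rho mu (fun x => u x * p x).
Proof.
move=> [mu_ u0 rhou] h; have [mp p0 nup] := h; split.
- exact: measurable_funM.
- by move=> x; rewrite mulr_ge0.
- move=> A mA; rewrite rhou// (ge0_integral_density h)//.
  + by apply/measurable_EFinP; exact: measurable_funTS.
  + by move=> x _; rewrite lee_fin.
Qed.

Lemma has_density_eq nu mu p (q : T -> R) : has_density nu mu p ->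
  measurable_fun setT q -> (forall x, 0 <= q x) ->
  ae_eq mu setT p q -> has_density nu mu q.
Proof.
move=> [mp p0 nup] mq q0 pq; split => // A mA; rewrite nup//.
apply: ae_eq_integral => //.
- by apply/measurable_EFinP; exact: measurable_funTS.
- by apply/measurable_EFinP; exact: measurable_funTS.
- case: pq => N [mN N0 NU]; exists N; split => // x /= nx; apply: NU => /= pqx.
  by apply: nx => Ax; rewrite pqx.
Qed.

(** The Radon-Nikodym derivative is nonnegative only almost everywhere; the
    positive part makes it a density in the sense above. *)
Lemma RN_has_density nu (mu : {finite_measure set T -> \bar R}) : nu `<< mu ->
  has_density nu mu (fun x => Num.max 0
    (fine (('d (charge_of_finite_measure nu) '/d mu) x))).
Proof.
move=> numu; set r := 'd _ '/d _.
have ri : mu.-integrable setT r by exact: Radon_Nikodym_integrable.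
have mr : measurable_fun setT r by exact: measurable_int ri.
have rf x : r x \is a fin_num by exact: Radon_Nikodym_fin_num.
split.
- by apply: measurable_maxr => //; exact: measurableT_comp.
- by move=> x; rewrite le_max lexx.
- move=> A mA.
  have := Radon_Nikodym_SigmaFinite.f_integral numu mA => ->.
  have h1 := ae_eq_Radon_Nikodym_SigmaFinite numu (@measurableT _ T).
  apply: ae_eq_integral => //.
  + exact/measurable_funTS/(measurable_int _ (Radon_Nikodym_SigmaFinite.f_integrable numu)).
  + apply/measurable_EFinP; apply: measurable_maxr => //; apply: measurableT_comp => //.
    exact: measurable_funTS.
  + case: h1 => N [mN N0 NU]; exists N; split => // x /= nx; apply: NU => /= fx.
    apply: nx => _; rewrite -[X in fine (X _)]/r.
    have f0 := Radon_Nikodym_SigmaFinite.f_ge0 numu x.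
    have rx := fx I; rewrite -/r in rx.
    rewrite -rx; have ff := Radon_Nikodym_SigmaFinite.f_fin_num numu x.
    by rewrite max_r ?fine_ge0// fineK.
Qed.

End has_density.

(** * Fisher information and continuous densities *)

Section continuous_representatives.
Context {R : realType}.
Local Notation mu := (@lebesgue_measure R).
Implicit Types (l : R) (f g u : R -> R).

Lemma within_itv_continuous_eq l f g : 0 < l ->
  {within `[0, l], continuous f} -> {within `[0, l], continuous g} ->
  ae_eq mu `]0, l[%classic (f : line R -> R) g ->
  forall x, x \in `[0, l] -> f x = g x.
Proof.
move=> l0 cf cg fg x xl; apply: contrapT => /eqP fgx.
pose h y := f y - g y.
have ch : {within `[0, l], continuous h} by move=> y; apply: cvgB; [exact: cf|exact: cg].
have hx : 0 < `|h x| by rewrite normr_gt0 subr_eq0.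
have [e /= e0 He] : exists2 e : R, 0 < e &
    forall y, y \in `[0, l] -> `|y - x| < e -> h y != 0.
  have /subspace_continuousP/(_ x xl)/cvgrPdist_lt/(_ _ hx) := ch.
  rewrite near_withinE => -[e /= e0 He]; exists e => // y yl yx.
  have := He y; rewrite /ball/= distrC => /(_ yx yl).
  move=> H; apply/eqP => hy; have : `|h x - h y| < `|h x| by exact: H.
  by rewrite hy subr0 ltxx.
pose a := Num.max 0 (x - e); pose b := Num.min l (x + e).
have /andP[x0 xl'] : 0 <= x <= l by move: xl; rewrite in_itv.
have ab : a < b.
  by rewrite /a /b gt_max !lt_min; apply/andP; split; apply/andP; split; lra.
have [N [mN N0 NU]] := fg.
have : (mu `]a, b[ <= mu N)%E.
  apply: (@le_measure _ _ _ mu);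
    [by rewrite inE; exact: measurable_itv|by rewrite inE|].
  move=> y /=; rewrite in_itv/= /a /b gt_max lt_min => /andP[/andP[y0 y1] /andP[y2 y3]].
  apply: NU => /= fgy.
  have yl : y \in `[0, l] by rewrite in_itv/= !ltW.
  have yx : `|y - x| < e by rewrite ltr_norml; apply/andP; split; lra.
  have := He _ yl yx; rewrite /h fgy ?subrr ?eqxx//.
  by rewrite in_itv/= y0 y2.
by rewrite N0 lebesgue_measure_itv/= lte_fin ab -EFinB lee_fin subr_le0 leNgt ab.
Qed.

Lemma cont_repE l u g : 0 < l -> {within `[0, l], continuous g} ->
  ae_eq mu `]0, l[%classic (g : line R -> R) u ->
  forall x, x \in `[0, l] -> cont_rep l u x = g x.
Proof.
move=> l0 cg gu x xl; rewrite /cont_rep.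
case: xgetP => [f _ [cf fu]|/(_ g)]; last by case.
apply: (within_itv_continuous_eq l0 cf cg) => //.
exact: ae_eq_trans fu (ae_eq_sym gu).
Qed.

Lemma within_itv_measurable l f : {within `[0, l], continuous f} ->
  measurable_fun (`[0, l] : set (line R)) f.
Proof. by move=> cf; exact: subspace_continuous_measurable_fun. Qed.

Lemma within_itv_bounded l f : {within `[0, l], continuous f} ->
  exists2 C, 0 <= C & forall x, x \in `[0, l] -> `|f x| <= C.
Proof.
move=> cf.
have /compact_bounded[C [_ HC]] : compact (f @` `[0, l]%classic).
  by apply: continuous_compact => //; exact: segment_compact.
exists (`|C| + 1); first by rewrite addr_ge0.
move=> x xl; apply: (HC (`|C| + 1)); last by exists x.
by rewrite (le_lt_trans (ler_norm _))// ltrDl.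
Qed.

Lemma within_itv_integrable l f (m : {finite_measure set (line R) -> \bar R}) :
  {within `[0, l], continuous f} -> m.-integrable `[0, l] (EFin \o f).
Proof.
move=> cf; have [C C0 fC] := within_itv_bounded cf.
apply: (integrable_real_bounded (C := C)) => //.
- by rewrite -ge0_fin_numE// fin_num_measure.
- exact: within_itv_measurable.
Qed.

End continuous_representatives.

Section potential.
Context {R : realType}.
Local Notation mu := (@lebesgue_measure R).
Variables (l : R) (P : R -> R).
Hypothesis l0 : 0 < l.
Hypothesis lipP : [lipschitz P x | x in `[0, l]].

Lemma lipschitz_potential : exists2 k, 0 <= k &
  forall x y, x \in `[0, l] -> y \in `[0, l] -> `|P x - P y| <= k * `|x - y|.
Proof.
have [k [kr Hk]] := lipP.
exists (`|k| + 1); first by rewrite addr_ge0.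
move=> x y xl yl.
have kk : k < `|k| + 1 by rewrite (le_lt_trans (ler_norm _))// ltrDl.
exact: (Hk _ kk (x, y) (conj xl yl)).
Qed.

Lemma continuous_potential : {within `[0, l], continuous P}.
Proof.
have [k k0 Pk] := lipschitz_potential.
apply/subspace_continuousP => x xl; apply/cvgrPdist_le => /= e e0.
have k1 : 0 < k + 1 by rewrite ltr_wpDl.
have d0 : 0 < e / (k + 1) by rewrite divr_gt0.
rewrite near_withinE; near=> y => yl.
apply: (le_trans (Pk _ _ xl yl)).
have : `|x - y| <= e / (k + 1).
  by apply: ltW; near: y; exact: nbhsx_ballx.
move=> h; apply: (@le_trans _ _ ((k + 1) * `|x - y|)).
  by rewrite ler_wpM2r// lerDl.
by rewrite mulrC -ler_pdivlMr.
Unshelve. all: by end_near. Qed.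

Lemma potential_bounds : exists2 Q, 0 < Q &
  forall x, x \in `[0, l] -> expR (P x) <= Q /\ expR (- P x) <= Q.
Proof.
have [C C0 PC] := within_itv_bounded continuous_potential.
exists (expR C); first exact: expR_gt0.
by move=> x /PC; rewrite ler_norml => /andP[? ?]; rewrite !ler_expR; split; lra.
Qed.

Definition gibbs_density : R -> R := (fun x => expR (- P x)) \_ `[0, l].

Lemma measurable_expRN : measurable_fun (`[0, l] : set (line R)) (fun x => expR (- P x)).
Proof.
apply: measurableT_comp => //; apply: measurableT_comp => //.
exact: within_itv_measurable continuous_potential.
Qed.

Lemma gibbs_has_density (pi : {finite_measure set (line R) -> \bar R}) :
  (forall A : set (line R), measurable A -> pi A =
    (\int[mu]_(x in A `&` `[0%R, l]%classic) (expR (- P x))%:E)%E) ->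
  has_density pi mu gibbs_density.
Proof.
move=> Hpi; split.
- by apply/(measurable_restrictT _ _).1 => //; exact: measurable_expRN.
- by move=> x; rewrite /gibbs_density patchE; case: ifPn => // _; exact: expR_ge0.
- move=> A mA; rewrite Hpi// integral_mkcondr; apply: eq_integral => x _.
  by rewrite /gibbs_density !patchE; case: ifPn.
Qed.

End potential.

Section fisher_representative.
Context {R : realType}.
Local Notation mu := (@lebesgue_measure R).
Variables (l : R) (P : R -> R).
Hypothesis l0 : 0 < l.
Hypothesis lipP : [lipschitz P x | x in `[0, l]].
Variables rho pi : {finite_measure set (line R) -> \bar R}.
Hypothesis Hpi : forall A : set (line R), measurable A -> pi A =
    (\int[mu]_(x in A `&` `[0%R, l]%classic) (expR (- P x))%:E)%E.
Hypothesis rhopi : rho `<< pi.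
Hypothesis rho_conc : rho.-null_set (~` `[0, l]).
Local Notation sd := (fun x => Num.sqrt (density rho pi x)).
Hypothesis sdH1 : is_H1 l sd.
Hypothesis fin_fisher :
  (\int[pi]_(x in `]0%R, l[) (weak_derivative l sd x ^+ 2)%:E < +oo)%E.

(** Here [g] is the continuous representative of the square root of the density of
    [rho] with respect to [pi], and [J] the primitive of the density of its
    Fisher information; the last clause is the fundamental theorem of calculus
    for [g] followed by Young's inequality, whose weight is the free
    parameter [z]. *)
Lemma fisher_representative : exists g J : R -> R,
  [/\ {within `[0, l], continuous g} /\ (forall x, x \in `[0, l] -> 0 <= g x),
    forall x, x \in `[0, l] -> cont_rep l sd x = g x,
    forall x, x \in `[0, l] ->
      cont_rep l (density rho mu) x = g x ^+ 2 * expR (- P x),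
    has_density rho mu ((fun x => g x ^+ 2 * expR (- P x)) \_ `[0, l]) &
    [/\ forall x y, 0 <= x -> x <= y -> y <= l -> J x <= J y,
      (J l - J 0)%:E =
        (\int[pi]_(x in `]0%R, l[) (weak_derivative l sd x ^+ 2)%:E)%E &
      forall x y z Q, 0 <= x -> x <= y -> y <= l ->
        (forall t, t \in `[x, y] -> expR (P t) <= Q) ->
        z * (g y - g x) <= 2 * (J y - J x) + z ^+ 2 * Q * (y - x) / 8]].
Proof.
set w := weak_derivative l sd.
have fin_w : (\int[pi]_(x in `]0%R, l[) (w x ^+ 2)%:E < +oo)%E := fin_fisher.
have [sdL2 sdw] := sdH1.
have ww : is_weak_derivative l sd w.
  by rewrite /w /weak_derivative; case: xgetP => [? _ //|]; case: sdw => v vw /(_ v).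
have [g0 [cg0 g0sd g0w]] := H1_representative l0 sdL2 ww.
have [cP expRNc] : {within `[0, l], continuous P} /\
    {within `[0, l], continuous (fun x => expR (- P x))}.
  have cP := continuous_potential lipP; split => // x.
  apply: continuous_comp; last exact: continuous_expR.
  by apply: cvgN; exact: cP.
have ge0 x : x \in `[0, l] -> 0 <= g0 x.
  move=> xl.
  suff -> : g0 x = `|g0 x| by [].
  apply: (within_itv_continuous_eq (g := fun y => `|g0 y|) l0 cg0) => //.
    by move=> y; apply: continuous_comp; [exact: cg0|exact: norm_continuous].
  have [N [mN N0 NU]] := g0sd; exists N; split => // y /= ny.
  apply: NU => /= gy; apply: ny => yl; rewrite (gy yl).
  by rewrite ger0_norm// sqrtr_ge0.
have hpi := gibbs_has_density lipP Hpi.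
set p := gibbs_density l P in hpi.
have pE x : x \in `[0, l] -> p x = expR (- P x).
  by move=> xl; rewrite /p /gibbs_density patchE mem_set.
have hrho := RN_has_density rhopi.
set u0 := (fun x => Num.max 0 _) in hrho.
have sdu x : sd x = Num.sqrt (u0 x).
  rewrite /u0 /density /Num.max; case: ifPn => //; rewrite -leNgt => h.
  by rewrite sqrtr0 ler0_sqrtr.
have u00 x : 0 <= u0 x by rewrite /u0 le_max lexx.
pose q := (fun x => g0 x ^+ 2 * expR (- P x)) \_ `[0, l].
have cq : {within `[0, l], continuous (fun x => g0 x ^+ 2 * expR (- P x))}.
  move=> x; apply: cvgM; last exact: expRNc.
  by apply: cvgM; exact: cg0.
have q0 x : 0 <= q x.
  rewrite /q patchE; case: ifPn => // _.
  by rewrite mulr_ge0 ?sqr_ge0// expR_ge0.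
have mq : measurable_fun (setT : set (line R)) q.
  apply/(measurable_restrictT _ _).1 => //.
  exact: within_itv_measurable cq.
have u0q : ae_eq mu `]0, l[%classic (fun x => u0 x * p x) q.
  have [N [mN N0 NU]] := g0sd; exists N; split => // x /= nx.
  apply: NU => /= gx; apply: nx => xl; have gx' := gx xl.
  have xl' : x \in `[0, l] by apply: subset_itv_oo_cc; exact: xl.
  rewrite pE// /q patchE mem_set//; congr (_ * _).
  by rewrite gx' sdu sqr_sqrtr.
have hrhom := has_density_trans hrho hpi.
have hq : has_density rho mu q.
  apply: (has_density_eq hrhom mq q0).
  have [N [mN N0 NU]] := u0q.
  have m1 (c : R) : measurable ([set c] : set (line R)) by exact: measurable_set1.
  have m2 : measurable ([set 0; l] : set (line R)) by exact: measurableU.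
  have z2 : mu [set 0; l] = 0%E.
    by rewrite measureU0//; exact: lebesgue_measure_set1.
  exists (N `|` [set 0; l]); split.
  - exact: measurableU.
  - by rewrite measureU0.
  - move=> x /= nx; rewrite /setU/=.
    have [->|/eqP x0] := eqVneq x 0; first by right; left.
    have [->|/eqP xl] := eqVneq x l; first by right; right.
    left; apply: NU => /= h; apply: nx => _.
    have [xin|xout] := boolP (x \in `]0, l[); first exact: h.
    have xout' : x \notin `[0, l].
      apply: contra xout; rewrite !in_itv/= => /andP[a b].
      by rewrite !lt_neqAle a b !andbT eq_sym; apply/andP; split; exact/eqP.
    rewrite /q /p /gibbs_density !patchE ifF ?mulr0; last first.
      by apply/negbTE; rewrite notin_setE; exact/negP.
    by rewrite ifF//; apply/negbTE; rewrite notin_setE; exact/negP.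
have qd : ae_eq mu `]0, l[%classic
    ((fun x => g0 x ^+ 2 * expR (- P x)) : line R -> R) (density rho mu).
  have [N [mN N0 NU]] := has_density_unique hq; exists N; split => // x /= nx.
  apply: NU => /= h; apply: nx => xl.
  rewrite /density; have -> := h I; rewrite /= /q patchE mem_set//=.
  by apply: subset_itv_oo_cc; exact: xl.
set W := (w \_ `]0, l[) in g0w.
pose k x := W x ^+ 2 * p x.
have wp : (\int[pi]_(x in `]0%R, l[) (w x ^+ 2)%:E =
    \int[mu]_x (k x)%:E)%E.
  rewrite (ge0_integral_density hpi)//; last 2 first.
  - by apply/measurable_EFinP; apply: measurable_funX; case: ww => [[]].
  - by move=> x _; rewrite lee_fin sqr_ge0.
  rewrite integral_mkcond; apply: eq_integral => x _.
  rewrite /k /W !patchE; case: ifPn => // _.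
  by rewrite expr0n mul0r.
have mW : measurable_fun (setT : set (line R)) W.
  by apply/(measurable_restrictT _ _).1 => //; case: ww => [[]].
have p0 x : 0 <= p x by case: hpi.
have mp : measurable_fun (setT : set (line R)) p by case: hpi.
have k0 x : 0 <= k x by rewrite /k mulr_ge0 ?sqr_ge0.
have ik : mu.-integrable [set: R] (EFin \o k).
  apply/integrableP; split.
    by apply/measurable_EFinP; apply: measurable_funM => //; exact: measurable_funX.
  under eq_integral do rewrite /= (ger0_norm (k0 _)).
  by rewrite -wp.
have iks (i : interval R) : mu.-integrable [set` i] (EFin \o k).
  by apply: (integrableS _ _ _ ik).
have iW : mu.-integrable [set: R] (EFin \o W).
  by apply: integrable_patch => //; apply: is_L2_integrable; case: ww.
have iWs (i : interval R) : mu.-integrable [set` i] (EFin \o W).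
  by apply: (integrableS _ _ _ iW).
pose J x := \int[mu]_(t in `[0, x]) k t.
have JB x y : 0 <= x -> x <= y -> J y - J x = \int[mu]_(t in `]x, y]) k t.
  by move=> x0 xy; rewrite /J Rintegral_itvB ?bnd_simp.
exists g0, J; split => //.
- exact: cont_repE.
- exact: cont_repE.
split.
- move=> x y x0 xy yl; rewrite -subr_ge0 JB//.
  by apply: Rintegral_ge0 => t _.
- rewrite wp (JB _ _ (lexx _) (ltW l0)).
  have -> : (\int[mu]_x (k x)%:E = \int[mu]_(x in `]0%R, l]) (k x)%:E)%E.
    rewrite [RHS]integral_mkcond; apply: eq_integral => x _.
    rewrite patchE; case: ifPn => //; rewrite notin_setE/= => /negP xl.
    rewrite /k /W patchE ifF ?expr0n ?mul0r//.
    apply/negbTE; rewrite notin_setE/=; apply/negP.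
    by apply: contra xl; rewrite !in_itv/= => /andP[-> /ltW ->].
  by rewrite fineK//; exact: (integrable_fin_num _ (iks _)).
- move=> x y z Q x0 xy yl HQ.
  rewrite JB// g0w// -RintegralZl//.
  have Q0 : 0 <= Q by apply: le_trans (HQ x _); rewrite ?expR_ge0// in_itv/= lexx.
  have -> : z ^+ 2 * Q * (y - x) / 8 = \int[mu]_(t in `]x, y]) (z ^+ 2 * Q / 8).
    by rewrite Rintegral_itv_cst// mulrAC.
  have ic : mu.-integrable `]x, y] (EFin \o fun=> z ^+ 2 * Q / 8).
    by apply: integrable_real_cst => //; exact: lebesgue_itv_lty.
  rewrite -RintegralZl// -RintegralD//; last exact: integrable_realZ.
  apply: le_Rintegral => //.
  + exact: integrable_realZ.
  + by apply: integrable_realD => //; exact: integrable_realZ.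
  + move=> t /=; rewrite in_itv/= => /andP[xt ty].
    have tl : t \in `[0, l].
      by rewrite in_itv/= (le_trans x0 (ltW xt)) (le_trans ty).
    rewrite /k pE//.
    have /HQ eQ : t \in `[x, y] by rewrite in_itv/= (ltW xt).
    have eN : expR (- P t) * expR (P t) = 1 by rewrite -expRD addNr expR0.
    have e0 := expR_gt0 (- P t); have e1 := expR_gt0 (P t).
    set a := expR (- P t) in eN e0 *; set b := expR (P t) in eN e1 eQ *.
    (* the square is completed with weight [b = a^-1] *)
    have h : 0 <= (4 * W t * a - z) ^+ 2 * b by rewrite mulr_ge0 ?sqr_ge0// ltW.
    have h2 : z ^+ 2 * b <= z ^+ 2 * Q by rewrite ler_wpM2l// sqr_ge0.
    have h3 : (4 * W t * a - z) ^+ 2 * b = 16 * W t ^+ 2 * a * (a * b)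
        - 8 * z * W t * (a * b) + z ^+ 2 * b by ring.
    rewrite h3 eN in h; lra.
Qed.

End fisher_representative.

(** * Young inequalities *)

Section young.
Context {R : realType}.
Implicit Types (a b r s y z : R).

Lemma ler_ln_1V r : 0 < r -> 1 - r^-1 <= ln r.
Proof.
move=> r0; have rV : 0 < r^-1 by rewrite invr_gt0.
have e : 1 + (r^-1 - 1) = r^-1 by ring.
have := @le_ln1Dx _ (r^-1 - 1); rewrite e lnV ?posrE// => h.
have : - ln r <= r^-1 - 1 by apply: h; lra.
lra.
Qed.

(** Legendre duality between [cost] and [z |-> 2 (expR (z/2) + expR (-z/2) - 2)]:
    with [r = y - 1/y] and [z = 2 ln w] the difference of the two sides splits
    into two copies of [ln t >= 1 - 1/t]. *)
Lemma cost_young_aux r z :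
  r * z <= cost r + 2 * (expR (z / 2) + expR (- (z / 2)) - 2).
Proof.
have s0 : 0 <= r ^+ 2 + 4 by rewrite addr_ge0 ?sqr_ge0.
set s := Num.sqrt (r ^+ 2 + 4).
have ss : s ^+ 2 = r ^+ 2 + 4 by rewrite /s sqr_sqrtr.
have sp : 0 <= s by exact: sqrtr_ge0.
pose y := (r + s) / 2.
have y0 : 0 < y.
  rewrite /y divr_gt0//; have [r0|r0] := lerP 0 r; nra.
have yV : y^-1 = (s - r) / 2.
  apply: (mulfI (lt0r_neq0 y0)); rewrite divff ?lt0r_neq0//.
  have e : (r + s) * (s - r) = 4.
    have -> : (r + s) * (s - r) = s ^+ 2 - r ^+ 2 by ring.
    by rewrite ss addrAC subrr add0r.
  by rewrite /y mulrACA e; field.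
have rE : r = y - y^-1 by rewrite yV /y; field.
have sE : s = y + y^-1 by rewrite yV /y; field.
set w := expR (z / 2); have w0 : 0 < w by exact: expR_gt0.
have -> : expR (- (z / 2)) = w^-1 by rewrite expRN.
have zE : z = 2 * ln w by rewrite /w expRK; field.
rewrite /cost -/s -/y zE {1}rE.
have -> : 2 * r * ln y - 2 * s + 4 = 2 * (y - y^-1) * ln y - 2 * (y + y^-1) + 4.
  by rewrite -rE -sE.
have h1 : 1 - w / y <= ln y - ln w.
  have := @ler_ln_1V (y / w); rewrite divr_gt0// invf_div ln_div ?posrE//; exact.
have h2 : 1 - y / w <= ln w - ln y.
  have := @ler_ln_1V (w / y); rewrite divr_gt0// invf_div ln_div ?posrE//; exact.
have yV0 : 0 < y^-1 by rewrite invr_gt0.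
have h1' : y - w <= y * (ln y - ln w).
  have -> : y - w = y * (1 - w / y) by field; rewrite lt0r_neq0.
  by rewrite ler_pM2l.
have h2' : y^-1 - w^-1 <= y^-1 * (ln w - ln y).
  have -> : y^-1 - w^-1 = y^-1 * (1 - y / w) by field; rewrite !lt0r_neq0.
  by rewrite ler_pM2l.
nra.
Qed.

Lemma costN r : cost (- r) = cost r.
Proof.
have s0 : 0 < r ^+ 2 + 4 by rewrite ltr_wpDl ?sqr_ge0.
rewrite /cost sqrrN; set s := Num.sqrt (r ^+ 2 + 4).
have ss : s ^+ 2 = r ^+ 2 + 4 by rewrite /s sqr_sqrtr ?ltW.
have sp : 0 <= s by exact: sqrtr_ge0.
have p1 : 0 < (r + s) / 2 by rewrite divr_gt0//; have [r0|r0] := lerP 0 r; nra.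
have p2 : 0 < (- r + s) / 2 by rewrite divr_gt0//; have [r0|r0] := lerP 0 r; nra.
have -> : ln ((- r + s) / 2) = - ln ((r + s) / 2).
  rewrite -lnV ?posrE//; congr ln.
  apply: (mulfI (lt0r_neq0 p1)); rewrite divff ?lt0r_neq0//.
  rewrite mulrACA -invfM.
  have -> : (r + s) * (- r + s) = s ^+ 2 - r ^+ 2 by ring.
  by rewrite ss [_ + 4]addrC addrK; field.
ring.
Qed.

Lemma cost_persp_young r s z : 0 <= s ->
  ((`|r * z|)%:E <= cost_persp r s +
    (s * (2 * (expR (z / 2) + expR (- (z / 2)) - 2)))%:E)%E.
Proof.
move=> s0; rewrite /cost_persp; case: ltP => [s1|s1]; last first.
  have -> : s = 0 by apply/eqP; rewrite eq_le s1 s0.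
  rewrite mul0r; case: eqP => [->|_]; first by rewrite mul0r normr0 adde0.
  by rewrite adde0 leey.
rewrite -EFinD lee_fin -mulrDr -ler_pdivrMl//.
have -> : s^-1 * `|r * z| = `|r / s * z|.
  by rewrite !normrM normfV (gtr0_norm s1) mulrCA mulrA.
rewrite ler_norml cost_young_aux andbT.
have := cost_young_aux (- (r / s)) z; rewrite costN mulNr; lra.
Qed.

(** The flux cost absorbs the node part of the Fisher information: the square
    roots disappear by the inequality between the arithmetic and the geometric
    mean, which leaves an expression that is linear in [a] and [b]. *)
Lemma node_young a b z : 0 <= a -> 0 <= b ->
  Num.sqrt (a * b) * (2 * (expR (z / 2) + expR (- (z / 2)) - 2)) <=
  2 * (Num.sqrt b - Num.sqrt a) ^+ 2
    + (a * (expR (- z) - 1) + b * (expR z - 1)).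
Proof.
move=> a0 b0; rewrite sqrtrM//.
set p := Num.sqrt a; set q := Num.sqrt b.
have pa : a = p ^+ 2 by rewrite /p sqr_sqrtr.
have qb : b = q ^+ 2 by rewrite /q sqr_sqrtr.
have p0 : 0 <= p by exact: sqrtr_ge0.
have q0 : 0 <= q by exact: sqrtr_ge0.
rewrite pa qb; set w := expR (z / 2); set v := expR (- (z / 2)).
have wv : w * v = 1 by rewrite /w /v -expRD subrr expR0.
have -> : expR z = w ^+ 2 by rewrite /w expr2 -expRD -splitr.
have -> : expR (- z) = v ^+ 2.
  by rewrite /v expr2 -expRD -opprD -splitr.
have w0 : 0 < w by exact: expR_gt0.
have v0 : 0 < v by exact: expR_gt0.
have h : 0 <= (p - q * w) ^+ 2 * v by rewrite mulr_ge0 ?sqr_ge0// ltW.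
have h' : 2 * (p * q) <= p ^+ 2 * v + q ^+ 2 * w.
  have e : (p - q * w) ^+ 2 * v =
    p ^+ 2 * v - 2 * (p * q) * (w * v) + q ^+ 2 * w * (w * v) by ring.
  by rewrite e wv in h; lra.
have h2 : 2 * (p * q) * (w + v) <= (p ^+ 2 * v + q ^+ 2 * w) * (w + v).
  by rewrite ler_wpM2r// addr_ge0// ltW.
have e2 : (p ^+ 2 * v + q ^+ 2 * w) * (w + v) =
  p ^+ 2 * (w * v + v ^+ 2) + q ^+ 2 * (w ^+ 2 + w * v) by ring.
rewrite e2 wv in h2; lra.
Qed.

End young.

Section charge_young.
Context {R : realType}.
Variables (j : {charge set (line R) -> \bar R})
  (rho : {finite_measure set (line R) -> \bar R}).
Hypothesis jrho : j `<< rho.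

(** Both parts of the Jordan decomposition are dominated by [rho], and the
    difference of their densities is the density of [j]. *)
Lemma charge_integral_density : exists r : R -> R,
  [/\ measurable_fun (setT : set (line R)) r,
    rho.-integrable [set: R] (EFin \o r),
    {ae rho, forall x, fine (('d j '/d rho) x) = r x} &
    forall (D : set (line R)) (f : R -> R) (C : R), measurable D -> measurable_fun D f ->
      (forall x, D x -> `|f x| <= C) ->
      charge_integral j D f = \int[rho]_(x in D) (r x * f x)].
Proof.
pose jp := jordan_pos (hahn_posneg j); pose jn := jordan_neg (hahn_posneg j).
have hp := RN_has_density (jordan_pos_dominates (hahn_posneg j) jrho).
have hn := RN_has_density (jordan_neg_dominates (hahn_posneg j) jrho).
set rp := (fun x => _) in hp; set rn := (fun x => _) in hn.
have ip := has_density_integrable hp; have in_ := has_density_integrable hn.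
have ir : rho.-integrable [set: R] (EFin \o (fun x => rp x - rn x)).
  exact: integrable_realB.
exists (fun x => rp x - rn x); split => //.
- by case/integrableP : ir => /measurable_EFinP.
- have : ae_eq rho setT ('d j '/d rho) (EFin \o (fun x => rp x - rn x)).
    apply: integral_ae_eq => //.
    + exact: Radon_Nikodym_integrable.
    + by case/integrableP : ir.
    + move=> A _ mA; rewrite -Radon_Nikodym_integral//.
      have ipA : rho.-integrable A (EFin \o rp) by apply: (integrableS _ _ _ ip).
      have inA : rho.-integrable A (EFin \o rn) by apply: (integrableS _ _ _ in_).
      transitivity (\int[rho]_(x in A) (rp x)%:E - \int[rho]_(x in A) (rn x)%:E)%E;
        last by rewrite -integralB_EFin.
      case: hp => _ _ <-//; case: hn => _ _ <-//.
      by rewrite (jordan_decomp (hahn_posneg j) mA) /cadd/= cscaleN1.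
  by move=> [N [mN N0 NU]]; exists N; split => // x /= nx; apply: NU => /= h;
    apply: nx; rewrite h.
- move=> D f C mD mf fC.
  have fi (m : {finite_measure set (line R) -> \bar R}) :
      m.-integrable D (EFin \o f).
    apply: (integrable_real_bounded (C := C)) => //.
    by rewrite -ge0_fin_numE// fin_num_measure.
  rewrite /charge_integral (Rintegral_density hp)// (Rintegral_density hn)//.
  rewrite -RintegralB//; last 2 first.
  - by rewrite -(integrable_density hp).
  - by rewrite -(integrable_density hn).
  by apply: eq_Rintegral => x _; rewrite -mulrBr mulrC.
Qed.

(** Writing the flux as a density against [rho], this is the elementary inequality
    [r f <= r^2 / (2 d) + d f^2 / 2] under the integral. *)
Lemma charge_young (D : set (line R)) (f : R -> R) (C d : R) : measurable D ->
  measurable_fun D f -> (forall x, D x -> `|f x| <= C) -> 0 < d ->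
  ((`|charge_integral j D f|)%:E <=
    (2 * d)^-1%:E * \int[rho]_(x in D) (fine (('d j '/d rho) x) ^+ 2)%:E
    + (d / 2 * \int[rho]_(x in D) (f x ^+ 2))%:E)%E.
Proof.
move=> mD mf fC d0; have [r [mr ir jr Er]] := charge_integral_density.
have mrD : measurable_fun D r by exact: measurable_funTS.
rewrite (Er _ _ _ mD mf fC).
have irD : rho.-integrable D (EFin \o r) by apply: (integrableS _ _ _ ir).
have irf : rho.-integrable D (EFin \o (fun x => r x * f x)).
  exact: (integrable_realM (C := C)).
have if2 : rho.-integrable D (EFin \o (fun x => f x ^+ 2)).
  apply: (integrable_real_bounded (C := C ^+ 2)) => //.
  - by rewrite -ge0_fin_numE// fin_num_measure.
  - exact: measurable_funX.
  - move=> x Dx; rewrite normrX -real_normK ?num_real// normr_id.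
    have := fC _ Dx; have := normr_ge0 (f x) => ? ?.
    by rewrite !expr2 ler_pM.
have -> : (\int[rho]_(x in D) (fine (('d j '/d rho) x) ^+ 2)%:E =
    \int[rho]_(x in D) (r x ^+ 2)%:E)%E.
  apply: ge0_ae_eq_integral => //.
  - apply/measurable_EFinP; apply: measurable_funX; apply: measurableT_comp => //.
    apply: measurable_funTS; apply: measurable_int.
    exact: Radon_Nikodym_integrable.
  - by apply/measurable_EFinP; exact: measurable_funX.
  - by move=> x _; rewrite lee_fin sqr_ge0.
  - by move=> x _; rewrite lee_fin sqr_ge0.
  - case: jr => N [mN N0 NU]; exists N; split => // x /= nx; apply: NU => /= h.
    by apply: nx => _; rewrite h.
rewrite EFin_normr_Rintegral//; apply: (le_trans (le_abse_integral _ _ _)) => //.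
  by case/integrableP : irf.
have dV0 : 0 < (2 * d)^-1 by rewrite invr_gt0 mulr_gt0.
have -> : (d / 2 * \int[rho]_(x in D) (f x ^+ 2))%:E =
    (\int[rho]_(x in D) (d / 2 * f x ^+ 2)%:E)%E.
  rewrite -RintegralZl// /Rintegral fineK//.
  exact: (integrable_fin_num _ (integrable_realZ _ _ if2)).
rewrite -ge0_integralZl//; last 3 first.
- by apply/measurable_EFinP; exact: measurable_funX.
- by move=> x _; rewrite lee_fin sqr_ge0.
- by rewrite lee_fin ltW.
rewrite -ge0_integralD//; last 4 first.
- by move=> x _; rewrite mule_ge0 ?lee_fin ?sqr_ge0// ltW.
- by apply/measurable_EFinP; apply: measurable_funM => //; exact: measurable_funX.
- by move=> x _; rewrite lee_fin mulr_ge0 ?sqr_ge0// divr_ge0 ?ltW.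
- by apply/measurable_EFinP; apply: measurable_funM => //; exact: measurable_funX.
apply: ge0_le_lower_integral => // x Dx.
rewrite /= -EFinM -EFinD lee_fin ler_norml.
have h : 0 <= (r x + d * f x) ^+ 2 * (2 * d)^-1 by rewrite mulr_ge0 ?sqr_ge0 ?ltW.
have h2 : 0 <= (r x - d * f x) ^+ 2 * (2 * d)^-1 by rewrite mulr_ge0 ?sqr_ge0 ?ltW.
have e1 : (r x + d * f x) ^+ 2 * (2 * d)^-1 =
  (2 * d)^-1 * r x ^+ 2 + d / 2 * f x ^+ 2 + r x * f x by field; rewrite lt0r_neq0.
have e2 : (r x - d * f x) ^+ 2 * (2 * d)^-1 =
  (2 * d)^-1 * r x ^+ 2 + d / 2 * f x ^+ 2 - r x * f x by field; rewrite lt0r_neq0.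
by rewrite e1 in h; rewrite e2 in h2; apply/andP; split; lra.
Qed.

End charge_young.

(** * Static estimates *)

Section edge_static.
Context {R : realType}.
Local Notation mu := (@lebesgue_measure R).

(** What the estimates need to know about the density [u] of [rho] with respect
    to [pi] on an edge; [J] is a primitive of the density of the Fisher
    information. *)
Definition edge_profile (l C : R) (P : R -> R)
    (rho pi : {finite_measure set (line R) -> \bar R}) (u J : R -> R) : Prop :=
  [/\ {within `[0, l], continuous u} /\ has_density rho mu
        ((fun x => u x * expR (- P x)) \_ `[0, l]),
    (forall x, x \in `[0, l] -> 0 <= u x <= C * (1 + (J l - J 0))) /\
    (forall x y, x \in `[0, l] -> y \in `[0, l] ->
      `|u x - u y| <= C * Num.sqrt `|x - y| * (1 + (J l - J 0))),
    forall x, x \in `[0, l] ->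
      cont_rep l (fun x => Num.sqrt (density rho pi x)) x = Num.sqrt (u x) /\
      cont_rep l (density rho mu) x = u x * expR (- P x),
    (J l - J 0)%:E = (\int[pi]_(x in `]0%R, l[) (weak_derivative l
      (fun x => Num.sqrt (density rho pi x)) x ^+ 2)%:E)%E &
    forall x y z Q U, 0 <= x -> x <= y -> y <= l ->
      (forall t, t \in `[x, y] -> expR (P t) <= Q) -> u x <= U -> u y <= U ->
      z * (u y - u x) <= 2 * (J y - J x) + z ^+ 2 * Q * U * (y - x) / 2].

(** The mass of an edge is at most one, so the density is small somewhere, and the
    Fisher information controls the increments of its square root by
    Cauchy-Schwarz, which is the clause of [fisher_representative] with the best
    [z].  Together these bound the density and its modulus of continuity by the
    Fisher information, with a constant depending on the edge only.  The last
    clause is the inequality for [g] at [z (g x + g y)], where [z] is left free: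
    in this form it is linear in the density, and survives averaging in time. *)
Lemma edge_static (l : R) (P : R -> R) : 0 < l ->
  [lipschitz P x | x in `[0, l]] -> exists2 C, 0 < C &
  forall rho pi : {finite_measure set (line R) -> \bar R},
    (forall A : set (line R), measurable A -> pi A =
      (\int[mu]_(x in A `&` `[0%R, l]%classic) (expR (- P x))%:E)%E) ->
    rho `<< pi -> rho.-null_set (~` `[0, l]) ->
    (rho `[0%R, l]%classic <= 1)%E ->
    is_H1 l (fun x => Num.sqrt (density rho pi x)) ->
    (\int[pi]_(x in `]0%R, l[) (weak_derivative l
      (fun x => Num.sqrt (density rho pi x)) x ^+ 2)%:E < +oo)%E ->
  exists u J : R -> R, edge_profile l C P rho pi u J.
Proof.
move=> l0 lipP; have [Q Q0 PQ] := potential_bounds lipP.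
(* [C1] bounds [u = g^2]: twice its value [2 Q / l] at a good point, plus twice the
   squared increment of [g]; [C2] comes from [|g x - g y| |g x + g y|], and
   the summand 1 makes [4 Q C1 <= C2 ^+ 2]. *)
pose C1 := 4 * Q / l + 2 * Q * l; pose C2 := 1 + 4 * Q * C1.
have C10 : 0 < C1 by rewrite addr_gt0// ?divr_gt0 ?mulr_gt0.
have C20 : 0 < C2 by rewrite addr_gt0// !mulr_gt0.
exists (C1 + C2); first exact: addr_gt0.
move=> rho pi Hpi rhopi rhoc rho1 sdH1 finF.
have [g [J [[cg g0] gE rE hrho [Jnd JI gz]]]] :=
  fisher_representative l0 lipP Hpi rhopi sdH1 finF.
have in0l x : x \in `[0, l] = (0 <= x <= l) by rewrite in_itv.
set I := J l - J 0 in JI *.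
have I0 : 0 <= I by rewrite subr_ge0 Jnd ?(ltW l0).
have incJ x y : 0 <= x -> x <= y -> y <= l -> J y - J x <= I.
  move=> x0 xy yl; have h1 := Jnd 0 x (lexx _) x0 (le_trans xy yl).
  have h2 := Jnd y l (le_trans x0 xy) yl (lexx _); rewrite /I; lra.
have D2' x y : 0 <= x -> x <= y -> y <= l -> (g y - g x) ^+ 2 <= Q * (y - x) * I.
  move=> x0; rewrite le_eqVlt => /predU1P[->|xy] yl.
    by rewrite !subrr expr0n mulr0 mul0r.
  have h0 : 0 < Q * (y - x) by rewrite mulr_gt0// subr_gt0.
  have := gz x y (4 * (g y - g x) / (Q * (y - x))) Q x0 (ltW xy) yl.
  have HQ t : t \in `[x, y] -> expR (P t) <= Q.
    rewrite in_itv/= => /andP[xt ty].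
    by have /PQ[] : t \in `[0, l] by rewrite in0l (le_trans x0 xt) (le_trans ty yl).
  move=> /(_ HQ).
  set D := g y - g x; set k := Q * (y - x) in h0 *.
  have -> : 4 * D / k * D = 4 * (D ^+ 2 / k) by ring.
  have -> : (4 * D / k) ^+ 2 * Q * (y - x) / 8 = 2 * (D ^+ 2 / k).
    by rewrite -(mulrA _ Q) -/k; field; rewrite lt0r_neq0.
  have := incJ x y x0 (ltW xy) yl => hJ h.
  have : D ^+ 2 / k <= I by lra.
  by rewrite ler_pdivrMr// mulrC.
have D2 x y : x \in `[0, l] -> y \in `[0, l] ->
    (g y - g x) ^+ 2 <= Q * `|x - y| * I.
  rewrite !in0l => /andP[x0 xl] /andP[y0 yl]; have [xy|yx] := lerP x y.
    exact: D2'.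
  by rewrite -sqrrN opprB; apply: D2' => //; exact: ltW.
(* otherwise [rho] would have mass at least 2 *)
have [x0 x0l gx0] : exists2 x0, x0 \in `[0, l] & g x0 ^+ 2 <= 2 * Q / l.
  apply: contrapT => /forall2NP H.
  have : (2%:E <= rho `[0%R, l]%classic)%E.
    case: hrho => mq q0 ->//.
    have -> : 2%:E = (\int[mu]_(x in `[0%R, l]) (2 / l)%:E)%E.
      rewrite integral_cst//= lebesgue_measure_itv/= lte_fin l0 sube0 -EFinM.
      by rewrite divfK ?lt0r_neq0.
    apply: ge0_le_integral => //.
    - by move=> x _; rewrite lee_fin divr_ge0// ltW.
    - by apply/measurable_EFinP; exact: measurable_funTS.
    - move=> x xl; rewrite lee_fin patchE mem_set//.
      have [/(_ xl)//|/negP] := H x; rewrite -ltNge => gx.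
      have [eP eN] := PQ x xl.
      have ep0 := expR_gt0 (P x); have en0 := expR_gt0 (- P x).
      have ee : expR (P x) * expR (- P x) = 1 by rewrite -expRD subrr expR0.
      have -> : 2 / l = 2 / l * (expR (P x) * expR (- P x)) by rewrite ee mulr1.
      rewrite mulrA ler_pM2r//; apply/ltW/(le_lt_trans _ gx).
      have -> : 2 * Q / l = 2 / l * Q by ring.
      by rewrite ler_wpM2l// divr_ge0 // ltW.
  by move=> /le_trans/(_ rho1); rewrite lee_fin => ?; lra.
have g2 x : x \in `[0, l] -> g x ^+ 2 <= C1 * (1 + I).
  move=> xl; have := D2 _ _ x0l xl.
  have h1 : `|x0 - x| <= l.
    move: x0l xl; rewrite !in0l ler_norml => /andP[? ?] /andP[? ?].
    by apply/andP; split; lra.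
  have h2 : Q * `|x0 - x| * I <= Q * l * I.
    by rewrite ler_wpM2r// ler_wpM2l// ltW.
  have h3 : 0 <= (2 * g x0 - g x) ^+ 2 by exact: sqr_ge0.
  have h4 : g x ^+ 2 <= 2 * g x0 ^+ 2 + 2 * (g x - g x0) ^+ 2 by nra.
  have h5 : 0 <= 4 * Q / l * I by rewrite mulr_ge0// divr_ge0 ?mulr_ge0 ?ltW.
  have h6 : 0 <= Q * l by rewrite mulr_ge0 ?ltW.
  have e1 : 2 * (2 * Q / l) = 4 * Q / l by field; rewrite lt0r_neq0.
  rewrite /C1 => h7; nra.
have D1 x y : x \in `[0, l] -> y \in `[0, l] ->
    `|g x ^+ 2 - g y ^+ 2| <= C2 * Num.sqrt `|x - y| * (1 + I).
  move=> xl yl; have I1 : 0 <= 1 + I by lra.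
  have s0 := sqrtr_ge0 `|x - y|.
  have b0 : 0 <= C2 * Num.sqrt `|x - y| * (1 + I).
    by rewrite !mulr_ge0// ltW.
  rewrite -(ler_pXn2r (n := 2))// real_normK ?num_real//.
  have -> : (C2 * Num.sqrt `|x - y| * (1 + I)) ^+ 2 =
      C2 ^+ 2 * `|x - y| * (1 + I) ^+ 2.
    by rewrite !exprMn sqr_sqrtr.
  have -> : (g x ^+ 2 - g y ^+ 2) ^+ 2 = (g y - g x) ^+ 2 * (g x + g y) ^+ 2 by ring.
  have h1 : (g x + g y) ^+ 2 <= 4 * C1 * (1 + I).
    have := g2 _ xl; have := g2 _ yl.
    have : 0 <= (g x - g y) ^+ 2 by exact: sqr_ge0.
    nra.
  apply: (@le_trans _ _ ((Q * `|x - y| * I) * (4 * C1 * (1 + I)))).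
    by apply: ler_pM; rewrite ?sqr_ge0//; exact: D2.
  have h2 : 4 * Q * C1 <= C2 ^+ 2.
    rewrite /C2; have : 0 <= 4 * Q * C1 by rewrite !mulr_ge0// ltW.
    move: (4 * Q * C1) => t t0; nra.
  have -> : Q * `|x - y| * I * (4 * C1 * (1 + I)) =
    (4 * Q * C1) * (`|x - y| * (I * (1 + I))) by ring.
  have -> : C2 ^+ 2 * `|x - y| * (1 + I) ^+ 2 =
    C2 ^+ 2 * (`|x - y| * (1 + I) ^+ 2) by ring.
  apply: ler_pM => //.
  - by rewrite !mulr_ge0// ltW.
  - by rewrite !mulr_ge0.
  - by rewrite ler_wpM2l// expr2 ler_wpM2r//; lra.
exists (fun x => g x ^+ 2), J; split => //.
- by split => // x; apply: cvgM; exact: cg.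
- split => [x xl|x y xl yl].
    rewrite sqr_ge0/= (le_trans (g2 _ xl))// ler_wpM2r//; lra.
  apply: (le_trans (D1 _ _ xl yl)); rewrite ler_wpM2r//; first lra.
  by rewrite ler_wpM2r ?sqrtr_ge0// lerDr ltW.
- move=> x xl; split; last exact: rE.
  by rewrite gE// sqrtr_sqr ger0_norm// g0.
- move=> x y z Q' U x0' xy yl HQ uxU uyU.
  have xl : x \in `[0, l] by rewrite in0l x0' (le_trans xy).
  have yl' : y \in `[0, l] by rewrite in0l yl (le_trans x0').
  have Q'0 : 0 <= Q' by apply: le_trans (HQ x _); rewrite ?expR_ge0// in_itv/= lexx.
  have := gz x y (z * (g x + g y)) Q' x0' xy yl HQ.
  have -> : z * (g x + g y) * (g y - g x) = z * (g y ^+ 2 - g x ^+ 2) by ring.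
  move=> h; apply: (le_trans h); rewrite lerD2l.
  have h1 : (g x + g y) ^+ 2 <= 4 * U.
    have : 0 <= (g x - g y) ^+ 2 by exact: sqr_ge0.
    nra.
  have h2 : 0 <= z ^+ 2 * Q' * (y - x) / 8.
    apply: divr_ge0 => //; apply: mulr_ge0; last by rewrite subr_ge0.
    by apply: mulr_ge0 => //; exact: sqr_ge0.
  have -> : (z * (g x + g y)) ^+ 2 * Q' * (y - x) / 8 =
    z ^+ 2 * Q' * (y - x) / 8 * (g x + g y) ^+ 2 by ring.
  have -> : z ^+ 2 * Q' * U * (y - x) / 2 =
    z ^+ 2 * Q' * (y - x) / 8 * (4 * U) by field.
  by rewrite ler_wpM2l.
Qed.

End edge_static.

Section static.
Context {R : realType} {V : finType} (M : metric_graph R V).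
Variables (nu : state R V) (P : V * V -> R -> R).
Variables (d : V * V -> R) (kappa : V * V -> V -> R).
Hypothesis omega_gt0 : forall v, 0 < node_mass nu v.
Hypothesis nu_gibbs : is_gibbs M P nu.
Hypothesis d_gt0 : forall e, e \in edges M -> 0 < d e.
Hypothesis kappa_gt0 : forall e v, e \in edges M -> ends e v -> 0 < kappa e v.
Local Notation mu := (@lebesgue_measure R).

Lemma cost_ge0 (r : R) : 0 <= cost r.
Proof.
have := cost_young_aux r 0; rewrite mulr0 mul0r oppr0 expR0.
by move=> h; lra.
Qed.

Lemma cost_persp_ge0 (r s : R) : (0 <= cost_persp r s)%E.
Proof.
rewrite /cost_persp; case: ifPn => s0; last by case: ifPn.
by rewrite lee_fin mulr_ge0 ?cost_ge0// ltW.
Qed.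

Lemma rate_ge0 m f : (0 <= rate M d kappa m f)%E.
Proof.
rewrite /rate; case: ifPn => // _; apply: adde_ge0.
  by apply: sume_ge0 => e _; apply: sume_ge0 => v _; exact: cost_persp_ge0.
apply: sume_ge0 => e eM; apply: mule_ge0.
  by rewrite lee_fin invr_ge0 mulr_ge0// ltW// d_gt0.
by apply: integral_ge0 => x _; rewrite lee_fin sqr_ge0.
Qed.

Lemma fisher_ge0 m : (0 <= fisher M nu P d kappa m)%E.
Proof.
rewrite /fisher; case: ifPn => // _; apply: adde_ge0.
  apply: sume_ge0 => e eM; apply: sume_ge0 => v ev; rewrite lee_fin.
  by rewrite !mulr_ge0 ?sqrtr_ge0 ?sqr_ge0// ltW// kappa_gt0.
apply: sume_ge0 => e eM; apply: mule_ge0.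
  by rewrite lee_fin mulr_ge0// ltW// d_gt0.
by apply: integral_ge0 => x _; rewrite lee_fin sqr_ge0.
Qed.

Lemma prob_node_mass_le1 m v : is_prob M m -> 0 <= node_mass m v <= 1.
Proof.
move=> [m0 _ m1]; rewrite m0/= -lee_fin -m1 (bigD1 v)//= -addeA leeDl//.
rewrite adde_ge0//; first by apply: sume_ge0 => w _; rewrite lee_fin.
by apply: sume_ge0 => e _; exact: measure_ge0.
Qed.

Lemma prob_edge_meas_le1 m e : is_prob M m -> e \in edges M ->
  (edge_meas m e `[0%R, len M e]%classic <= 1)%E.
Proof.
move=> [m0 _ m1] eM; rewrite -m1 addeC (bigD1 e)//= -addeA leeDl//.
rewrite adde_ge0//; last by apply: sume_ge0 => w _; rewrite lee_fin.
by apply: sume_ge0 => e' _; exact: measure_ge0.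
Qed.

Lemma sume_lty_term (I : finType) (Q : pred I) (F : I -> \bar R) i :
  (forall i, Q i -> (0 <= F i)%E) -> (\sum_(i | Q i) F i < +oo)%E -> Q i ->
  (F i < +oo)%E.
Proof.
move=> F0 Foo Qi; apply: le_lt_trans Foo.
rewrite (bigD1 i)//= leeDl//; apply: sume_ge0 => k /andP[Qk _]; exact: F0.
Qed.

Definition jump_rate e v : R :=
  kappa e v * Num.sqrt (node_mass nu v * pi_at M P e v).

(** Young's inequality for the cost of the node flux, combined with [node_young],
    where the geometric mean in the rate is traded for the Fisher information.
    What remains is linear in the two densities at the node. *)
Lemma node_static m f e v z b : e \in edges M -> ends e v ->
  0 <= node_mass m v -> 0 <= b ->
  rho_at M m e v = b * pi_at M P e v ->
  at_node M (cont_rep (len M e) (sqrt_density nu m e)) e v = Num.sqrt b ->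
  ((`|z * node_flux f e v|)%:E <=
    cost_persp (node_flux f e v)
      (kappa e v * Num.sqrt (node_mass m v * rho_at M m e v))
    + (2 * kappa e v * Num.sqrt (node_mass nu v * pi_at M P e v) *
        `| at_node M (cont_rep (len M e) (sqrt_density nu m e)) e v
           - Num.sqrt (node_mass m v / node_mass nu v) | ^+ 2)%:E
    + (jump_rate e v * (node_mass m v / node_mass nu v * (expR (- z) - 1)
        + b * (expR z - 1)))%:E)%E.
Proof.
move=> eM ev m0 b0 -> ->.
have k0 := kappa_gt0 eM ev; have w0 := omega_gt0 v.
have p0 : 0 < pi_at M P e v by rewrite /pi_at /at_node; case: ifP => _; exact: expR_gt0.
set a := node_mass m v / node_mass nu v.
have a0 : 0 <= a by rewrite divr_ge0// ltW.
have -> : node_mass m v * (b * pi_at M P e v) =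
    (node_mass nu v * pi_at M P e v) * (a * b).
  by rewrite /a; field; rewrite lt0r_neq0.
rewrite sqrtrM; last by rewrite mulr_ge0// ltW.
rewrite mulrA -/(jump_rate e v).
have j0 : 0 <= jump_rate e v by rewrite mulr_ge0 ?sqrtr_ge0// ltW.
rewrite mulrC -addeA -EFinD.
have js : 0 <= jump_rate e v * Num.sqrt (a * b) by rewrite mulr_ge0 ?sqrtr_ge0.
apply: le_trans (cost_persp_young _ z js) _.
apply: leeD => //; rewrite lee_fin -mulrA.
have h := ler_wpM2l j0 (node_young z a0 b0).
apply: (le_trans h); rewrite mulrDr lerD2r real_normK ?num_real//.
by rewrite le_eqVlt; apply/orP; left; apply/eqP; rewrite /jump_rate; ring.
Qed.

(** Everything the time averages need to know about one instant of finite
    dissipation.  In the last two clauses the densities enter linearly once the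
    multipliers [z] and the potential are fixed, so these clauses can be averaged
    in time. *)
Lemma static_estimate : exists2 C, 0 < C & forall m f, is_prob M m ->
  (rate M d kappa m f + fisher M nu P d kappa m < +oo)%E ->
  let g := fine (rate M d kappa m f + fisher M nu P d kappa m)%E in
  exists u J : V * V -> R -> R, [/\
    forall e, e \in edges M -> {within `[0, len M e], continuous (u e)} /\
      has_density (edge_meas m e) mu
        ((fun x => u e x * expR (- P e x)) \_ `[0, len M e]),
    forall e x, e \in edges M -> x \in `[0, len M e] -> 0 <= u e x <= C * (1 + g),
    forall e x y, e \in edges M -> x \in `[0, len M e] -> y \in `[0, len M e] ->
      `|u e x - u e y| <= C * Num.sqrt `|x - y| * (1 + g),
    forall e, e \in edges M -> forall x y z Q U, 0 <= x -> x <= y -> y <= len M e ->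
      (forall t, t \in `[x, y] -> expR (P e t) <= Q) -> u e x <= U -> u e y <= U ->
      z * (u e y - u e x) <= 2 * (J e y - J e x) + z ^+ 2 * Q * U * (y - x) / 2 &
    forall (phi : V -> R) (vphi dvphi : V * V -> R -> R),
      (forall e, e \in edges M -> {within `[0, len M e], continuous (dvphi e)}) ->
      `|flux_pairing M phi vphi dvphi f|
        + \sum_(e in edges M) 2 * d e * (J e (len M e) - J e 0) <=
      g + \sum_(e in edges M) \sum_(v | ends e v) jump_rate e v *
            (node_mass m v / node_mass nu v
               * (expR (- (phi v - at_node M (vphi e) e v)) - 1)
             + at_node M (u e) e v * (expR (phi v - at_node M (vphi e) e v) - 1))
        + \sum_(e in edges M) d e / 2 *
            \int[edge_meas m e]_(x in `[0, len M e]) (dvphi e x ^+ 2)].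
Proof.
have Cex e : exists C, e \in edges M -> 0 < C /\ forall m, is_prob M m ->
    edge_meas m e `<< edge_meas nu e -> is_H1 (len M e) (sqrt_density nu m e) ->
    (\int[edge_meas nu e]_(x in `]0%R, len M e[)
      (weak_derivative (len M e) (sqrt_density nu m e) x ^+ 2)%:E < +oo)%E ->
    exists u J, edge_profile (len M e) C (P e) (edge_meas m e) (edge_meas nu e) u J.
  have [eM|] := boolP (e \in edges M); last by exists 0.
  have [lipP gibbs] := nu_gibbs eM.
  have [C C0 H] := edge_static (len_gt0 eM) lipP; exists C => _; split => // m pm.
  move=> mnu mH1 mfin; apply: H => //; first by case: pm => _ /(_ _ eM).
  exact: prob_edge_meas_le1.
pose Ce e := projT1 (cid (Cex e)).
have CeP e : e \in edges M -> 0 < Ce e by rewrite /Ce; case: cid => C /= HC /HC[].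
pose C := 1 + \sum_(e in edges M) Ce e * (1 + (2 * d e)^-1).
have dV0 e : e \in edges M -> 0 < (2 * d e)^-1.
  by move=> eM; rewrite invr_gt0 mulr_gt0// d_gt0.
have term0 e : e \in edges M -> 0 <= Ce e * (1 + (2 * d e)^-1).
  by move=> eM; rewrite mulr_ge0 ?addr_ge0// ltW ?CeP ?dV0.
have C0 : 0 < C by rewrite ltr_wpDr// sumr_ge0.
have CeC e : e \in edges M -> Ce e * (1 + (2 * d e)^-1) <= C.
  move=> eM; rewrite /C (bigD1 e)//= addrCA lerDl addr_ge0// sumr_ge0//.
  by move=> e' /andP[? _]; exact: term0.
exists C => // m f pm Doo g.
have [m0 mc _] := pm.
have r0 := rate_ge0 m f; have f0 := fisher_ge0 m.
have rfin : rate M d kappa m f \is a fin_num.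
  by rewrite ge0_fin_numE// (le_lt_trans _ Doo)// leeDl.
have ffin : fisher M nu P d kappa m \is a fin_num.
  by rewrite ge0_fin_numE// (le_lt_trans _ Doo)// leeDr.
have gE : g = fine (rate M d kappa m f) + fine (fisher M nu P d kappa m).
  by rewrite /g fineD.
move: rfin ffin r0 f0 gE; rewrite {Doo}; move: g => g.
rewrite /rate; case: ifPn => // /asboolP jrho.
rewrite /fisher; case: ifPn => // /asboolP rhopi.
set S1 := (\sum_(e in _) _)%E; set S2 := (\sum_(e in _) _)%E.
set T1 := (\sum_(e in _) _)%E; set T2 := (\sum_(e in _) _)%E.
move=> rfin ffin r0 f0 gE.
have S10 : (0 <= S1)%E.
  by apply: sume_ge0 => e _; apply: sume_ge0 => v _; exact: cost_persp_ge0.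
have S20 : (0 <= S2)%E.
  apply: sume_ge0 => e eM; apply: mule_ge0; first by rewrite lee_fin ltW// dV0.
  by apply: integral_ge0 => x _; rewrite lee_fin sqr_ge0.
have T10 : (0 <= T1)%E.
  apply: sume_ge0 => e eM; apply: sume_ge0 => v ev; rewrite lee_fin.
  by rewrite !mulr_ge0 ?sqrtr_ge0 ?sqr_ge0// ltW// kappa_gt0.
have T2t e : e \in edges M -> (0 <= (2 * d e)%:E * \int[edge_meas nu e]_(x in
    `]0%R, (len M e)[) (weak_derivative (len M e) (sqrt_density nu m e) x ^+ 2)%:E)%E.
  move=> eM; apply: mule_ge0; first by rewrite lee_fin mulr_ge0// ltW// d_gt0.
  by apply: integral_ge0 => x _; rewrite lee_fin sqr_ge0.
have T20 : (0 <= T2)%E by apply: sume_ge0.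
move: rfin; rewrite fin_numD => /andP[S1f S2f].
move: ffin; rewrite fin_numD => /andP[T1f T2f].
have gE' : g = fine S1 + fine S2 + (fine T1 + fine T2) by rewrite gE !fineD.
have Ifin e : e \in edges M -> (\int[edge_meas nu e]_(x in `]0%R, len M e[)
      (weak_derivative (len M e) (sqrt_density nu m e) x ^+ 2)%:E < +oo)%E.
  move=> eM; rewrite ltey; apply/eqP => h.
  have T2oo : (T2 < +oo)%E by rewrite -ge0_fin_numE.
  have := sume_lty_term T2t T2oo eM; rewrite h.
  by rewrite gt0_muley// lte_fin mulr_gt0// d_gt0.
have uJex e : exists uJ : (R -> R) * (R -> R), e \in edges M ->
    edge_profile (len M e) (Ce e) (P e) (edge_meas m e) (edge_meas nu e) uJ.1 uJ.2.
  have [eM|] := boolP (e \in edges M); last by exists (fun=> 0, fun=> 0).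
  rewrite /Ce; case: cid => C' /= /(_ eM)[_ /(_ m pm)].
  have [h1 h2] := rhopi e eM; move=> /(_ h1 h2 (Ifin e eM)) [u [J H]].
  by exists (u, J).
pose u e := (projT1 (cid (uJex e))).1; pose J e := (projT1 (cid (uJex e))).2.
have uJ e : e \in edges M ->
    edge_profile (len M e) (Ce e) (P e) (edge_meas m e) (edge_meas nu e) (u e) (J e).
  by rewrite /u /J; case: cid.
pose Ie e := J e (len M e) - J e 0.
have T2E : T2 = (\sum_(e in edges M) 2 * d e * Ie e)%:E.
  rewrite -sumEFin; apply: eq_bigr => e eM; case: (uJ e eM) => _ _ _ IE _.
  by rewrite [RHS]EFinM; congr (_ * _)%E; exact: (esym IE).
have Ie0 e : e \in edges M -> 0 <= Ie e.
  move=> eM; case: (uJ e eM) => _ _ _ IE _; rewrite -lee_fin /Ie IE.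
  by apply: integral_ge0 => x _; rewrite lee_fin sqr_ge0.
have S1f0 := fine_ge0 S10; have S2f0 := fine_ge0 S20.
have T1f0 := fine_ge0 T10; have T2f0 := fine_ge0 T20.
have g0 : 0 <= g by rewrite gE' !addr_ge0.
have Ieg e : e \in edges M -> 2 * d e * Ie e <= g.
  move=> eM; rewrite gE' T2E /= (bigD1 e)//=.
  have : 0 <= \sum_(i in edges M | i != e) 2 * d i * Ie i.
    by apply: sumr_ge0 => i /andP[iM _]; rewrite !mulr_ge0 ?Ie0// ltW// d_gt0.
  lra.
have CI e : e \in edges M -> Ce e * (1 + Ie e) <= C * (1 + g).
  move=> eM; apply: (@le_trans _ _ (Ce e * (1 + (2 * d e)^-1) * (1 + g))); last first.
    by rewrite ler_wpM2r ?CeC// addr_ge0.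
  rewrite -mulrA ler_wpM2l//; first by rewrite ltW ?CeP.
  have dV := dV0 e eM; have d2 : 0 < 2 * d e by rewrite mulr_gt0 ?d_gt0.
  have : Ie e <= (2 * d e)^-1 * g by rewrite ler_pdivlMl// Ieg.
  move: ((2 * d e)^-1) dV => t t0; nra.
exists u, J; split.
- by move=> e eM; case: (uJ e eM).
- move=> e x eM xl; case: (uJ e eM) => _ [+ _] _ _ _ => /(_ x xl) /andP[-> /=].
  by move=> /le_trans; apply; exact: CI.
- move=> e x y eM xl yl; case: (uJ e eM) => _ [_ +] _ _ _ => /(_ x y xl yl).
  move=> /le_trans; apply; rewrite -!(mulrAC _ (1 + _)) ler_wpM2r ?sqrtr_ge0//.
  exact: CI.
- by move=> e eM; case: (uJ e eM).
move=> phi vphi dvphi cdvphi.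
pose z e v := phi v - at_node M (vphi e) e v.
have zero_in e : e \in edges M -> 0 \in `[0, len M e].
  by move=> eM; rewrite in_itv/= lexx ltW ?len_gt0.
have len_in e : e \in edges M -> len M e \in `[0, len M e].
  by move=> eM; rewrite in_itv/= lexx ltW ?len_gt0.
have N : \sum_(e in edges M) \sum_(v | ends e v) `|z e v * node_flux f e v| <=
  fine S1 + fine T1 + \sum_(e in edges M) \sum_(v | ends e v) jump_rate e v *
            (node_mass m v / node_mass nu v * (expR (- z e v) - 1)
             + at_node M (u e) e v * (expR (z e v) - 1)).
  rewrite -lee_fin !EFinD !fineK// -!sumEFin.
  under eq_bigr do rewrite -sumEFin.
  under [X in (_ <= _ + X)%E]eq_bigr do rewrite -sumEFin.
  rewrite /S1 /T1 -!big_split/=; apply: lee_sum => e eM.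
  rewrite -!big_split/=; apply: lee_sum => v ev.
  case: (uJ e eM) => _ [ub _] ur _ _.
  apply: node_static => //.
  - by rewrite /at_node; case: ifP => _;
      [have := ub _ (zero_in e eM)|have := ub _ (len_in e eM)] => /andP[].
  - rewrite /rho_at /pi_at /at_node; case: ifP => _;
      [have := ur _ (zero_in e eM)|have := ur _ (len_in e eM)] => -[_ ->]//.
  - rewrite /at_node; case: ifP => _;
      [have := ur _ (zero_in e eM)|have := ur _ (len_in e eM)] => -[<- _]//.
have E : \sum_(e in edges M) `|charge_integral (edge_flux f e) `[0, len M e] (dvphi e)| <=
  fine S2 + \sum_(e in edges M) d e / 2 *
            \int[edge_meas m e]_(x in `[0, len M e]) (dvphi e x ^+ 2).
  rewrite -lee_fin EFinD fineK// -!sumEFin /S2 -big_split/=.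
  apply: lee_sum => e eM.
  have [C1 C10 HC1] := within_itv_bounded (cdvphi e eM).
  apply: (charge_young (jrho e eM) _ _ (C := C1)) => //.
  - exact: within_itv_measurable (cdvphi e eM).
  - exact: d_gt0.
have F : `|flux_pairing M phi vphi dvphi f| <=
    \sum_(e in edges M) \sum_(v | ends e v) `|z e v * node_flux f e v| +
    \sum_(e in edges M) `|charge_integral (edge_flux f e) `[0, len M e] (dvphi e)|.
  rewrite /flux_pairing; apply: (le_trans (ler_normD _ _)).
  apply: lerD; last exact: ler_norm_sum.
  rewrite (exchange_big_dep (fun e => e \in edges M))/=; last by move=> v e _ /andP[].
  apply: (le_trans (ler_norm_sum _ _ _)); apply: ler_sum => e eM.
  rewrite eM/=; exact: ler_norm_sum.
rewrite -/(z _ _) gE' T2E /=.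
move: N E F; rewrite /z.
set A := \sum_(e in _) \sum_(v | _) `| _ |; set B := \sum_(e in _) `| _ |.
set N1 := \sum_(e in _) \sum_(v | _) _; set E1 := \sum_(e in _) d _ / 2 * _.
have -> : \sum_(e in edges M) 2 * d e * (J e (len M e) - J e 0) =
  \sum_(e in edges M) 2 * d e * Ie e by [].
by move=> N E F; lra.
Qed.

End static.

(** * The continuity equation in integrated form *)

Section charge_integral_measurable.
Context {R : realType}.
Local Notation mu := (@lebesgue_measure R).

Lemma charge_integral_bound (j : {charge set (line R) -> \bar R}) (D : set (line R))
    (f : R -> R) (C : R) : measurable D -> measurable_fun D f ->
  (forall x, D x -> `|f x| <= C) ->
  ((`|charge_integral j D f|)%:E <= C%:E * charge_norm j D)%E.
Proof.
move=> mD mf fC.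
have B (m : {finite_measure set (line R) -> \bar R}) :
    ((`|\int[m]_(x in D) f x|)%:E <= C%:E * m D)%E.
  have fi : m.-integrable D (EFin \o f).
    apply: (integrable_real_bounded (C := C)) => //.
    by rewrite -ge0_fin_numE// fin_num_measure.
  rewrite EFin_normr_Rintegral//; apply: (le_trans (le_abse_integral _ _ _)) => //.
    by case/integrableP : fi.
  by rewrite -integral_cst//; apply: ge0_le_lower_integral => // x Dx;
    rewrite /= lee_fin fC.
rewrite /charge_norm /charge_variation /charge_integral.
rewrite ge0_muleDr//.
apply: (@le_trans _ _ (`|\int[jordan_pos (hahn_posneg j)]_(x in D) f x|%:E
  + `|\int[jordan_neg (hahn_posneg j)]_(x in D) f x|%:E)%E).
  by rewrite -EFinD lee_fin ler_normB.
by apply: leeD; exact: B.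
Qed.

Import HBNNSimple.

(** The Jordan decomposition of [j t] depends on [t] without any measurability, but
    for a simple function [f] the integral is a finite combination of the numbers
    [j t A].  The general case follows by approximation; adding the constant [C]
    makes [f] nonnegative. *)
Lemma measurable_charge_integral (T : set (line R))
    (j : R -> {charge set (line R) -> \bar R}) (D : set (line R)) (f : R -> R) (C : R) :
  measurable T -> measurable D -> measurable_fun D f ->
  (forall x, D x -> `|f x| <= C) ->
  (forall A, measurable A -> measurable_fun T (fun t => j t A)) ->
  measurable_fun T (fun t => charge_integral (j t) D f).
Proof.
move=> mT mD mf fC mj.
pose f1 (x : line R) := (f x + C)%:E.
have f10 x : D x -> (0 <= f1 x)%E.
  by move=> /fC; rewrite lee_fin ler_norml => /andP[? _]; lra.
have mf1 : measurable_fun D f1.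
  by apply/measurable_EFinP; exact: measurable_funD.
pose h n : {nnsfun (line R) >-> R} := nnsfun_approx mD mf1 n.
have hle n x : D x -> h n x <= f x + C.
  by move=> Dx; rewrite -lee_fin /h nnsfun_approxE; exact: le_approx.
have hC n x : D x -> `|h n x| <= C + C.
  move=> Dx; rewrite ger0_norm//; apply: (le_trans (hle n x Dx)).
  by rewrite lerD2r (le_trans (ler_norm _))// fC.
have mh n : measurable_fun D (h n) by exact: measurable_funTS.
have fin_lty (m : {finite_measure set (line R) -> \bar R}) A :
    measurable A -> (m A < +oo)%E.
  by move=> mA; rewrite -ge0_fin_numE// fin_num_measure.
have hi n (m : {finite_measure set (line R) -> \bar R}) : m.-integrable D (EFin \o h n).
  by apply: (integrable_real_bounded (C := C + C)) => //; [exact: fin_lty|exact: hC].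
have fi (m : {finite_measure set (line R) -> \bar R}) : m.-integrable D (EFin \o f).
  by apply: (integrable_real_bounded (C := C)) => //; exact: fin_lty.
have ci (m : {finite_measure set (line R) -> \bar R}) : m.-integrable D (EFin \o fun=> C).
  by apply: integrable_real_cst => //; exact: fin_lty.
have lim (m : {finite_measure set (line R) -> \bar R}) :
    \int[m]_(x in D) h n x @[n --> \oo] --> \int[m]_(x in D) (f x + C).
  have iff := integrable_realD mD (fi m) (ci m).
  have [] := @dominated_convergence _ _ _ m D mD (fun n => EFin \o h n) f1 (fun=> (C + C)%:E).
  - by move=> n; apply/measurable_EFinP.
  - exact: mf1.
  - by apply: aeW => x Dx; exact: (@cvg_nnsfun_approx _ _ _ D mD f1 mf1 f10 x Dx).
  - by apply: integrable_real_cst => //; exact: fin_lty.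
  - by apply: aeW => x n Dx; rewrite /= lee_fin; exact: hC.
  move=> if1 _ H; have := H; rewrite -(fineK (integrable_fin_num _ if1))//.
  by move=> /fine_cvgP[_].
have hex n : exists N (c : nat -> R), forall x,
    h n x = \sum_(i < N) (c i * \1_(h n @^-1` [set c i]) x).
  by eexists _, (nth 0 (finmap.enum_fset (fset_set (range (h n))))) => x;
    exact: (fimfunEord (h n)).
pose N n := projT1 (cid (hex n)).
pose s n : nat -> R := projT1 (cid (projT2 (cid (hex n)))).
have hs n x : h n x = \sum_(i < N n) (s n i * \1_(h n @^-1` [set s n i]) x).
  exact: (projT2 (cid (projT2 (cid (hex n))))).
have hE n (m : {finite_measure set (line R) -> \bar R}) : \int[m]_(x in D) h n x =
    \sum_(i < N n) s n i * fine (m (D `&` (h n @^-1` [set s n i]))).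
  under eq_Rintegral do rewrite hs.
  have mA i : measurable (h n @^-1` [set s n i]) by exact: measurable_sfunP.
  have ind i : m.-integrable D (EFin \o (fun x => \1_(h n @^-1` [set s n i]) x)).
    apply: (integrable_real_bounded (C := 1)) => //; first exact: fin_lty.
      by apply: measurable_indic.
    by move=> x _; rewrite indicE; case: (_ \in _); rewrite ?normr1 ?normr0.
  rewrite Rintegral_sum//; last by move=> i _; exact: integrable_realZ.
  apply: eq_bigr => i _; rewrite RintegralZl//; congr (_ * fine _).
  by rewrite integral_indic// setIC.
have cE n t : charge_integral (j t) D (h n) =
    \sum_(i < N n) s n i * fine (j t (D `&` (h n @^-1` [set s n i]))).
  rewrite /charge_integral !hE -sumrB; apply: eq_bigr => i _; rewrite -mulrBr.
  have mA : measurable (D `&` h n @^-1` [set s n i]).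
    by apply: measurableI => //; exact: measurable_sfunP.
  rewrite (jordan_decomp (hahn_posneg (j t)) mA) /cadd/= cscaleN1 fineB//;
    exact: fin_num_measure.
have clim t : charge_integral (j t) D (h n) @[n --> \oo] -->
    charge_integral (j t) D (fun x => f x + C).
  by apply: cvgB; exact: lim.
have mfine A : measurable A -> measurable_fun T (fun t => fine (j t A)).
  by move=> mA; apply: measurableT_comp => //; exact: mj.
have -> : (fun t => charge_integral (j t) D f) =
    (fun t => charge_integral (j t) D (fun x => f x + C) - C * fine (j t D)).
  apply/funext => t; rewrite /charge_integral.
  rewrite (RintegralD mD (fi _) (ci _)) (RintegralD mD (fi _) (ci _)).
  rewrite !Rintegral_cst// (jordan_decomp (hahn_posneg (j t)) mD) /cadd/= cscaleN1.
  by rewrite fineB ?fin_num_measure//; ring.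
apply: measurable_funB; last by apply: measurable_funM => //; exact: mfine.
apply: (@measurable_fun_cvg _ _ _ T (fun n t => charge_integral (j t) D (h n))).
- move=> n; rewrite (funext (cE n)).
  apply: measurable_sum => i; apply: measurable_funM => //; apply: mfine.
  by apply: measurableI => //; exact: measurable_sfunP.
- by move=> t _; exact: clim.
Qed.

End charge_integral_measurable.

Section continuity_equation.
Context {R : realType} {V : finType} (M : metric_graph R V) (T : R).
Variables (mu : R -> state R V) (j : R -> flux R V).
Hypothesis ce : CE M T mu j.
Local Notation leb := (@lebesgue_measure R).

Lemma is_C1_bounds (vphi dvphi : V * V -> R -> R) :
  (forall e, e \in edges M -> is_C1 (len M e) (vphi e) (dvphi e)) ->
  exists2 C : V * V -> R, (forall e, 0 <= C e) & forall e, e \in edges M ->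
    forall x, x \in `[0, len M e] -> `|dvphi e x| <= C e.
Proof.
move=> C1.
have H e : exists C : R, 0 <= C /\ (e \in edges M -> forall x, x \in `[0, len M e] -> `|dvphi e x| <= C).
  have [eM|_] := boolP (e \in edges M); last by exists 0.
  have [_ cd _] := C1 e eM; have [C C0 HC] := within_itv_bounded cd; by exists C.
exists (fun e => projT1 (cid (H e))).
  by move=> e; case: cid => C [].
by move=> e; case: cid => C /= [].
Qed.

(** The absolute value is at most a multiple of [flux_size], which has a finite
    integral; the comparison is one of lower integrals, which spares the measurability of
    [flux_size]. *)
Lemma flux_pairing_integrable (phi : V -> R) (vphi dvphi : V * V -> R -> R) :
  (forall e, e \in edges M -> is_C1 (len M e) (vphi e) (dvphi e)) ->
  leb.-integrable `[0, T] (EFin \o (fun t => flux_pairing M phi vphi dvphi (j t))).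
Proof.
move=> C1; have [C C0 HC] := is_C1_bounds C1.
pose z e v := phi v - at_node M (vphi e) e v.
pose K := 1 + \sum_(e in edges M) (C e + \sum_(v | ends e v) `|z e v|).
have K0 : 0 < K.
  by rewrite ltr_wpDr// sumr_ge0// => e _; rewrite addr_ge0// sumr_ge0.
have KC e : e \in edges M -> C e + \sum_(v | ends e v) `|z e v| <= K.
  move=> eM; rewrite /K (bigD1 e)//= addrCA lerDl addr_ge0// sumr_ge0// => e' _.
  by rewrite addr_ge0// sumr_ge0.
have KC1 e : e \in edges M -> C e <= K.
  by move=> eM; apply: le_trans (KC e eM); rewrite lerDl sumr_ge0.
have KC2 e v : e \in edges M -> ends e v -> `|z e v| <= K.
  move=> eM ev; apply: le_trans (KC e eM); rewrite (bigD1 v)//= addrCA lerDl.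
  by rewrite addr_ge0// sumr_ge0.
have md e : e \in edges M -> measurable_fun (`[0, len M e] : set (line R)) (dvphi e).
  by move=> eM; have [_ cd _] := C1 e eM; exact: within_itv_measurable.
have mG : measurable_fun (`[0, T] : set (line R))
    (fun t => flux_pairing M phi vphi dvphi (j t)).
  apply: measurable_funD.
    apply: measurable_sum_cond => v _; apply: measurable_sum_cond => e /andP[eM ev].
    by apply: measurable_funM => //; exact: (CE_node_meas ce).
  apply: measurable_sum_cond => e eM.
  apply: (measurable_charge_integral (C := C e)) => //.
  - exact: md.
  - by move=> x xl; exact: HC.
  - by move=> A mA; exact: (CE_edge_meas ce).
have GB t : ((`|flux_pairing M phi vphi dvphi (j t)|)%:E <= K%:E * flux_size M (j t))%E.
  rewrite /flux_pairing /flux_size.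
  apply: (@le_trans _ _ (
     (\sum_(e in edges M) \sum_(v | ends e v) `|z e v * node_flux (j t) e v|)%:E +
     (\sum_(e in edges M) `|charge_integral (edge_flux (j t) e) `[0, len M e] (dvphi e)|)%:E)%E).
    rewrite -EFinD lee_fin; apply: (le_trans (ler_normD _ _)).
    apply: lerD; last exact: ler_norm_sum.
    rewrite (exchange_big_dep (fun e => e \in edges M))/=; last by move=> v e _ /andP[].
    apply: (le_trans (ler_norm_sum _ _ _)); apply: ler_sum => e eM.
    rewrite eM/=; exact: ler_norm_sum.
  rewrite ge0_muleDr; last 2 first.
  - by apply: sume_ge0 => e _; apply: sume_ge0 => v _; rewrite lee_fin.
  - by apply: sume_ge0 => e _; exact: measure_ge0.
  apply: leeD.
    rewrite -sumEFin ge0_sume_distrr; last first.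
      by move=> e _; apply: sume_ge0 => v _; rewrite lee_fin.
    apply: lee_sum => e eM; rewrite -sumEFin ge0_sume_distrr; last by move=> v _; rewrite lee_fin.
    apply: lee_sum => v ev; rewrite -EFinM lee_fin normrM ler_wpM2r//; exact: KC2.
  rewrite -sumEFin ge0_sume_distrr; last by move=> e _; exact: measure_ge0.
  apply: lee_sum => e eM.
  apply: charge_integral_bound => //; first exact: md.
  by move=> x xl; apply: le_trans (KC1 e eM); exact: HC.
apply/integrableP; split; first exact/measurable_EFinP.
have mGn : measurable_fun (`[0, T] : set (line R))
    (fun t => `|flux_pairing M phi vphi dvphi (j t)|%:E).
  by apply/measurable_EFinP; exact: measurableT_comp.
have : (\int[leb]_(t in `[0%R, T]) (K^-1%:E * `|flux_pairing M phi vphi dvphi (j t)|%:E) < +oo)%E.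
  apply: le_lt_trans (CE_finite ce); apply: ge0_le_lower_integral.
    by move=> t _; rewrite mule_ge0// lee_fin invr_ge0 ltW.
  by move=> t _; rewrite lee_pdivrMl.
rewrite ge0_integralZl//; last by rewrite lee_fin invr_ge0 ltW.
rewrite -[X in (_ -> X < _)%E]/(\int[leb]_(t in `[0%R, T]) `|flux_pairing M phi vphi dvphi (j t)|%:E)%E.
case: (\int[leb]_(t in _) _)%E => [r _|/=|//]; first exact: ltry.
by rewrite gt0_muley// lte_fin invr_gt0.
Qed.

Lemma pairing_increment (phi : V -> R) (vphi dvphi : V * V -> R -> R) (X : R -> R) :
  (forall e, e \in edges M -> is_C1 (len M e) (vphi e) (dvphi e)) ->
  leb.-integrable `[0, T] (EFin \o X) ->
  {ae leb, forall t, t \in `[0, T] -> `|flux_pairing M phi vphi dvphi (j t)| <= X t} ->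
  forall s t, 0 <= s -> s <= t -> t <= T ->
    `|pairing M phi vphi (mu t) - pairing M phi vphi (mu s)| <=
    \int[leb]_(r in `[s, t]) X r.
Proof.
move=> C1 iX GX s t s0 st tT.
have [_ ->//] := CE_eq ce phi C1.
have iG := flux_pairing_integrable phi C1.
have sub : `[s, t] `<=` `[0, T].
  move=> r /=; rewrite !in_itv/= => /andP[a b].
  by rewrite (le_trans s0 a) (le_trans b tT).
have iGs : leb.-integrable `[s, t] (EFin \o (fun t => flux_pairing M phi vphi dvphi (j t))).
  by apply: (integrableS _ _ _ iG).
apply: (le_trans (le_normr_Rintegral _ iGs)) => //.
apply: ae_le_Rintegral => //.
- exact: integrable_norm.
- by apply: (integrableS _ _ _ iX).
- case: GX => N [mN N0 NU]; exists N; split => // r /= nr; apply: NU => /= h.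
  by apply: nr => /sub; exact: h.
Qed.

End continuity_equation.

(** * Time averages *)

Section averaging.
Context {R : realType} (T : R).
Local Notation leb := (@lebesgue_measure R).
Local Notation tint f := (leb.-integrable `[0, T] (EFin \o f)).

(** What the choice of a potential uses of a time average; the weights, on which
    the passage from one average to the next depends, come later. *)
Definition averaging (L : (R -> R) -> R) : Prop :=
  [/\ forall (c : R) (f g : R -> R), tint f -> tint g ->
        L (fun t => c * f t + g t) = c * L f + L g,
      forall f g : R -> R, tint f -> tint g ->
        {ae leb, forall t : line R, t \in `[0, T] -> f t <= g t} -> L f <= L g &
      L (fun=> 1) = 1].

Lemma integrable_time_cst (c : R) : tint (fun=> c).
Proof. by apply: integrable_real_cst => //; exact: lebesgue_itv_lty. Qed.

Variable L : (R -> R) -> R.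
Hypothesis avL : averaging L.

Lemma averaging_cst (c : R) : L (fun=> c) = c.
Proof.
have [lin _ one] := avL.
have L0 : L (fun=> 0) = 0.
  have := lin (-1) (fun=> 1) (fun=> 1) (integrable_time_cst 1) (integrable_time_cst 1).
  rewrite one (_ : (fun t : R => _) = fun=> 0); last by apply/funext => t; ring.
  by move=> ->; ring.
have -> : (fun=> c) = (fun t : R => c * 1 + 0) by apply/funext => t; ring.
rewrite (lin c (fun=> 1) (fun=> 0)) ?one ?L0; last 2 first.
- exact: integrable_time_cst.
- exact: integrable_time_cst.
by ring.
Qed.

Lemma averagingZ c f : tint f -> L (fun t => c * f t) = c * L f.
Proof.
move=> fi; have [lin _ _] := avL.
have := lin c f (fun=> 0) fi (integrable_time_cst 0).
rewrite averaging_cst addr0 => <-; congr L; apply/funext => t; ring.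
Qed.

Lemma averagingD f g : tint f -> tint g -> L (fun t => f t + g t) = L f + L g.
Proof.
move=> fi gi; have [lin _ _] := avL.
have := lin 1 f g fi gi; rewrite mul1r => <-; congr L; apply/funext => t; ring.
Qed.

Lemma averagingB f g : tint f -> tint g -> L (fun t => f t - g t) = L f - L g.
Proof.
move=> fi gi; have [lin _ _] := avL.
have := lin (-1) g f gi fi; rewrite mulN1r addrC => <-; congr L; apply/funext => t; ring.
Qed.

Lemma averaging_sum I (s : seq I) (P : pred I) (f : I -> R -> R) :
  (forall i, P i -> tint (f i)) ->
  L (fun t => \sum_(i <- s | P i) f i t) = \sum_(i <- s | P i) L (f i).
Proof.
move=> fi; elim: s => [|i s IH].
  by rewrite big_nil -[RHS](averaging_cst 0); congr L; apply/funext => t; rewrite big_nil.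
rewrite big_cons; have -> : (fun t => \sum_(k <- i :: s | P k) f k t) =
    fun t => if P i then f i t + \sum_(k <- s | P k) f k t else \sum_(k <- s | P k) f k t.
  by apply/funext => t; rewrite big_cons.
have [Pi|_] := boolP (P i); last exact: IH.
by rewrite averagingD ?IH//; [exact: fi|exact: integrable_real_sum].
Qed.

Lemma averaging_le f g : tint f -> tint g ->
  {ae leb, forall t : line R, t \in `[0, T] -> f t <= g t} -> L f <= L g.
Proof. by have [_ + _] := avL; exact. Qed.

Lemma averaging_le_in f g : tint f -> tint g ->
  (forall t, t \in `[0, T] -> f t <= g t) -> L f <= L g.
Proof. by move=> fi gi fg; apply: averaging_le => //; exact: aeW. Qed.

Lemma averaging_ge0 f : tint f -> (forall t, t \in `[0, T] -> 0 <= f t) -> 0 <= L f.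
Proof.
move=> fi f0; rewrite -(averaging_cst 0); apply: averaging_le_in => //.
exact: integrable_time_cst.
Qed.

End averaging.

(** * Interpolation on a grid *)

Section logarithm.
Context {R : realType}.
Implicit Types X Y m : R.

Lemma ln_quotient_le X Y : 0 < X -> 0 < Y -> ln Y - ln X <= (Y - X) / X.
Proof.
move=> X0 Y0; rewrite -ln_div ?posrE//.
have -> : (Y - X) / X = Y / X - 1 by rewrite mulrBl divff ?gt_eqF.
have YX : 0 < Y / X by rewrite divr_gt0.
have e : 1 + (Y / X - 1) = Y / X by ring.
by have := @le_ln1Dx _ (Y / X - 1); rewrite e; apply; lra.
Qed.

Lemma ln_lipschitz m X Y : 0 < m -> m <= X -> m <= Y ->
  `|ln Y - ln X| <= `|Y - X| / m.
Proof.
move=> m0; wlog XY : X Y / X <= Y => [H mX mY|mX mY].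
  have [XY|/ltW YX] := leP X Y; first exact: H.
  by rewrite distrC [`|Y - X|]distrC; exact: H.
have X0 : 0 < X by exact: lt_le_trans mX.
have Y0 : 0 < Y by exact: lt_le_trans mY.
have lnXY : 0 <= ln Y - ln X by rewrite subr_ge0 ler_ln.
rewrite (ger0_norm lnXY) ger0_norm ?subr_ge0//.
apply: (le_trans (ln_quotient_le X0 Y0)).
by rewrite ler_wpM2l ?subr_ge0// lef_pV2.
Qed.

(** Concavity gives [X (ln Y - ln X) <= Y - X] for [X <= Y].  This lower bound on the
    gain from the logarithm is what absorbs the discretization errors later. *)
Lemma ln_monotone_quadratic m X Y : 0 < m -> m <= X -> m <= Y ->
  m * (ln Y - ln X) ^+ 2 <= (Y - X) * (ln Y - ln X).
Proof.
move=> m0; wlog XY : X Y / X <= Y => [H mX mY|mX mY].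
  have [XY|/ltW YX] := leP X Y; first exact: H.
  have -> : (Y - X) * (ln Y - ln X) = (X - Y) * (ln X - ln Y) by ring.
  have -> : (ln Y - ln X) ^+ 2 = (ln X - ln Y) ^+ 2 by ring.
  exact: H.
have X0 : 0 < X by exact: lt_le_trans mX.
have Y0 : 0 < Y by exact: lt_le_trans mY.
have lnXY : 0 <= ln Y - ln X by rewrite subr_ge0 ler_ln.
rewrite expr2 mulrA ler_wpM2r//; apply: le_trans (_ : X * (ln Y - ln X) <= _).
  by rewrite ler_wpM2r.
by rewrite mulrC -ler_pdivlMr//; exact: ln_quotient_le.
Qed.

End logarithm.

Section interpolation.
Context {R : realType} (n : nat) (h kap : R).
Hypotheses (kap0 : 0 < kap) (kaph : 2 * kap <= h).
Implicit Types (c : nat -> R) (x : R).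

Let step k := smooth_step (k%:R * h) (k.+1%:R * h) kap.
Let bump k := smooth_bump (k%:R * h) (k.+1%:R * h) kap.

(** The C^1 analogue of piecewise linear interpolation.  The smoothing of width
    [kap] costs a factor [h / (h - kap)] in the slope. *)
Definition interp c x := c 0%N + \sum_(k < n) (c k.+1 - c k) * step k x.
Definition dinterp c x := \sum_(k < n) (c k.+1 - c k) * bump k x.

Let h0 : 0 < h. Proof. by have := kap0; have := kaph; lra. Qed.

Let cell_width k : 2 * kap <= k.+1%:R * h - k%:R * h.
Proof. by rewrite -mulrBl -natrB// subSnn mul1r. Qed.

Lemma grid_cell x : (0 < n)%N -> 0 <= x -> x <= n%:R * h ->
  exists2 i, (i < n)%N & i%:R * h <= x <= i.+1%:R * h.
Proof.
move=> n0 x0 xn; have [/eqP xE|xE] := boolP (x == n%:R * h).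
  exists n.-1; first by rewrite prednK.
  by rewrite prednK// xE lexx andbT ler_wpM2r ?(ltW h0)// ler_nat leq_pred.
have xn' : x < n%:R * h by rewrite lt_neqAle xE.
have q0 : 0 <= x / h by rewrite divr_ge0// ltW.
have /andP[a b] := truncn_itv q0.
exists (Num.truncn (x / h)).
  by rewrite -(ltr_nat R) (le_lt_trans a)// ltr_pdivrMr.
by rewrite -ler_pdivlMr// a -ler_pdivrMr// ltW.
Qed.

Lemma interp_cell c i x : (i < n)%N -> i%:R * h <= x -> x <= i.+1%:R * h ->
  interp c x = c i + (c i.+1 - c i) * step i x.
Proof.
move=> lin xi xi1; rewrite /interp -(big_mkord xpredT (fun k => (c k.+1 - c k) * step k x)).
rewrite (big_cat_nat (n := i))//=; last exact: ltnW.
rewrite (big_ltn lin) addrA addrA.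
have -> : \sum_(0 <= k < i) (c k.+1 - c k) * step k x = c i - c 0%N.
  rewrite -telescope_sumr//; apply: eq_big_nat => k /andP[_ ki].
  rewrite /step smooth_step_eq1 ?mulr1//.
  by apply: le_trans xi; rewrite ler_wpM2r ?(ltW h0)// ler_nat.
rewrite big1_seq ?addr0; first by ring.
move=> k /=; rewrite mem_index_iota => /andP[ik _].
rewrite /step smooth_step_eq0 ?mulr0//.
by apply: (le_trans xi1); rewrite ler_wpM2r ?(ltW h0)// ler_nat.
Qed.

Lemma dinterp_cell c i x : (i < n)%N -> i%:R * h <= x -> x <= i.+1%:R * h ->
  dinterp c x = (c i.+1 - c i) * bump i x.
Proof.
move=> lin xi xi1; rewrite /dinterp (bigD1 (Ordinal lin))//= big1 ?addr0// => k ki.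
have {}ki : (k : nat) != i by apply: contra ki => /eqP ki; apply/eqP/val_inj.
rewrite /bump smooth_bump_eq0 ?mulr0//.
have [kli|ikl] := ltnP k i.
  by apply/orP; right; apply: le_trans xi; rewrite ler_wpM2r ?(ltW h0)// ler_nat.
apply/orP; left; apply: (le_trans xi1); rewrite ler_wpM2r ?(ltW h0)// ler_nat.
by rewrite ltn_neqAle eq_sym ki.
Qed.

Lemma interp0 c : interp c 0 = c 0%N.
Proof.
rewrite /interp big1 ?addr0// => k _; rewrite /step smooth_step_eq0 ?mulr0//.
by rewrite mulr_ge0// ltW.
Qed.

Lemma interp_end c : interp c (n%:R * h) = c n.
Proof.
rewrite /interp (eq_bigr (fun k : 'I_n => c k.+1 - c k)); last first.
  move=> k _; rewrite /step smooth_step_eq1 ?mulr1//.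
  by rewrite ler_wpM2r ?(ltW h0)// ler_nat.
by rewrite -(big_mkord xpredT (fun k => c k.+1 - c k)) telescope_sumr//; ring.
Qed.

Lemma is_derive_interp c x : is_derive x 1 (interp c) (dinterp c x).
Proof.
have -> : interp c = (fun=> c 0%N) + \sum_(k < n) ((fun=> c k.+1 - c k) * step k).
  by apply/funext => y; rewrite /interp /= fctE fct_sumE.
have -> : dinterp c x = 0 + \sum_(k < n) ((c k.+1 - c k) * bump k x).
  by rewrite add0r.
apply: is_deriveD; apply: is_derive_sum => k.
have -> : (fun=> c k.+1 - c k) * step k = (c k.+1 - c k) \*: step k by [].
by apply: is_deriveZ; exact: is_derive_smooth_step.
Qed.

Lemma continuous_interp c : continuous (interp c).
Proof.
move=> x; have /derivable1_diffP dx := @ex_derive _ _ _ _ _ _ _ (is_derive_interp c x).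
exact: differentiable_continuous.
Qed.

Lemma continuous_dinterp c : continuous (dinterp c).
Proof.
have C k : continuous (fun x => (c k.+1 - c k) * bump k x).
  by move=> x; apply: cvgM; [exact: cvg_cst|exact: continuous_smooth_bump].
rewrite /dinterp; elim: n => [|m IH].
  by rewrite (_ : (fun x => _) = fun=> 0) => [x|]; [exact: cvg_cst|apply/funext => x; rewrite big_ord0].
rewrite (_ : (fun x => _) = fun x => \sum_(k < m) (c k.+1 - c k) * bump k x + (c m.+1 - c m) * bump m x).
  by move=> x; apply: cvgD; [exact: IH|exact: C].
by apply/funext => x; rewrite big_ord_recr.
Qed.

Lemma interp_is_C1 c : is_C1 (n%:R * h) (interp c) (dinterp c).
Proof.
split; [exact/continuous_subspaceT/continuous_interp|
        exact/continuous_subspaceT/continuous_dinterp|].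
by move=> x _; exact: is_derive_interp.
Qed.

(** The bounds [a], [b] are free so that the lemma also gives the distance to a
    third value that is close to both ends. *)
Lemma interp_between c i x y a b : (i < n)%N -> i%:R * h <= x -> x <= i.+1%:R * h ->
  y = interp c x -> a <= c i -> a <= c i.+1 -> c i <= b -> c i.+1 <= b -> a <= y <= b.
Proof.
move=> lin xi xi1 -> a1 a2 b1 b2; rewrite (interp_cell c lin xi xi1).
have /andP[t0 t1] := smooth_step_itv x kap0 (cell_width i); rewrite -/(step i x) in t0 t1 *.
by apply/andP; split; nra.
Qed.

Lemma dinterp_sqr_le c i x : (i < n)%N -> i%:R * h <= x -> x <= i.+1%:R * h ->
  dinterp c x ^+ 2 <= ((c i.+1 - c i) / (h - kap)) ^+ 2.
Proof.
move=> lin xi xi1; rewrite (dinterp_cell c lin xi xi1) -/(bump i x).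
have b0 := smooth_bump_ge0 x kap0 (cell_width i).
have := smooth_bump_le x kap0 (cell_width i).
rewrite -mulrBl -natrB// subSnn mul1r -/(bump i x) => b1.
rewrite [leLHS]exprMn [leRHS]exprMn ler_wpM2l ?sqr_ge0//.
by rewrite ler_sqr ?nnegrE// invr_ge0; have := kap0; have := kaph; lra.
Qed.

End interpolation.

(** * Densities on one edge *)

Section within_interval.
Context {R : realType} (l : R).
Implicit Types f g : R -> R.

Lemma within_itv_comp f g : {within `[0, l], continuous f} -> continuous g ->
  {within `[0, l], continuous (fun x => g (f x))}.
Proof.
move=> cf cg; apply/subspace_continuousP => x xl.
move/subspace_continuousP : cf => /(_ x xl) cf.
exact: (cvg_comp _ _ cf (cg (f x))).
Qed.

Lemma within_itvM f g : {within `[0, l], continuous f} ->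
  {within `[0, l], continuous g} -> {within `[0, l], continuous (fun x => f x * g x)}.
Proof. by move=> cf cg x; apply: cvgM; [exact: cf|exact: cg]. Qed.

Lemma within_itvB f g : {within `[0, l], continuous f} ->
  {within `[0, l], continuous g} -> {within `[0, l], continuous (fun x => f x - g x)}.
Proof. by move=> cf cg x; apply: cvgB; [exact: cf|exact: cg]. Qed.

Lemma within_itv_lebesgue f : {within `[0, l], continuous f} ->
  (@lebesgue_measure R).-integrable `[0, l] (EFin \o f).
Proof.
move=> cf; apply: continuous_compact_integrable => //; exact: segment_compact.
Qed.

End within_interval.

Section edge_data.
Context {R : realType} (l : R) (P : R -> R) (C : R).
Local Notation leb := (@lebesgue_measure R).

(** The part of [edge_profile] that concerns [rho] alone, with the Fisher
    information of the edge replaced by a bound [g] for the dissipation of the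
    whole graph. *)
Definition edge_data (rho : {finite_measure set (line R) -> \bar R})
    (u J : R -> R) (g : R) : Prop :=
  [/\ {within `[0, l], continuous u} /\ has_density rho leb
        ((fun x => u x * expR (- P x)) \_ `[0, l]),
    forall x, x \in `[0, l] -> 0 <= u x <= C * (1 + g),
    forall x y, x \in `[0, l] -> y \in `[0, l] ->
      `|u x - u y| <= C * Num.sqrt `|x - y| * (1 + g) &
    forall x y z Q U, 0 <= x -> x <= y -> y <= l ->
      (forall t, t \in `[x, y] -> expR (P t) <= Q) -> u x <= U -> u y <= U ->
      z * (u y - u x) <= 2 * (J y - J x) + z ^+ 2 * Q * U * (y - x) / 2].

Lemma edge_data_integral rho u J g f : edge_data rho u J g ->
  {within `[0, l], continuous f} ->
  \int[rho]_(x in `[0, l]) f x = \int[leb]_(x in `[0, l]) (f x * (u x * expR (- P x))).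
Proof.
move=> [[cu h] _ _ _] cf.
rewrite (Rintegral_density h)//; last exact: within_itv_integrable.
by apply: eq_Rintegral => x xl; rewrite patchE xl.
Qed.

Lemma Rintegral_supported (a b : R) (f : R -> R) : `[a, b] `<=` `[0, l] ->
  (forall x, x \notin `[a, b] -> f x = 0) ->
  \int[leb]_(x in `[0, l]) f x = \int[leb]_(x in `[a, b]) f x.
Proof.
move=> ab f0; rewrite Rintegral_mkcond [RHS]Rintegral_mkcond.
apply: eq_Rintegral => x _; rewrite !patchE.
have [xab|xab] := boolP (x \in `[a, b]).
  by rewrite !mem_set//; exact: ab.
rewrite [in RHS]memNset; last by apply/negP.
by case: ifP => // _; exact: f0.
Qed.

Hypothesis lipP : [lipschitz P x | x in `[0, l]].

Lemma continuous_expP : {within `[0, l], continuous (fun x => expR (P x))}.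
Proof.
by apply: within_itv_comp; [exact: continuous_potential|exact: continuous_expR].
Qed.

Lemma continuous_expNP : {within `[0, l], continuous (fun x => expR (- P x))}.
Proof.
apply: within_itv_comp; last exact: continuous_expR.
by move=> x; apply: cvgN; exact: continuous_potential.
Qed.

(** Averaging a density near a point approximates its value there, and unlike
    the latter is the integral of a fixed continuous function. *)
Lemma node_average (x0 s : R) : x0 \in `[0, l] -> 0 < s -> s <= l ->
  exists k : R -> R, [/\ {within `[0, l], continuous k}, forall x, 0 <= k x &
  forall rho u J g, edge_data rho u J g -> 0 <= C * (1 + g) ->
    `|\int[rho]_(x in `[0, l]) k x - u x0| <= C * Num.sqrt s * (1 + g)].
Proof.
rewrite in_itv/= => /andP[x00 x0l] s0 sl.
pose a := Num.min x0 (l - s).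
have [a0 ax ax' al] : [/\ 0 <= a, a <= x0, x0 <= a + s & a + s <= l].
  by rewrite /a; have [xs|xs] := leP x0 (l - s); split; lra.
pose B := smooth_bump a (a + s) (s / 4).
have k0 : 0 < s / 4 by lra.
have k1 : 2 * (s / 4) <= a + s - a by lra.
have cB : {within `[0, l], continuous B}.
  exact/continuous_subspaceT/continuous_smooth_bump.
have sub : `[a, a + s] `<=` `[0, l].
  by move=> x /=; rewrite !in_itv/= => /andP[? ?]; apply/andP; split; lra.
have B0 x : x \notin `[a, a + s] -> B x = 0.
  rewrite in_itv/= negb_and -!ltNge => h; apply: smooth_bump_eq0 => //.
  by case/orP : h => /ltW ->; rewrite ?orbT.
have BN x : 0 <= B x by exact: smooth_bump_ge0.
exists (fun x => B x * expR (P x)); split.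
- exact: within_itvM cB continuous_expP.
- by move=> x; rewrite mulr_ge0 ?expR_ge0.
move=> rho u J g ed C1; have [[cu _] _ hu _] := ed.
rewrite (edge_data_integral ed); last exact: within_itvM cB continuous_expP.
have -> : \int[leb]_(x in `[0, l]) (B x * expR (P x) * (u x * expR (- P x))) =
    \int[leb]_(x in `[0, l]) (B x * u x).
  apply: eq_Rintegral => x _; rewrite mulrACA expRN divff ?mulr1//.
  by rewrite gt_eqF// expR_gt0.
have IB : \int[leb]_(x in `[0, l]) B x = 1.
  by rewrite (Rintegral_supported sub B0) integral_smooth_bump.
have iBu : leb.-integrable `[0, l] (EFin \o (fun x => B x * u x)).
  exact/within_itv_lebesgue/within_itvM.
have iB : leb.-integrable `[0, l] (EFin \o B) by exact: within_itv_lebesgue.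
have iBc c : leb.-integrable `[0, l] (EFin \o (fun x => c * B x)) by exact: integrable_realZ.
set c := C * _ * _.
rewrite -[X in _ - X]mulr1 -IB -RintegralZl// -RintegralB//.
apply: (le_trans (le_normr_Rintegral _ _)) => //; first exact: integrable_realB.
rewrite -[c]mulr1 -IB -RintegralZl//.
apply: le_Rintegral => //.
- by apply: integrable_norm => //; exact: integrable_realB.
- move=> x xl; have [xab|xab] := boolP (x \in `[a, a + s]); last first.
    by rewrite B0// !mulr0 mul0r subrr normr0.
  rewrite mulrC -mulrBl normrM (ger0_norm (BN x)) ler_wpM2r//.
  apply: (le_trans (hu x x0 _ _)) => //.
    by rewrite in_itv/= x00.
  rewrite /c [leLHS]mulrAC [leRHS]mulrAC ler_wpM2l// ler_wsqrtr//.
  move: xab; rewrite in_itv/= => /andP[? ?].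
  by rewrite ler_norml; apply/andP; split; lra.
Qed.

End edge_data.

(** * Estimates on a grid *)

Section grid_estimates.
Context {R : realType} (P : R -> R) (C : R) (n : nat) (h kap k s : R).
Local Notation leb := (@lebesgue_measure R).
Local Notation l := (n%:R * h).
Hypotheses (C0 : 0 < C) (kap0 : 0 < kap) (kaph : 2 * kap <= h) (k0 : 0 <= k) (s0 : 0 <= s).
Hypothesis n0 : (0 < n)%N.
Hypothesis lipP : [lipschitz P x | x in `[0, l]].
Hypothesis lipk : forall x y, x \in `[0, l] -> y \in `[0, l] ->
  `|P x - P y| <= k * `|x - y|.

Let h0 : 0 < h. Proof. by have := kap0; have := kaph; lra. Qed.

Lemma grid_in i : (i <= n)%N -> i%:R * h \in `[0, l].
Proof.
move=> lein; rewrite in_itv/= mulr_ge0 ?(ltW h0)//=.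
by rewrite ler_wpM2r ?(ltW h0)// ler_nat.
Qed.

Lemma cell_in i x : (i < n)%N -> i%:R * h <= x -> x <= i.+1%:R * h -> x \in `[0, l].
Proof.
move=> lin xi xi1; have := grid_in (ltnW lin); have := grid_in lin.
by rewrite !in_itv/= => /andP[_ a] /andP[b _]; rewrite (le_trans b xi) (le_trans xi1 a).
Qed.

Lemma Rintegral_cells (f : R -> R) : leb.-integrable `[0, l] (EFin \o f) ->
  \int[leb]_(x in `[0, l]) f x =
  \sum_(i < n) \int[leb]_(x in `[i%:R * h, i.+1%:R * h]) f x.
Proof.
move=> fi; suff H m : (m <= n)%N -> \int[leb]_(x in `[0, m%:R * h]) f x =
    \sum_(i < m) \int[leb]_(x in `[i%:R * h, i.+1%:R * h]) f x by exact: H.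
elim: m => [_|m IH mn].
  by rewrite mul0r set_itv1 Rintegral_set1 big_ord0.
rewrite big_ord_recr/= -IH; last exact: ltnW.
have mm : m%:R * h <= m.+1%:R * h by rewrite ler_wpM2r ?(ltW h0)// ler_nat.
have m0 : 0 <= m%:R * h by rewrite mulr_ge0 ?(ltW h0).
have mn' : m.+1%:R * h <= l by rewrite ler_wpM2r ?(ltW h0)// ler_nat.
apply/eqP; rewrite addrC -subr_eq; apply/eqP.
rewrite Rintegral_itvB ?bnd_simp//; last first.
  by apply: (integrableS _ _ _ fi) => //; apply: subset_itvScc; rewrite ?bnd_simp.
rewrite Rintegral_itv_obnd_cbnd//.
apply: (integrableS _ _ _ fi) => // x /=; rewrite !in_itv/= => /andP[a b].
by rewrite (le_trans b mn') andbT (le_trans m0 (ltW a)).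
Qed.

Lemma potential_cell i x y : (i < n)%N ->
  i%:R * h <= x -> x <= i.+1%:R * h -> i%:R * h <= y -> y <= i.+1%:R * h ->
  P x - P y <= k * h.
Proof.
move=> lin xi xi1 yi yi1; apply: (le_trans (ler_norm _)).
apply: (le_trans (lipk (cell_in lin xi xi1) (cell_in lin yi yi1))).
rewrite ler_wpM2l// ler_norml.
have e : i.+1%:R * h = i%:R * h + h by rewrite -[i.+1]addn1 natrD mulrDl mul1r.
by move: xi1 yi1; rewrite e => ? ?; apply/andP; split; lra.
Qed.

Section one_density.
Variables (rho : {finite_measure set (line R) -> \bar R}) (u J : R -> R) (g : R).
Hypotheses (ed : edge_data l P C rho u J g) (g0 : 0 <= g).
Variable b : nat -> R.
Hypothesis bu : forall i, (i <= n)%N ->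
  `|b i - u (i%:R * h)| <= C * Num.sqrt s * (1 + g).

Let err := C * (Num.sqrt h + Num.sqrt s) * (1 + g).

Lemma density_near_grid i j x : (i < n)%N -> i%:R * h <= x -> x <= i.+1%:R * h ->
  j \in [:: i; i.+1] -> `|u x - b j| <= err.
Proof.
move=> lin xi xi1 jE.
have jn : (j <= n)%N.
  by move: jE; rewrite !inE => /orP[] /eqP ->; [exact: ltnW|].
have jx : `|x - j%:R * h| <= h.
  have e : i.+1%:R * h = i%:R * h + h by rewrite -[i.+1]addn1 natrD mulrDl mul1r.
  rewrite ler_norml; move: jE; rewrite !inE => /orP[] /eqP ->.
    by move: xi1; rewrite e => ?; apply/andP; split; lra.
  by move: xi1; rewrite e => ?; apply/andP; split; lra.
have [_ _ hu _] := ed.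
rewrite -(subrKA (u (j%:R * h))) (le_trans (ler_normD _ _))//.
have -> : err = C * Num.sqrt h * (1 + g) + C * Num.sqrt s * (1 + g) by rewrite /err; ring.
apply: lerD; last by rewrite distrC bu.
apply: (le_trans (hu _ _ (cell_in lin xi xi1) (grid_in jn))).
by rewrite ler_wpM2r ?addr_ge0// ler_wpM2l ?(ltW C0)// ler_wsqrtr.
Qed.

Lemma density_near_interp x : x \in `[0, l] -> `|u x - interp n h kap b x| <= err.
Proof.
rewrite in_itv/= => /andP[x0 xl]; have [i lin /andP[xi xi1]] := grid_cell kap0 kaph n0 x0 xl.
have h1 : `|u x - b i| <= err by apply: (density_near_grid lin xi xi1); rewrite mem_head.
have h2 : `|u x - b i.+1| <= err.
  by apply: (density_near_grid lin xi xi1); rewrite !inE eqxx orbT.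
move: h1 h2; rewrite !ler_norml => /andP[? ?] /andP[? ?].
have := @interp_between _ n h kap kap0 kaph b i x _ (u x - err) (u x + err) lin xi xi1 erefl.
by move=> H; have /andP[? ?] := H ltac:(lra) ltac:(lra) ltac:(lra) ltac:(lra);
  apply/andP; split; lra.
Qed.

Lemma integral_near_interp (f : R -> R) (F Q : R) :
  {within `[0, l], continuous f} -> (forall x, x \in `[0, l] -> `|f x| <= F) ->
  (forall x, x \in `[0, l] -> expR (- P x) <= Q) ->
  `|\int[rho]_(x in `[0, l]) f x -
    \int[leb]_(x in `[0, l]) (f x * (interp n h kap b x * expR (- P x)))| <=
  F * Q * l * err.
Proof.
move=> cf fF PQ.
have [[cu _] _ _ _] := ed.
have l0 : 0 <= l by rewrite mulr_ge0 ?ler0n ?(ltW h0).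
have in0 : 0 \in `[0, l] by rewrite in_itv/= lexx.
have ci : {within `[0, l], continuous (interp n h kap b)}.
  exact/continuous_subspaceT/continuous_interp.
have cP := continuous_expNP lipP.
rewrite (edge_data_integral ed)//.
have i1 : leb.-integrable `[0, l] (EFin \o (fun x => f x * (u x * expR (- P x)))).
  by apply: within_itv_lebesgue; apply: within_itvM => //; exact: within_itvM.
have i2 : leb.-integrable `[0, l] (EFin \o (fun x => f x * (interp n h kap b x * expR (- P x)))).
  by apply: within_itv_lebesgue; apply: within_itvM => //; exact: within_itvM.
rewrite -RintegralB//.
apply: (le_trans (le_normr_Rintegral _ _)) => //; first exact: integrable_realB.
have -> : F * Q * l * err = \int[leb]_(x in `[0, l]) (F * Q * err).
  by rewrite Rintegral_itv_cst// subr0; ring.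
apply: le_Rintegral => //.
- by apply: integrable_norm => //; exact: integrable_realB.
- by apply: integrable_real_cst => //; exact: lebesgue_itv_lty.
- move=> x xl; rewrite -mulrBr -mulrBl !normrM (ger0_norm (expR_ge0 _)).
  rewrite -mulrA ler_pM ?mulr_ge0 ?expR_ge0 ?fF//.
  by rewrite mulrC ler_pM ?expR_ge0 ?PQ ?density_near_interp.
Qed.

(** On each cell the slope of [c] is the multiplier [z] in the last clause of
    [edge_data]: it turns the increment of [J] into [slope * increment of u].  The
    right hand side is linear in the nodal averages [b i], up to errors of
    order [Num.sqrt h] and [Num.sqrt s] times [1 + g]; [beta] is slightly larger than 1 and absorbs the
    oscillation of [P] on a cell and the smoothing of the interpolation. *)
Lemma edge_pointwise (c : nat -> R) (d beta : R) : 0 < d ->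
  expR (k * h) <= beta -> expR (k * h) * (h / (h - kap)) ^+ 2 <= beta ->
  d / 2 * \int[rho]_(x in `[0, l]) (dinterp n h kap c x ^+ 2) - 2 * d * (J l - J 0) <=
  \sum_(i < n) d * expR (- P (i%:R * h)) *
    (- ((c i.+1 - c i) / h) * (b i.+1 - b i) + beta * ((c i.+1 - c i) / h) ^+ 2 * h * b i
     + (2 * `|(c i.+1 - c i) / h| * (C * Num.sqrt s)
        + beta * ((c i.+1 - c i) / h) ^+ 2 * h * (C * (Num.sqrt h + Num.sqrt s))) * (1 + g)).
Proof.
move=> d0 b1 b2; have [[cu _] u0 hu uJ] := ed.
have cd : {within `[0, l], continuous (fun x => dinterp n h kap c x ^+ 2)}.
  rewrite (_ : (fun x => _) = fun x => dinterp n h kap c x * dinterp n h kap c x); last first.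
    by apply/funext => x; rewrite expr2.
  by apply: within_itvM; exact/continuous_subspaceT/continuous_dinterp.
have cP := continuous_expNP lipP.
rewrite (edge_data_integral ed)// Rintegral_cells; last first.
  by apply: within_itv_lebesgue; apply: within_itvM => //; exact: within_itvM.
have -> : J l - J 0 = \sum_(i < n) (J (i.+1%:R * h) - J (i%:R * h)).
  by rewrite -(big_mkord xpredT (fun i => J (i.+1%:R * h) - J (i%:R * h)))
    telescope_sumr// mul0r.
rewrite !mulr_sumr -sumrB; apply: ler_sum => /= i _.
have lin := ltn_ord i.
set q := expR (- P (i%:R * h)); set sl := (c i.+1 - c i) / h.
have q0 : 0 < q by exact: expR_gt0.
have e : i.+1%:R * h = i%:R * h + h by rewrite -[i.+1]addn1 natrD mulrDl mul1r.
have xi : i%:R * h <= i%:R * h by [].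
have xi1 : i%:R * h <= i.+1%:R * h by rewrite e lerDl ltW.
pose U := b i + err.
have uU x : i%:R * h <= x -> x <= i.+1%:R * h -> u x <= U.
  move=> x1 x2; have := density_near_grid lin x1 x2 (mem_head (i : nat) [:: i.+1]).
  by rewrite /U ler_norml => /andP[_]; lra.
have U0 : 0 <= U.
  by apply: le_trans (uU _ xi xi1); have /andP[] := u0 _ (grid_in (ltnW lin)).
have E0 : 0 < expR (k * h) by exact: expR_gt0.
(* on the cell, [u] and [expR (- P)] are replaced by their bounds in terms of the
   left end *)
have cell1 : \int[leb]_(x in `[i%:R * h, i.+1%:R * h])
    (dinterp n h kap c x ^+ 2 * (u x * expR (- P x))) <=
    (c i.+1 - c i) ^+ 2 / (h - kap) ^+ 2 * (U * (q * expR (k * h))) * h.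
  set K := _ / _ * _; have -> : K * h = \int[leb]_(x in `[i%:R * h, i.+1%:R * h]) K.
    by rewrite Rintegral_itv_cst// e; congr (_ * _); ring.
  apply: le_Rintegral => //.
  - apply: (integrableS _ _ _ (within_itv_lebesgue (within_itvM cd (within_itvM cu cP)))) => //.
    by move=> x /=; rewrite in_itv/= => /andP[x1 x2]; exact: (cell_in lin x1 x2).
  - by apply: integrable_real_cst => //; exact: lebesgue_itv_lty.
  - move=> x /=; rewrite in_itv/= => /andP[x1 x2].
    have /andP[ux _] := u0 _ (cell_in lin x1 x2).
    apply: ler_pM; rewrite ?sqr_ge0 ?mulr_ge0 ?expR_ge0//.
      by have := dinterp_sqr_le kap0 kaph c lin x1 x2; rewrite expr_div_n.
    apply: ler_pM; rewrite ?expR_ge0//; first exact: uU.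
    rewrite -expRD ler_expR; have := potential_cell lin xi xi1 x1 x2; lra.
have cell2 := uJ (i%:R * h) (i.+1%:R * h) (sl * q) (expR (k * h) / q) U.
have {cell2} cell2 : sl * q * (u (i.+1%:R * h) - u (i%:R * h)) <=
    2 * (J (i.+1%:R * h) - J (i%:R * h)) + sl ^+ 2 * q * expR (k * h) * U * h / 2.
  apply: (le_trans (cell2 _ _ _ _ _ _)) => //.
  - by have := grid_in (ltnW lin); rewrite in_itv/= => /andP[].
  - by have := grid_in lin; rewrite in_itv/= => /andP[].
  - move=> t; rewrite in_itv/= => /andP[t1 t2].
    rewrite /q -expRN opprK -expRD ler_expR.
    have := potential_cell lin t1 t2 xi xi1; lra.
  - exact: uU.
  - exact: uU.
  - rewrite lerD2l e le_eqVlt; apply/orP; left; apply/eqP; field; exact: lt0r_neq0.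
have hb1 := bu (ltnW lin); have hb2 := bu lin.
have cell3 : - (sl * (u (i.+1%:R * h) - u (i%:R * h))) <=
    - sl * (b i.+1 - b i) + 2 * `|sl| * (C * Num.sqrt s) * (1 + g).
  rewrite -lerBlDl.
  apply: (le_trans (ler_norm _)).
  rewrite (_ : _ - _ = sl * ((b i.+1 - u (i.+1%:R * h)) - (b i - u (i%:R * h)))); last by ring.
  rewrite normrM (mulrC 2) -!mulrA ler_wpM2l//.
  apply: (le_trans (ler_normB _ _)); lra.
have hk0 : 0 < h - kap by have := kap0; have := kaph; lra.
have slE : (c i.+1 - c i) ^+ 2 / (h - kap) ^+ 2 = sl ^+ 2 * (h / (h - kap)) ^+ 2.
  by rewrite /sl; field; rewrite !gt_eqF.
move: cell1; rewrite slE.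
set I := \int[_]_(_ in _) _; set DJ := J _ - J _ in cell2 *; set Du := u _ - u _ in cell2 cell3 *.
set Db := b _ - b _ in cell3 *; set z := (h / _) ^+ 2 in b2 *; set E := expR _ in b1 b2 cell2 E0 *.
move=> cell1.
have D0 : 0 <= sl ^+ 2 * q * U * h.
  by rewrite mulr_ge0 ?(ltW h0)// mulr_ge0// mulr_ge0 ?sqr_ge0 ?(ltW q0).
have A1 : I <= beta * (sl ^+ 2 * q * U * h).
  apply: (le_trans cell1); rewrite (_ : _ * h = (E * z) * (sl ^+ 2 * q * U * h)); last by ring.
  by rewrite ler_wpM2r.
have A2 : sl * q * Du <= 2 * DJ + beta * (sl ^+ 2 * q * U * h) / 2.
  apply: (le_trans cell2); rewrite lerD2l ler_wpM2r ?invr_ge0//.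
  rewrite (_ : _ * h = E * (sl ^+ 2 * q * U * h)); last by ring.
  by rewrite ler_wpM2r.
have A3 := ler_wpM2l (ltW q0) cell3.
have A4 : d / 2 * I - 2 * d * DJ <= d * (beta * (sl ^+ 2 * q * U * h) - sl * q * Du).
  rewrite (_ : _ - _ = d * (I / 2 - 2 * DJ)); last by field.
  by rewrite ler_wpM2l ?(ltW d0)//; lra.
apply: (le_trans A4); rewrite -[leRHS]mulrA ler_wpM2l ?(ltW d0)//.
rewrite [leRHS](_ : _ = q * (- sl * Db + 2 * `|sl| * (C * Num.sqrt s) * (1 + g))
  + beta * (sl ^+ 2 * q * U * h)); last by rewrite /U /err; ring.
by rewrite addrC lerD2r; apply: le_trans A3; rewrite (_ : _ * - _ = - (sl * q * Du)) //; ring.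
Qed.

End one_density.
End grid_estimates.

(** * The potential on one edge *)

Lemma small_grid {R : realType} (l k e : R) : 0 < l -> 0 <= k -> 0 < e ->
  exists n h, [/\ (0 < n)%N, 0 < h, l = n%:R * h &
    [/\ expR (k * h) <= 1 + e, Num.sqrt h <= e & h <= 1]].
Proof.
move=> l0 k0 e0; pose h0 := Num.min 1 (Num.min (e ^+ 2) (e / ((1 + e) * (k + 1)))).
have p0 : 0 < (1 + e) * (k + 1) by rewrite mulr_gt0//; lra.
have h00 : 0 < h0 by rewrite /h0 !lt_min ltr01 exprn_gt0// divr_gt0.
pose n := (Num.truncn (l / h0)).+1.
have n0 : 0 < n%:R :> R by rewrite ltr0n.
have hh : l / n%:R <= h0.
  rewrite ler_pdivrMr// -ler_pdivrMl// mulrC.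
  by apply: ltW; rewrite truncnS_gt.
have hp : 0 < l / n%:R by rewrite divr_gt0.
have : l / n%:R <= h0 by [].
rewrite /h0 !le_min => /and3P[a b c].
exists n, (l / n%:R); split => //.
  by rewrite mulrC divfK// gt_eqF.
split=> //.
  have kh : k * (l / n%:R) <= e / (1 + e).
    apply: (@le_trans _ _ (k * (e / ((1 + e) * (k + 1))))); first by rewrite ler_wpM2l.
    have -> : e / (1 + e) = (k + 1) * (e / ((1 + e) * (k + 1))).
      by field; rewrite !gt_eqF//; lra.
    by rewrite ler_wpM2r ?divr_ge0 ?(ltW e0) ?(ltW p0)//; lra.
  have := expR_ge1Dx (- (k * (l / n%:R))); rewrite expRN => h1.
  have q : (1 + e)^-1 <= (expR (k * (l / n%:R)))^-1.
    apply: le_trans h1; have : (1 + e)^-1 = 1 - e / (1 + e) by field; rewrite gt_eqF//; lra.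
    by move=> ->; lra.
  by rewrite -[leLHS]invrK -[leRHS]invrK lef_pV2// posrE invr_gt0 ?expR_gt0//; lra.
by rewrite -[leRHS](ger0_norm (ltW e0)) -sqrtr_sqr ler_wsqrtr.
Qed.

(** The parameters are chosen in this order: the relative error [e] from [delta]
    and [eta], the mesh [h] from [e], the smoothing [kap] from [h], and last the
    width [tau] of the averaging kernels, whose error is multiplied by the number
    of cells and by slopes of the order [1 / h]. *)
Lemma grid_parameters {R : realType} (l k X Y W C delta eta : R) :
  0 < l -> 0 <= k -> 0 < X -> 0 < Y -> 0 <= W -> 0 < C -> 0 < delta -> 0 < eta ->
  exists n h kap e tau beta, [/\
    [/\ (0 < n)%N, 0 < kap, 2 * kap <= h & l = n%:R * h],
    [/\ expR (k * h) <= beta, expR (k * h) * (h / (h - kap)) ^+ 2 <= beta &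
        Num.sqrt h <= e],
    [/\ 0 < tau, tau <= Num.sqrt h, tau ^+ 2 <= l, C * tau <= eta &
        n%:R * (Y * (2 * (3 * X / delta / h) * X)) * tau <= eta] &
    [/\ 0 < e <= 1, 0 <= beta <= 1 + 3 * e, 17 * X * e <= delta & W * (8 * X) * e <= eta]].
Proof.
move=> l0 k0 X0 Y0 W0 C0 de0 et0.
have Z10 : 0 < 17 * X + 1 by lra.
have Z20 : 0 < W * (8 * X) + 1 by rewrite ltr_wpDl// mulr_ge0//; lra.
pose e := Num.min 1 (Num.min (delta / (17 * X + 1)) (eta / (W * (8 * X) + 1))).
have e0 : 0 < e by rewrite /e !lt_min ltr01 !divr_gt0.
have : e <= e by []; rewrite {2}/e !le_min => /and3P[e1 e2 e3].
have {}e2 : 17 * X * e <= delta by move: e2; rewrite ler_pdivlMr// => ?; lra.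
have {}e3 : W * (8 * X) * e <= eta.
  by move: e3; rewrite ler_pdivlMr// mulrDr mulr1 => ?; lra.
clearbody e.
have [n [h [n0 h0 lE [hk hsq h1]]]] := small_grid l0 k0 e0.
have nR0 : 0 < n%:R :> R by rewrite ltr0n.
have hl : h <= l by rewrite lE ler_peMl ?(ltW h0)// ler1n.
pose kap := e / (2 * (1 + e)) * h.
have kap0 : 0 < kap by rewrite mulr_gt0// divr_gt0//; lra.
have kaph : 2 * kap <= h.
  rewrite /kap mulrA ler_piMl ?(ltW h0)// mulrA ler_pdivrMr; last lra.
  lra.
have hkap : (h / (h - kap)) ^+ 2 <= 1 + e.
  have hk0 : 0 < h - kap by lra.
  rewrite expr_div_n ler_pdivrMr ?exprn_gt0//.
  have -> : h - kap = h * ((2 + e) / (2 * (1 + e))).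
    by rewrite /kap; field; lra.
  rewrite exprMn mulrCA ler_peMr ?sqr_ge0// expr_div_n mulrA ler_pdivlMr ?exprn_gt0//; last lra.
  by nra.
have b2 : expR (k * h) * (h / (h - kap)) ^+ 2 <= (1 + e) ^+ 2.
  by rewrite [leRHS]expr2 ler_pM ?expR_ge0 ?sqr_ge0.
pose Z3 := n%:R * (Y * (2 * (3 * X / delta / h) * X)) + 1.
have Z30 : 0 < Z3.
  by rewrite /Z3 ltr_wpDl// !mulr_ge0 ?invr_ge0 ?(ltW nR0) ?(ltW X0) ?(ltW Y0) ?(ltW de0) ?(ltW h0).
pose tau := Num.min (Num.sqrt h) (Num.min (eta / C) (eta / Z3)).
have sh0 : 0 < Num.sqrt h by rewrite sqrtr_gt0.
have t0 : 0 < tau by rewrite /tau !lt_min sh0 !divr_gt0.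
have : tau <= tau by []; rewrite {2}/tau !le_min => /and3P[t1 t2 t3].
clearbody tau.
exists n, h, kap, e, tau, ((1 + e) ^+ 2); split; split => //.
- by apply: (le_trans hk); rewrite expr2; nra.
- apply: le_trans hl; rewrite -[leRHS]sqr_sqrtr ?(ltW h0)//.
  by rewrite ler_sqr ?nnegrE ?(ltW t0) ?(ltW sh0).
- by move: t2; rewrite ler_pdivlMr// mulrC.
- move: t3; rewrite ler_pdivlMr// /Z3 mulrDr mulr1 mulrC; lra.
- by rewrite e0.
- by rewrite sqr_ge0/=; nra.
Qed.

(** The quadratic gain from the monotonicity of the logarithm beats the
    discretisation errors [E] and [3 X e] because of the shift [delta]. *)
Lemma cell_dissipation {R : realType} (X e delta h beta x0 x1 E : R) :
  0 < X -> 0 < e <= 1 -> 0 < delta -> 17 * X * e <= delta -> 0 < h ->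
  0 <= x0 <= 2 * X -> 0 <= x1 -> `|x1 - x0| <= 3 * X * e ->
  0 <= beta <= 1 + 3 * e -> 0 <= E <= 2 * X * e ->
  let s := (ln (x1 + delta) - ln (x0 + delta)) / h in
  - s * (x1 - x0) + beta * s ^+ 2 * h * (x0 + E) <= 0 /\ `|s| <= 3 * X / delta / h.
Proof.
move=> X0 /andP[e0 e1] de0 eX h0 /andP[x00 x0X] x10 osc /andP[b0 b1] /andP[E0 E1] /=.
set s := _ / h.
have sE : ln (x1 + delta) - ln (x0 + delta) = h * s by rewrite /s mulrC divfK// gt_eqF.
have Xe0 : 0 < X * e by rewrite mulr_gt0.
split; last first.
  rewrite /s normrM normfV (gtr0_norm h0) ler_pM2r ?invr_gt0//.
  have B0 : delta <= x0 + delta by lra.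
  have B1 : delta <= x1 + delta by lra.
  apply: (le_trans (ln_lipschitz de0 B0 B1)).
  rewrite ler_pM2r ?invr_gt0// opprD addrACA subrr addr0.
  by apply: (le_trans osc); rewrite ler_piMr//; lra.
clearbody s.
move: osc; rewrite ler_norml => /andP[osc1 osc2].
pose m := x0 + delta - 3 * X * e.
have m0 : 0 < m by rewrite /m; lra.
have mi : m <= x0 + delta by rewrite /m; lra.
have mi1 : m <= x1 + delta by rewrite /m; lra.
have lnq := ln_monotone_quadratic m0 mi mi1.
rewrite sE in lnq.
have A1 : m * h * s ^+ 2 <= (x1 - x0) * s.
  rewrite -(ler_pM2l h0) (_ : h * (m * h * s ^+ 2) = m * (h * s) ^+ 2); last by ring.
  by apply: (le_trans lnq); rewrite le_eqVlt; apply/orP; left; apply/eqP; ring.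
have A2 : beta * (x0 + E) <= m.
  apply: (@le_trans _ _ ((1 + 3 * e) * (x0 + 2 * X * e))).
    by apply: ler_pM => //; lra.
  have a2 : e * x0 <= e * (2 * X) by rewrite ler_wpM2l// ltW.
  have a3 : e * (X * e) <= 1 * (X * e) by rewrite ler_wpM2r// ltW.
  by rewrite /m; lra.
have A3 : 0 <= h * s ^+ 2 by rewrite mulr_ge0 ?sqr_ge0 ?(ltW h0).
by have := ler_wpM2l A3 A2; lra.
Qed.

Section edge_step.
Context {R : realType} (T : R) (L : (R -> R) -> R).
Variables (rho : R -> {finite_measure set (line R) -> \bar R}) (l : R) (P : R -> R).
Variables (C D1 : R).
Local Notation leb := (@lebesgue_measure R).
Local Notation tint f := (leb.-integrable `[0, T] (EFin \o f)).
Hypotheses (avL : averaging T L) (l0 : 0 < l) (lipP : [lipschitz P x | x in `[0, l]]).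
Hypothesis C0 : 0 < C.
Hypothesis rho_int : forall f : R -> R, {within `[0, l], continuous f} ->
  tint (fun r => \int[rho r]_(x in `[0, l]) f x).
(* [D1] stands for one plus the average of the dissipation, which enters only
   through its measurable minorants *)
Hypothesis L_max : forall (H : R -> R) (c : R), 0 < c -> tint H ->
  (forall r u J g, r \in `[0, T] -> 0 <= g -> edge_data l P C (rho r) u J g ->
    H r <= c * (1 + g)) -> L H <= c * D1.

(** The [b i] are integrals against fixed kernels concentrated near the grid
    points, hence integrable in time, which is not known of the densities
    themselves.  Their averages inherit the bound and the modulus of continuity
    of the densities through [L_max]. *)
Lemma averaged_density n h tau e : 0 < h -> l = n%:R * h -> 0 < tau ->
    tau <= Num.sqrt h -> tau ^+ 2 <= l -> Num.sqrt h <= e -> e <= 1 ->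
  exists b : nat -> R -> R, [/\
    forall i, (i <= n)%N -> tint (b i),
    forall i r u J g, (i <= n)%N -> 0 <= g -> edge_data l P C (rho r) u J g ->
      `|b i r - u (i%:R * h)| <= C * tau * (1 + g),
    forall i, (i <= n)%N -> 0 <= L (b i) <= 2 * (C * D1) &
    forall i, (i < n)%N -> `|L (b i.+1) - L (b i)| <= 3 * (C * D1) * e].
Proof.
move=> h0 lE t0 th tl he e1.
have sE : Num.sqrt (tau ^+ 2) = tau by rewrite sqrtr_sqr ger0_norm// ltW.
have te : tau <= e by exact: le_trans he.
have grid i : (i <= n)%N -> i%:R * h \in `[0, l].
  move=> lin; rewrite in_itv/= lE ler_wpM2r ?(ltW h0) ?ler_nat// andbT.
  by rewrite mulr_ge0// ltW.
have kex i : exists ki : R -> R, (i <= n)%N -> [/\ {within `[0, l], continuous ki},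
    forall x, 0 <= ki x & forall rho u J g, edge_data l P C rho u J g ->
    0 <= C * (1 + g) ->
    `|\int[rho]_(x in `[0, l]) ki x - u (i%:R * h)| <= C * tau * (1 + g)].
  case: (leqP i n) => [lin|_]; last by exists (fun=> 0).
  have [ki H] := node_average C lipP (grid i lin) (exprn_gt0 2 t0) tl.
  by exists ki => _; rewrite sE in H.
pose ki i := projT1 (cid (kex i)).
have kiP i : (i <= n)%N -> [/\ {within `[0, l], continuous (ki i)},
    forall x, 0 <= ki i x & forall rho u J g, edge_data l P C rho u J g ->
    0 <= C * (1 + g) ->
    `|\int[rho]_(x in `[0, l]) ki i x - u (i%:R * h)| <= C * tau * (1 + g)].
  exact: (projT2 (cid (kex i))).
clearbody ki; move: kex => _.
pose b i r := \int[rho r]_(x in `[0, l]) ki i x.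
have bi i : (i <= n)%N -> tint (b i).
  by move=> /kiP[ck _ _]; exact: rho_int.
have bu i r u J g : (i <= n)%N -> 0 <= g -> edge_data l P C (rho r) u J g ->
    `|b i r - u (i%:R * h)| <= C * tau * (1 + g).
  move=> /kiP[_ _ H] g0 ed; apply: H ed _.
  by rewrite mulr_ge0 ?(ltW C0)// addr_ge0.
exists b; split => // [i lin|].
  apply/andP; split.
    apply: (averaging_ge0 avL (bi i lin)) => r _.
    by have [_ kp _] := kiP i lin; apply: Rintegral_ge0 => x _; exact: kp.
  rewrite mulrA; apply: (L_max _ (bi i lin)); first by rewrite mulr_gt0.
  move=> r u J g rT g0 ed; have := bu i r u J g lin g0 ed.
  have [_ /(_ _ (grid i lin))/andP[_ uC] _ _] := ed.
  have : C * tau * (1 + g) <= C * 1 * (1 + g).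
    by rewrite ler_wpM2r ?addr_ge0// ler_wpM2l ?(ltW C0)// (le_trans te).
  by move: uC; rewrite ler_norml => ? ? /andP[_ ?]; lra.
have ubosc i j : (i <= n)%N -> (j <= n)%N -> `|i%:R * h - j%:R * h| <= h ->
    L (b i) - L (b j) <= 3 * (C * D1) * e.
  move=> lin ljn ij; rewrite -(averagingB avL (bi i lin) (bi j ljn)).
  rewrite [leRHS](_ : _ = 3 * C * e * D1); last by ring.
  apply: L_max.
  - by rewrite !mulr_gt0//; exact: lt_le_trans te.
  - by apply: integrable_realB => //; exact: bi.
  move=> r u J g rT g0 ed.
  rewrite [leRHS](_ : _ = 3 * (C * e * (1 + g))); last by ring.
  have := bu i r u J g lin g0 ed; have := bu j r u J g ljn g0 ed.
  have [_ _ /(_ _ _ (grid i lin) (grid j ljn)) hu _] := ed.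
  have {}hu : `|u (i%:R * h) - u (j%:R * h)| <= C * e * (1 + g).
    apply: (le_trans hu); rewrite ler_wpM2r ?addr_ge0// ler_wpM2l ?(ltW C0)//.
    by apply: le_trans he; rewrite ler_wsqrtr.
  have : C * tau * (1 + g) <= C * e * (1 + g).
    by rewrite ler_wpM2r ?addr_ge0// ler_wpM2l ?(ltW C0).
  move: hu; move: (C * e * _) (C * tau * _) => A1 A2.
  by rewrite !ler_norml => /andP[? ?] ? /andP[? ?] /andP[? ?]; lra.
move=> i lin.
have E1 : i.+1%:R * h - i%:R * h = h by rewrite -[i.+1]addn1 natrD; ring.
have A1 : L (b i.+1) - L (b i) <= 3 * (C * D1) * e.
  by apply: ubosc => //; [exact: ltnW|rewrite E1 ger0_norm// ltW].
have A2 : L (b i) - L (b i.+1) <= 3 * (C * D1) * e.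
  by apply: ubosc => //; [exact: ltnW|rewrite distrC E1 ger0_norm// ltW].
by rewrite ler_norml A1 andbT -lerN2 opprK opprB.
Qed.

End edge_step.

Section near_optimal.
Context {R : realType} (n : nat) (h kap X delta o : R) (ub : nat -> R).
Local Notation leb := (@lebesgue_measure R).
Local Notation l := (n%:R * h).
Hypotheses (n0 : (0 < n)%N) (kap0 : 0 < kap) (kaph : 2 * kap <= h).
Hypotheses (de0 : 0 < delta) (de1 : delta <= 1).
Hypothesis ubX : forall i, (i <= n)%N -> 0 <= ub i <= 2 * X.
Hypothesis ubo : forall i, (i < n)%N -> `|ub i.+1 - ub i| <= o.
Hypothesis ode : o < delta.

Let c i := ln (ub i + delta).
Let phi := interp n h kap c.

Lemma log_interp_bound x : x \in `[0, l] -> ln delta <= phi x <= 2 * X.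
Proof.
rewrite in_itv/= => /andP[x0 xl]; have [i lin /andP[xi xi1]] := grid_cell kap0 kaph n0 x0 xl.
have H j : (j <= n)%N -> ln delta <= c j <= 2 * X.
  move=> /ubX/andP[u0 u1]; have d1 := de1; have p0 := de0; rewrite /c ler_ln ?posrE; [|lra|lra].
  rewrite lerDr u0/=; have := @le_ln1Dx _ (ub j + delta - 1).
  by rewrite addrCA subrr addr0 => h1; apply: le_trans (h1 _) _; lra.
have /andP[a1 b1] := H _ lin; have /andP[a2 b2] := H _ (ltnW lin).
exact: (interp_between kap0 kaph lin xi xi1 erefl a2 a1 b2 b1).
Qed.

Lemma exp_log_interp x : x \in `[0, l] ->
  `|interp n h kap ub x + delta - expR (phi x)| <= 2 * o.
Proof.
rewrite in_itv/= => /andP[x0 xl]; have [i lin /andP[xi xi1]] := grid_cell kap0 kaph n0 x0 xl.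
have /andP[u0 _] := ubX (ltnW lin).
have /andP[u1 _] := ubX lin.
have := ubo lin; rewrite ler_norml => /andP[osc1 osc2].
have o0 : 0 <= o by apply: le_trans (ubo lin).
have od := ode.
have /andP[a1 a2] : ub i - o <= interp n h kap ub x <= ub i + o.
  by apply: (interp_between kap0 kaph lin xi xi1 erefl); lra.
have /andP[b1 b2] : ln (ub i + delta - o) <= phi x <= ln (ub i + delta + o).
  by apply: (interp_between kap0 kaph lin xi xi1 erefl);
    rewrite /c ler_ln ?posrE; lra.
have {}b1 : ub i + delta - o <= expR (phi x).
  rewrite -[leLHS]lnK ?ler_expR// posrE; lra.
have {}b2 : expR (phi x) <= ub i + delta + o.
  rewrite -[leRHS]lnK ?ler_expR// posrE; lra.
by rewrite ler_norml; apply/andP; split; lra.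
Qed.

Variables (P psi : R -> R) (Q Psi : R).
Hypothesis lipP : [lipschitz P x | x in `[0, l]].
Hypothesis PQ : forall x, x \in `[0, l] -> expR (- P x) <= Q.
Hypothesis cpsi : {within `[0, l], continuous psi}.
Hypothesis psiB : forall x, x \in `[0, l] -> `|psi x| <= Psi.

Let F := Psi + (`|ln delta| + 2 * X).

(** The potential [phi] is within [O(o)] of the logarithm of [u + delta], where [u]
    is the interpolated density.  For that density the integrand
    [psi (u + delta) - expR psi] is concave in [psi] with maximum at
    [ln (u + delta)], by convexity of the exponential. *)
Lemma log_interp_near_optimal : 0 <= X ->
  \int[leb]_(x in `[0, l]) ((psi x - phi x) * (interp n h kap ub x * expR (- P x)))
  - \int[leb]_(x in `[0, l]) (expR (psi x) * expR (- P x)) <=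
  (F * (2 * o) + delta * (2 * X + Psi)) * Q * l
  - \int[leb]_(x in `[0, l]) (expR (phi x) * expR (- P x)).
Proof.
move=> X0.
have cP := continuous_expNP lipP.
have cphi : {within `[0, l], continuous phi}.
  exact/continuous_subspaceT/continuous_interp.
have cu : {within `[0, l], continuous (interp n h kap ub)}.
  exact/continuous_subspaceT/continuous_interp.
have h0 : 0 < h by have := kap0; have := kaph; lra.
have l0 : 0 <= l by rewrite mulr_ge0// ltW.
have o0 : 0 <= o by apply: le_trans (ubo n0).
have i1 : leb.-integrable `[0, l] (EFin \o (fun x => (psi x - phi x) * (interp n h kap ub x * expR (- P x)))).
  apply: within_itv_lebesgue; apply: within_itvM; last exact: within_itvM.
  exact: within_itvB.
have i2 : leb.-integrable `[0, l] (EFin \o (fun x => expR (psi x) * expR (- P x))).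
  apply: within_itv_lebesgue; apply: within_itvM => //.
  by apply: within_itv_comp => //; exact: continuous_expR.
have i3 : leb.-integrable `[0, l] (EFin \o (fun x => expR (phi x) * expR (- P x))).
  apply: within_itv_lebesgue; apply: within_itvM => //.
  by apply: within_itv_comp => //; exact: continuous_expR.
set K := F * (2 * o) + _.
set I1 := Rintegral _ _ _; set I2 := Rintegral _ _ _; set I3 := Rintegral _ _ _.
suff H : I1 - I2 + I3 <= K * Q * l by lra.
rewrite /I1 /I2 /I3 -RintegralB// -RintegralD//; last exact: integrable_realB.
have -> : K * Q * l = \int[leb]_(x in `[0, l]) (K * Q).
  by rewrite Rintegral_itv_cst// subr0.
apply: le_Rintegral => //.
- by apply: integrable_realD => //; exact: integrable_realB.
- by apply: integrable_real_cst => //; exact: lebesgue_itv_lty.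
move=> x xl; have w0 := expR_ge0 (- P x).
have /andP[f1 f2] := log_interp_bound xl.
have fB : `|phi x| <= `|ln delta| + 2 * X.
  have := ler_norm (- ln delta); rewrite normrN => ?.
  by rewrite ler_norml; apply/andP; split; have := normr_ge0 (ln delta); lra.
have := psiB xl; rewrite ler_norml => /andP[p1 p2].
have fF : `|psi x - phi x| <= F.
  by apply: (le_trans (ler_normB _ _)); rewrite /F lerD//; exact: psiB.
have eo := exp_log_interp xl.
have conv : expR (phi x) * (psi x - phi x) <= expR (psi x) - expR (phi x).
  have := expR_ge1Dx (psi x - phi x); rewrite expRD expRN => hh.
  have := ler_wpM2l (expR_ge0 (phi x)) hh.
  by rewrite mulrCA divff ?mulr1 ?gt_eqF ?expR_gt0//; lra.
have main : (psi x - phi x) * (interp n h kap ub x + delta - expR (phi x)) <= F * (2 * o).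
  by apply: (le_trans (ler_norm _)); rewrite normrM ler_pM.
have d1 : delta * (phi x - psi x) <= delta * (2 * X + Psi).
  by rewrite ler_wpM2l ?(ltW de0)//; lra.
have K0 : 0 <= K.
  have F0 : 0 <= F by apply: le_trans fF.
  have P0 : 0 <= Psi by apply: le_trans (psiB xl).
  by rewrite /K addr_ge0// mulr_ge0//; have := de0; lra.
apply: (@le_trans _ _ (K * expR (- P x))); last by rewrite ler_wpM2l// PQ.
rewrite mulrA -mulrBl -mulrDl ler_wpM2r// /K; lra.
Qed.

End near_optimal.

(** The integral against an interpolation is a fixed linear form in its nodal
    values, so that it commutes with time averages. *)
Lemma interp_integral {R : realType} (n : nat) (h kap l : R) (f w : R -> R) :
  0 < kap -> 2 * kap <= h ->
  {within `[0, l], continuous f} -> {within `[0, l], continuous w} ->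
  exists (a0 : R) (a : nat -> R), forall c : nat -> R,
  \int[@lebesgue_measure R]_(x in `[0, l]) (f x * (interp n h kap c x * w x)) =
  c 0%N * a0 + \sum_(k < n) (c k.+1 - c k) * a k.
Proof.
move=> kap0 kaph cf cw.
pose st k x := smooth_step (k%:R * h) (k.+1%:R * h) kap x.
have cst k : {within `[0, l], continuous (st k)}.
  apply/continuous_subspaceT => x; apply/differentiable_continuous/derivable1_diffP.
  by case: (is_derive_smooth_step (k%:R * h) (k.+1%:R * h) kap x).
pose mu := @lebesgue_measure R.
exists (\int[mu]_(x in `[0, l]) (f x * w x)), (fun k => \int[mu]_(x in `[0, l]) (f x * (st k x * w x))) => c.
have i0 : mu.-integrable `[0, l] (EFin \o (fun x => f x * w x)).
  exact/within_itv_lebesgue/within_itvM.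
have ik k : mu.-integrable `[0, l] (EFin \o (fun x => f x * (st k x * w x))).
  by apply/within_itv_lebesgue/within_itvM => //; exact: within_itvM.
have ikc k : mu.-integrable `[0, l]
    (EFin \o (fun x => (c k.+1 - c k) * (f x * (st k x * w x)))).
  exact: integrable_realZ.
rewrite -RintegralZl//; under [in RHS]eq_bigr do rewrite -RintegralZl//.
rewrite -Rintegral_sum// -RintegralD//; last 2 first.
- exact: integrable_realZ.
- exact: integrable_real_sum.
apply: eq_Rintegral => x _; rewrite /interp mulrDl mulrDr; congr (_ + _); first by ring.
by rewrite mulr_suml mulr_sumr; apply: eq_bigr => k _; rewrite /st; ring.
Qed.

Section edge_step.
Context {R : realType} (T : R) (L : (R -> R) -> R).
Variables (rho : R -> {finite_measure set (line R) -> \bar R}) (l : R) (P : R -> R).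
Variables (C D1 : R).
Local Notation leb := (@lebesgue_measure R).
Local Notation tint f := (leb.-integrable `[0, T] (EFin \o f)).
Hypotheses (avL : averaging T L) (l0 : 0 < l) (lipP : [lipschitz P x | x in `[0, l]]).
Hypotheses (C0 : 0 < C) (D10 : 0 < D1).
Hypothesis rho_int : forall f : R -> R, {within `[0, l], continuous f} ->
  tint (fun r => \int[rho r]_(x in `[0, l]) f x).
Hypothesis L_max : forall (H : R -> R) (c : R), 0 < c -> tint H ->
  (forall r u J g, r \in `[0, T] -> 0 <= g -> edge_data l P C (rho r) u J g ->
    H r <= c * (1 + g)) -> L H <= c * D1.
Variables (d Q Psi : R) (psi : R -> R).
Hypotheses (d0 : 0 < d) (PQ : forall x, x \in `[0, l] -> expR (- P x) <= Q).
Hypothesis cpsi : {within `[0, l], continuous psi}.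
Hypothesis psiB : forall x, x \in `[0, l] -> `|psi x| <= Psi.

(** On one edge, the logarithm of the averaged density, shifted by [delta] and
    interpolated on a fine grid, nearly maximises the Legendre pairing with the
    average, while the average of its driving force is nearly nonpositive. *)
Lemma edge_step (delta eta : R) : 0 < delta -> delta <= 1 -> 0 < eta ->
  exists (phi dphi b0 bl Lin : R -> R) (K : R), [/\
    is_C1 l phi dphi /\ 0 <= K,
    [/\ tint b0, tint bl & tint Lin],
    [/\ phi 0 = ln (L b0 + delta), phi l = ln (L bl + delta), 0 <= L b0 & 0 <= L bl],
    forall r u J g, r \in `[0, T] -> 0 <= g -> edge_data l P C (rho r) u J g ->
      [/\ `|b0 r - u 0| <= eta * (1 + g), `|bl r - u l| <= eta * (1 + g) &
       d / 2 * \int[rho r]_(x in `[0, l]) (dphi x ^+ 2) - 2 * d * (J l - J 0)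
        <= Lin r + K * (1 + g)] &
    L Lin + K * D1 <= eta /\
    L (fun r => \int[rho r]_(x in `[0, l]) psi x)
      - \int[leb]_(x in `[0, l]) (expR (psi x) * expR (- P x)) <=
    L (fun r => \int[rho r]_(x in `[0, l]) phi x)
      + (delta * (Q * l * (2 * (C * D1) + Psi)) + eta)
      - \int[leb]_(x in `[0, l]) (expR (phi x) * expR (- P x))].
Proof.
move=> de0 de1 et0.
have [k k0 lipk] := lipschitz_potential lipP.
have in0 : 0 \in `[0, l] by rewrite in_itv/= lexx ltW.
have Q0 : 0 < Q by apply: lt_le_trans (PQ in0); exact: expR_gt0.
have Psi0 : 0 <= Psi by apply: le_trans (psiB in0).
pose X := C * D1; have X0 : 0 < X by exact: mulr_gt0.
pose F := Psi + (`|ln delta| + 2 * X).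
have F0 : 0 <= F by rewrite /F !addr_ge0// mulr_ge0// ltW.
have W0 : 0 <= F * Q * l by rewrite !mulr_ge0// ltW.
have [n [h [kap [e [tau [beta [[n0 kap0 kaph lE] [b1 b2 he] [t0 th tl t2 t3]
  [/andP[e0 e1] bb eX eW]]]]]]]] :=
  grid_parameters l0 k0 X0 (mulr_gt0 d0 Q0) W0 C0 de0 et0.
have h0 : 0 < h.
  by apply: lt_le_trans kaph; rewrite mulr_gt0.
have [b [bi bu ubX ubo]] :=
  averaged_density avL lipP C0 rho_int L_max h0 lE t0 th tl he e1.
rewrite -/X in ubX ubo.
pose ub i := L (b i).
have sE : Num.sqrt (tau ^+ 2) = tau by rewrite sqrtr_sqr ger0_norm// ltW.
pose c i := ln (ub i + delta).
pose phi := interp n h kap c; pose dphi := dinterp n h kap c.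
pose sp i := (c i.+1 - c i) / h.
pose q i := expR (- P (i%:R * h)).
have q0 i : 0 < q i by exact: expR_gt0.
have qQ i : (i <= n)%N -> q i <= Q.
  move=> lin; apply: PQ; rewrite in_itv/= lE ler_wpM2r ?(ltW h0) ?ler_nat// andbT.
  by rewrite mulr_ge0// ltW.
pose E := C * (Num.sqrt h + tau).
have E0 : 0 <= E by rewrite mulr_ge0 ?(ltW C0)// addr_ge0 ?sqrtr_ge0// ltW.
have ED : 0 <= E * D1 <= 2 * X * e.
  rewrite mulr_ge0 ?(ltW D10)//= /E /X.
  rewrite (_ : C * _ * _ = C * D1 * (Num.sqrt h + tau)); last by ring.
  rewrite (_ : 2 * _ * e = C * D1 * (e + e)); last by ring.
  by rewrite ler_wpM2l ?(ltW X0)// lerD// (le_trans th).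
pose Lin r := \sum_(i < n) d * q i * (- sp i * (b i.+1 r - b i r) + beta * sp i ^+ 2 * h * b i r).
pose K := \sum_(i < n) d * q i * (2 * `|sp i| * (C * tau) + beta * sp i ^+ 2 * h * E).
have Lini i : (i < n)%N -> tint (fun r => - sp i * (b i.+1 r - b i r) + beta * sp i ^+ 2 * h * b i r).
  move=> lin; apply: integrable_realD => //; apply: integrable_realZ => //.
    by apply: integrable_realB => //; [exact: bi|exact/bi/ltnW].
  exact/bi/ltnW.
have K0 : 0 <= K.
  have b0 : 0 <= beta by case/andP : bb.
  apply: sumr_ge0 => i _; apply: mulr_ge0; first by rewrite mulr_ge0 ?ltW.
  apply: addr_ge0; first by rewrite !mulr_ge0 ?normr_ge0 ?(ltW C0) ?(ltW t0).
  by rewrite mulr_ge0// mulr_ge0 ?(ltW h0)// mulr_ge0// sqr_ge0.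
exists phi, dphi, (b 0%N), (b n), Lin, K; split.
- by split => //; rewrite lE; exact: interp_is_C1.
- split; [exact: bi|exact: bi|].
  by apply: integrable_real_sum => // i _; apply: integrable_realZ => //; exact: Lini.
- split; [exact: interp0|by rewrite lE; exact: interp_end| |].
    by case/andP : (ubX 0%N (leq0n _)).
  by case/andP : (ubX n (leqnn _)).
- move=> r u J g rT g0 ed; have g1 : 0 <= 1 + g by rewrite addr_ge0.
  split.
  + apply: le_trans (ler_wpM2r g1 t2).
    by have := bu 0%N r u J g (leq0n _) g0 ed; rewrite mul0r.
  + apply: le_trans (ler_wpM2r g1 t2).
    by have := bu n r u J g (leqnn _) g0 ed; rewrite -lE.
  + have H := @edge_pointwise R P C n h kap k (tau ^+ 2) C0 kap0 kaph k0.
    rewrite -lE sE in H.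
    apply: (le_trans (H lipP lipk (rho r) u J g ed g0 (b^~ r)
      (fun i lin => bu i r u J g lin g0 ed) c d beta d0 b1 b2)).
    rewrite /Lin /K mulr_suml -big_split/=; apply: ler_sum => i _.
    by rewrite -/(sp i) -/(q i) -/E le_eqVlt; apply/orP; left; apply/eqP; ring.
have LLin : L Lin = \sum_(i < n) d * q i *
    (- sp i * (ub i.+1 - ub i) + beta * sp i ^+ 2 * h * ub i).
  rewrite /Lin (averaging_sum avL); last first.
    by move=> i _; apply: integrable_realZ => //; exact: Lini.
  apply: eq_bigr => i _; rewrite (averagingZ avL); last exact: Lini.
  have b1i := bi _ (ltn_ord i); have bii := bi _ (ltnW (ltn_ord i)).
  have bbi : tint (fun r => b i.+1 r - b i r) by exact: integrable_realB.
  rewrite (averagingD avL) ?(averagingZ avL) ?(averagingB avL)//.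
  - exact: integrable_realZ.
  - exact: integrable_realZ.
split.
  rewrite LLin /K mulr_suml -big_split/=.
  apply: (@le_trans _ _ (\sum_(i < n) d * Q * (2 * (3 * X / delta / h) * X) * tau)); last first.
    rewrite sumr_const card_ord -mulr_natl; apply: le_trans t3.
    by rewrite le_eqVlt; apply/orP; left; apply/eqP; ring.
  apply: ler_sum => i _; have lin := ltn_ord i; have lin' := ltnW lin.
  have x1 : 0 <= ub i.+1 by case/andP : (ubX _ lin).
  have [main spb] := cell_dissipation X0 (introT andP (conj e0 e1)) de0 eX h0
    (ubX _ lin') x1 (ubo _ lin) bb ED.
  rewrite -/(ub i) -/(ub i.+1) -/(c i) -/(c i.+1) -/(sp i) in main spb.
  rewrite (_ : _ + _ = d * q i * (- sp i * (ub i.+1 - ub i)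
      + beta * sp i ^+ 2 * h * (ub i + E * D1)) +
      d * q i * (2 * `|sp i| * X * tau)); last by rewrite /X; ring.
  rewrite -[leRHS]add0r lerD//.
    by rewrite mulr_ge0_le0// mulr_ge0 ?ltW.
  have a0 : 0 <= d * q i by rewrite mulr_ge0 ?ltW.
  rewrite -[leRHS]mulrA; apply: ler_pM => //.
    by rewrite mulr_ge0 ?(ltW t0)// mulr_ge0 ?(ltW X0)// mulr_ge0.
    by rewrite ler_wpM2l ?(ltW d0)// qQ.
  by rewrite ler_wpM2r ?(ltW t0)// ler_wpM2r ?(ltW X0)// ler_wpM2l.
have cphi : {within `[0, l], continuous phi}.
  exact/continuous_subspaceT/continuous_interp.
have cf : {within `[0, l], continuous (fun x => psi x - phi x)} by exact: within_itvB.
have cP := continuous_expNP lipP.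
have oe : 3 * X * e < delta.
  have := mulr_gt0 X0 e0; move: eX; lra.
have lnB x : x \in `[0, l] -> ln delta <= phi x <= 2 * X.
  by move=> xl; apply: (log_interp_bound n0 kap0 kaph de0 de1 ubX); rewrite -lE.
have fF x : x \in `[0, l] -> `|psi x - phi x| <= F.
  move=> xl; apply: (le_trans (ler_normB _ _)); rewrite lerD ?psiB//.
  have /andP[f1 f2] := lnB x xl; have := ler_norm (- ln delta); rewrite normrN => ?.
  by rewrite ler_norml; apply/andP; split; have := normr_ge0 (ln delta); lra.
have [a0 [a aE]] := interp_integral n kap0 kaph cf cP.
pose N r := b 0%N r * a0 + \sum_(k < n) (b k.+1 r - b k r) * a k.
have b0i := bi 0%N (leq0n _).
have bki (i : 'I_n) : tint (fun r => b i.+1 r - b i r).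
  by apply: integrable_realB => //; [exact: bi|exact/bi/ltnW].
have bkai (i : 'I_n) : tint (fun r => (b i.+1 r - b i r) * a i).
  have -> : (fun r => (b i.+1 r - b i r) * a i) = (fun r => a i * (b i.+1 r - b i r)).
    by apply/funext => r; exact: mulrC.
  exact: integrable_realZ.
have b0ai : tint (fun r => b 0%N r * a0).
  have -> : (fun r => b 0%N r * a0) = (fun r => a0 * b 0%N r).
    by apply/funext => r; exact: mulrC.
  exact: integrable_realZ.
have Ni : tint N by apply: integrable_realD => //; exact: integrable_real_sum.
have LN : L N = ub 0%N * a0 + \sum_(k < n) (ub k.+1 - ub k) * a k.
  rewrite /N (averagingD avL)//; last exact: integrable_real_sum.
  rewrite (averaging_sum avL)//; congr (_ + _).
    rewrite mulrC -(averagingZ avL)//; congr L; apply/funext => r; exact: mulrC.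
  apply: eq_bigr => k' _; rewrite mulrC -(averagingB avL)//; last 2 first.
  - exact: bi.
  - exact/bi/ltnW.
  rewrite -(averagingZ avL)//; congr L; apply/funext => r; exact: mulrC.
have Lf : L (fun r => \int[rho r]_(x in `[0, l]) (psi x - phi x)) <=
    L N + F * Q * l * (2 * X) * e.
  rewrite -lerBlDl -(averagingB avL)//; last exact: rho_int.
  apply: (@le_trans _ _ ((F * Q * l * E + 0) * D1)); last first.
    rewrite addr0 -mulrA -2!mulrA; rewrite 2!mulrA; rewrite -[leRHS]mulrA ler_wpM2l//.
    by case/andP : ED.
  apply/ler_addgt0Pr => z z0.
  apply: (@le_trans _ _ ((F * Q * l * E + z / D1) * D1)); last first.
    by rewrite addr0 mulrDl divfK ?gt_eqF.
  apply: L_max.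
  - by rewrite ltr_wpDl ?divr_gt0// mulr_ge0.
  - by apply: integrable_realB => //; exact: rho_int.
  move=> r u J g rT g0 ed.
  have H := @integral_near_interp R P C n h kap (tau ^+ 2) C0 kap0 kaph n0.
  rewrite -lE sE in H.
  have {}H := H lipP (rho r) u J g ed g0 (b^~ r)
      (fun i lin => bu i r u J g lin g0 ed) _ F Q cf fF PQ.
  rewrite aE -/(N r) in H.
  apply: (le_trans (ler_norm _)); apply: (le_trans H).
  rewrite -/E (mulrA _ E) [leRHS]mulrDl lerDl.
  by rewrite mulr_ge0 ?addr_ge0// divr_ge0 ?ltW.
have LB : L (fun r => \int[rho r]_(x in `[0, l]) (psi x - phi x)) =
    L (fun r => \int[rho r]_(x in `[0, l]) psi x)
    - L (fun r => \int[rho r]_(x in `[0, l]) phi x).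
  rewrite -(averagingB avL); [|exact: rho_int|exact: rho_int].
  by congr L; apply/funext => r; rewrite RintegralB//; exact: within_itv_integrable.
have opt := @log_interp_near_optimal R n h kap X delta (3 * X * e) ub n0 kap0 kaph
  de0 de1 ubX ubo oe P psi Q Psi.
rewrite -lE in opt; have {}opt := opt lipP PQ cpsi psiB (ltW X0).
rewrite aE -/F -LN in opt.
rewrite LB in Lf.
have fin : F * Q * l * (2 * X) * e + (F * (2 * (3 * X * e)) + delta * (2 * X + Psi)) * Q * l
    <= delta * (Q * l * (2 * X + Psi)) + eta.
  rewrite (_ : _ + _ = delta * (Q * l * (2 * X + Psi)) + F * Q * l * (8 * X) * e); last by ring.
  by rewrite lerD2l.
move: opt Lf fin; rewrite -/phi -/c -/X.
move: (_ * Q * l) => A1; move: (F * Q * l * _ * e) => A2; move: (delta * _ + eta) => A3.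
move: (Rintegral _ _ _) => B1; move: (Rintegral _ _ _) => B2; move: (L N) => B3.
move: (L _) => B4; move: (L _) => B5; lra.
Qed.

End edge_step.

(** * One time step on the graph *)

Section node_step.
Context {R : realType}.

(** With [A = a + delta] and [B = b + delta] in place of [a] and [b] the first
    expression would vanish; the shift leaves [- delta (a - b)^2 / (A B)]. *)
Lemma node_dissipation (a b delta : R) : 0 <= a -> 0 <= b -> 0 < delta ->
  let z := ln (a + delta) - ln (b + delta) in
  a * (expR (- z) - 1) + b * (expR z - 1) <= 0 /\
  `|expR z - 1| <= (a + delta) / delta + 1.
Proof.
move=> a0 b0 de0 /=.
have A0 : 0 < a + delta by rewrite ltr_wpDl.
have B0 : 0 < b + delta by rewrite ltr_wpDl.
have zE : expR (ln (a + delta) - ln (b + delta)) = (a + delta) / (b + delta).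
  by rewrite expRB !lnK.
rewrite expRN zE; split.
  rewrite (_ : _ + _ = - delta * (a - b) ^+ 2 / ((a + delta) * (b + delta))); last first.
    by field; rewrite !gt_eqF.
  rewrite !mulNr oppr_le0 divr_ge0//; last by rewrite mulr_ge0// ltW.
  by rewrite mulr_ge0 ?sqr_ge0// ltW.
apply: (le_trans (ler_normB _ _)); rewrite normr1 lerD2r ger0_norm; last first.
  by rewrite divr_ge0// ltW.
by rewrite ler_wpM2l ?(ltW A0)// lef_pV2// lerDr.
Qed.

(** The concave function [psi |-> psi m - w expR psi] is maximal at [ln (m / w)];
    the shift [delta], which keeps [phi] finite at [m = 0], costs [O(delta)]. *)
Lemma node_near_optimal (w m psi delta : R) : 0 < w -> 0 <= m <= 1 ->
  0 < delta -> delta <= 1 ->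
  let phi := ln (m / w + delta) in
  psi * m - w * (expR psi - 1) <=
  phi * m - w * (expR phi - 1) + delta * (w * (`|psi| + w^-1)).
Proof.
move=> w0 /andP[m0 m1] de0 de1 /=; set A := m / w + delta.
have A0 : 0 < A by rewrite ltr_wpDl// divr_ge0// ltW.
have mE : w * A = m + delta * w by rewrite /A; field; rewrite gt_eqF.
have mw : m / w <= w^-1 by rewrite ler_piMl ?invr_ge0 ?(ltW w0).
have lnA : ln A <= w^-1.
  have := @le_ln1Dx _ (A - 1); rewrite addrCA subrr addr0 => h1.
  by move: A0 h1; rewrite /A => ? h1; apply: le_trans (h1 _) _; lra.
have eA : expR (ln A) = A by rewrite lnK.
have := expR_ge1Dx (psi - ln A); rewrite expRB eA ler_pdivlMr// => h1.
have h2 := ler_wpM2l (ltW w0) h1.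
have h3 : w * ((1 + (psi - ln A)) * A) = (1 + (psi - ln A)) * (m + delta * w).
  by rewrite -mE; ring.
have h4 : delta * w * (ln A - psi) <= delta * w * (w^-1 + `|psi|).
  rewrite ler_wpM2l ?mulr_ge0 ?(ltW de0) ?(ltW w0)//.
  have := ler_norm (- psi); rewrite normrN; lra.
rewrite h3 in h2; move: (w^-1) h4 h2 => W h4 h2.
have := mE; lra.
Qed.

End node_step.

Section one_step.
Context {R : realType} {V : finType} (M : metric_graph R V).
Variables (nu : state R V) (P : V * V -> R -> R).
Variables (d : V * V -> R) (kappa : V * V -> V -> R) (T : R).
Hypothesis omega_gt0 : forall v, 0 < node_mass nu v.
Hypothesis nu_gibbs : is_gibbs M P nu.
Hypothesis d_gt0 : forall e, e \in edges M -> 0 < d e.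
Hypothesis kappa_gt0 : forall e v, e \in edges M -> ends e v -> 0 < kappa e v.
Variables (mu : R -> state R V) (j : R -> flux R V).
Hypothesis ce : CE M T mu j.
Local Notation leb := (@lebesgue_measure R).
Local Notation tint f := (leb.-integrable `[0, T] (EFin \o f)).

(** The Legendre transform of the entropy: the conjugate of
    [g |-> w * eta (g / w)] is [p |-> w * (expR p - 1)]. *)
Definition legendre (phi : V -> R) (vphi : V * V -> R -> R) : R :=
  \sum_v node_mass nu v * (expR (phi v) - 1)
  + \sum_(e in edges M) \int[edge_meas nu e]_(x in `[0, len M e]) (expR (vphi e x) - 1).

Definition edgewise_continuous (vphi : V * V -> R -> R) :=
  forall e, e \in edges M -> {within `[0, len M e], continuous (vphi e)}.

Lemma pairing_time_integrable phi vphi : edgewise_continuous vphi ->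
  tint (fun r => pairing M phi vphi (mu r)).
Proof. by move=> cv; apply: within_itv_lebesgue; exact: (CE_narrow ce). Qed.

Lemma node_mass_time_integrable v : tint (fun r => node_mass (mu r) v).
Proof.
have := @pairing_time_integrable (fun w => (w == v)%:R) (fun _ _ => 0).
rewrite (_ : (fun r => pairing _ _ _ (mu r)) = fun r => node_mass (mu r) v).
  by apply=> e _; exact/continuous_subspaceT/cst_continuous.
apply/funext => r; rewrite /pairing [X in _ + X]big1 => [|e _]; last first.
  by rewrite Rintegral_cst// mul0r.
rewrite addr0 (bigD1 v)//= eqxx mul1r big1 ?addr0// => w /negbTE ->.
by rewrite mul0r.
Qed.

Lemma edge_time_integrable e f : e \in edges M ->
  {within `[0, len M e], continuous f} ->
  tint (fun r => \int[edge_meas (mu r) e]_(x in `[0, len M e]) f x).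
Proof.
move=> eM cf.
have := @pairing_time_integrable (fun=> 0) (fun e' => if e' == e then f else fun=> 0).
rewrite (_ : (fun r => pairing _ _ _ (mu r)) = fun r => \int[edge_meas (mu r) e]_(x in `[0, len M e]) f x).
  apply=> e' _; case: eqP => [->//|_].
  exact/continuous_subspaceT/cst_continuous.
apply/funext => r; rewrite /pairing big1 => [|v _]; last by rewrite mul0r.
rewrite add0r (bigD1 e)//= eqxx big1 ?addr0// => e' /andP[_ /negbTE ->].
by rewrite Rintegral_cst// mul0r.
Qed.

Let g r := (rate M d kappa (mu r) (j r) + fisher M nu P d kappa (mu r))%E.

Variable gs : R -> R.
Hypothesis gs_int : tint gs.
Hypothesis gs_ge0 : forall r, 0 <= gs r.
Hypothesis gs_max : forall h : R -> R, measurable_fun (`[0, T] : set (line R)) h ->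
  (forall r, r \in `[0, T] -> ((h r)%:E <= g r)%E) ->
  {ae leb, forall r : line R, r \in `[0, T] -> h r <= gs r}.

(** Solving for the dissipation makes the bound a measurable minorant of [g], to
    which maximality of [gs] applies. *)
Lemma dissipation_majorant (H : R -> R) (a c : R) : 0 < c -> tint H ->
  (forall r, r \in `[0, T] -> (g r < +oo)%E -> H r <= a + c * fine (g r)) ->
  {ae leb, forall r : line R, r \in `[0, T] -> H r <= a + c * gs r}.
Proof.
move=> c0 iH Hg.
have := gs_max (h := fun r => c^-1 * (H r - a)).
case=> [|r rT|N [mN N0 NU]].
- have /integrableP[/measurable_EFinP mH _] := iH.
  by apply: measurable_funM => //; apply: measurable_funB.
- have [goo|] := boolP (g r < +oo)%E; last by rewrite -leNgt leye_eq => /eqP ->; exact: leey.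
  have g0 : (0 <= g r)%E.
    by apply: adde_ge0; [exact: rate_ge0|exact: fisher_ge0].
  rewrite -[leRHS]fineK ?ge0_fin_numE// lee_fin ler_pdivrMl//.
  by have := Hg r rT goo; lra.
exists N; split => // r /= nr; apply: NU => /= h; apply: nr => rT.
by have := h rT; rewrite ler_pdivrMl//; lra.
Qed.

Variable L : (R -> R) -> R.
Hypothesis avL : averaging T L.

Lemma averaging_pairing phi vphi : edgewise_continuous vphi ->
  L (fun r => pairing M phi vphi (mu r)) =
  \sum_v phi v * L (fun r => node_mass (mu r) v)
  + \sum_(e in edges M) L (fun r => \int[edge_meas (mu r) e]_(x in `[0, len M e]) vphi e x).
Proof.
move=> cv; rewrite /pairing (averagingD avL); last 2 first.
- apply: integrable_real_sum => // v _; apply: integrable_realZ => //.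
  exact: node_mass_time_integrable.
- by apply: integrable_real_sum => // e eM; apply: edge_time_integrable => //; exact: cv.
rewrite (averaging_sum avL); last first.
  move=> v _; apply: integrable_realZ => //; exact: node_mass_time_integrable.
congr (_ + _).
  apply: eq_bigr => v _; rewrite (averagingZ avL)//; exact: node_mass_time_integrable.
rewrite (averaging_sum avL)// => e eM; apply: edge_time_integrable => //; exact: cv.
Qed.

Lemma legendre_edge e f : e \in edges M -> {within `[0, len M e], continuous f} ->
  \int[edge_meas nu e]_(x in `[0, len M e]) (expR (f x) - 1) =
  \int[leb]_(x in `[0, len M e]) (expR (f x) * expR (- P e x))
  - \int[leb]_(x in `[0, len M e]) expR (- P e x).
Proof.
move=> eM cf; have [lipP gibbs] := nu_gibbs eM.
have cP := continuous_expNP lipP.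
have ce' : {within `[0, len M e], continuous (fun x => expR (f x))}.
  by apply: within_itv_comp => //; exact: continuous_expR.
have cef : {within `[0, len M e], continuous (fun x => expR (f x) - 1)}.
  by apply: within_itvB => //; exact/continuous_subspaceT/cst_continuous.
rewrite (Rintegral_density (gibbs_has_density lipP gibbs))//; last first.
  exact: within_itv_integrable.
rewrite -RintegralB//; last 2 first.
- by apply: within_itv_lebesgue; exact: within_itvM.
- exact: within_itv_lebesgue.
apply: eq_Rintegral => x xl; rewrite /gibbs_density patchE xl; ring.
Qed.

(** The potential is the logarithm of the average of the densities under [L],
    regularized by [delta] and by the interpolation.  It nearly maximizes
    the Legendre pairing with the averaged state, so it does no worse than [psi].
    The static estimate bounds the speed of its pairing by the dissipation plus
    terms linear in the densities, and the average under [L] of these terms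
    is that of [node_dissipation] and [cell_dissipation], hence almost nonpositive.
    Only the average of [X] is controlled by that of the dissipation, not [X]
    itself. *)
Lemma one_step (psi : V -> R) (vpsi : V * V -> R -> R) (eps : R) :
  edgewise_continuous vpsi -> 0 < eps ->
  exists (phi : V -> R) (vphi dvphi : V * V -> R -> R) (X : R -> R), [/\
    forall e, e \in edges M -> is_C1 (len M e) (vphi e) (dvphi e),
    tint X,
    {ae leb, forall t : line R, t \in `[0, T] ->
      `|flux_pairing M phi vphi dvphi (j t)| <= X t},
    L X <= L gs + eps &
    L (fun r => pairing M psi vpsi (mu r)) - legendre psi vpsi <=
    L (fun r => pairing M phi vphi (mu r)) - legendre phi vphi + eps].
Proof.
move=> cpsi eps0.
have [C C0 static] := static_estimate omega_gt0 nu_gibbs d_gt0 kappa_gt0.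
pose D1 := 1 + L gs.
have Lgs0 : 0 <= L gs by apply: (averaging_ge0 avL gs_int).
have D10 : 0 < D1 by rewrite /D1 ltr_wpDr.
have bounds e : exists Qe Pe : R, e \in edges M ->
    (forall x, x \in `[0, len M e] -> expR (- P e x) <= Qe) /\
    (forall x, x \in `[0, len M e] -> `|vpsi e x| <= Pe).
  have [eM|] := boolP (e \in edges M); last by exists 0, 0.
  have [lipP _] := nu_gibbs eM; have [Qe _ HQ] := potential_bounds lipP.
  have [Pe _ HP] := within_itv_bounded (cpsi _ eM).
  by exists Qe, Pe => _; split => // x /HQ[].
pose Qe e := projT1 (cid (bounds e)); pose Pe e := projT1 (cid (projT2 (cid (bounds e)))).
have QP e : e \in edges M ->
    (forall x, x \in `[0, len M e] -> expR (- P e x) <= Qe e) /\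
    (forall x, x \in `[0, len M e] -> `|vpsi e x| <= Pe e).
  exact: (projT2 (cid (projT2 (cid (bounds e))))).
clearbody Qe Pe; move: bounds => _.
pose Se e := Qe e * len M e * (2 * (C * D1) + Pe e).
have Se0 e : e \in edges M -> 0 <= Se e.
  move=> eM; have [HQ HP] := QP _ eM; have l0 := len_gt0 eM.
  have in0 : 0 \in `[0, len M e] by rewrite in_itv/= lexx ltW.
  have Q0 : 0 <= Qe e by apply: le_trans (HQ _ in0); exact: expR_ge0.
  have P0 : 0 <= Pe e by apply: le_trans (HP _ in0).
  rewrite mulr_ge0//; first by rewrite mulr_ge0// ltW.
  by rewrite addr_ge0// mulr_ge0// mulr_ge0// ltW.
(* the loss in the Legendre pairing is at most [delta * S2] plus multiples of
   [eta], which fixes [delta]; [eta] is chosen afterwards since [S1] depends on [delta] *)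
pose S2 := \sum_v node_mass nu v * (`|psi v| + (node_mass nu v)^-1)
  + \sum_(e in edges M) Se e.
have S20 : 0 <= S2.
  rewrite addr_ge0//; last by apply: sumr_ge0.
  by apply: sumr_ge0 => v _; rewrite mulr_ge0 ?addr_ge0 ?invr_ge0// ltW.
pose delta := Num.min 1 (eps / 2 / (S2 + 1)).
have S21 : 0 < S2 + 1 by rewrite ltr_wpDl.
have de0 : 0 < delta by rewrite /delta lt_min ltr01 !divr_gt0.
have [de1 deS] : delta <= 1 /\ delta * S2 <= eps / 2.
  have : delta <= delta by []; rewrite {2}/delta le_min => /andP[? h]; split => //.
  move: h; rewrite ler_pdivlMr// mulrDr mulr1; move: (delta * S2) => z; have := de0; lra.
clearbody delta.
pose jr := jump_rate M nu P kappa.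
have jr0 e v : e \in edges M -> ends e v -> 0 <= jr e v.
  by move=> eM ev; rewrite mulr_ge0 ?sqrtr_ge0// ltW// kappa_gt0.
pose zb v := ((node_mass nu v)^-1 + delta) / delta + 1.
have zb0 v : 0 <= zb v.
  rewrite /zb addr_ge0// divr_ge0 ?(ltW de0)// addr_ge0 ?(ltW de0)//.
  by rewrite invr_ge0 ltW.
pose S1 := \sum_(e in edges M) \sum_(v | ends e v) jr e v * zb v.
have S10 : 0 <= S1.
  by apply: sumr_ge0 => e eM; apply: sumr_ge0 => v ev; rewrite mulr_ge0// jr0.
pose nE : R := \sum_(e in edges M) 1.
have nE0 : 0 <= nE by exact: sumr_ge0.
have SD0 : 0 <= S1 * D1 by rewrite mulr_ge0// ltW.
pose eta := eps / 2 / (S1 * D1 + nE + 1).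
have Z0 : 0 < S1 * D1 + nE + 1 by rewrite ltr_wpDl// addr_ge0.
have eta0 : 0 < eta by rewrite !divr_gt0.
have etaS : eta * (S1 * D1) + eta * nE + eta = eps / 2.
  by rewrite -mulrDr -[X in _ + X]mulr1 -mulrDr /eta divfK// gt_eqF.
clearbody eta.
have estep e : exists x : (R -> R) * (R -> R) * (R -> R) * (R -> R) * (R -> R) * R,
    let: (phi, dphi, b0, bl, Lin, K) := x in e \in edges M -> [/\
    is_C1 (len M e) phi dphi /\ 0 <= K,
    [/\ tint b0, tint bl & tint Lin],
    [/\ phi 0 = ln (L b0 + delta), phi (len M e) = ln (L bl + delta), 0 <= L b0 & 0 <= L bl],
    forall r u J g, r \in `[0, T] -> 0 <= g ->
      edge_data (len M e) (P e) C (edge_meas (mu r) e) u J g ->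
      [/\ `|b0 r - u 0| <= eta * (1 + g), `|bl r - u (len M e)| <= eta * (1 + g) &
       d e / 2 * \int[edge_meas (mu r) e]_(x in `[0, len M e]) (dphi x ^+ 2)
        - 2 * d e * (J (len M e) - J 0) <= Lin r + K * (1 + g)] &
    L Lin + K * D1 <= eta /\
    L (fun r => \int[edge_meas (mu r) e]_(x in `[0, len M e]) vpsi e x)
      - \int[leb]_(x in `[0, len M e]) (expR (vpsi e x) * expR (- P e x)) <=
    L (fun r => \int[edge_meas (mu r) e]_(x in `[0, len M e]) phi x)
      + (delta * Se e + eta)
      - \int[leb]_(x in `[0, len M e]) (expR (phi x) * expR (- P e x))].
  have [eM|neM] := boolP (e \in edges M); last first.
    by exists ((fun=> 0), (fun=> 0), (fun=> 0), (fun=> 0), (fun=> 0), 0).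
  have [HQ HP] := QP _ eM; have [lipP _] := nu_gibbs eM.
  have := @edge_step R T L (fun r => edge_meas (mu r) e) (len M e) (P e) C D1 avL
    (len_gt0 eM) lipP C0 D10 (fun f cf => edge_time_integrable eM cf).
  case/(_ _ (d e) (Qe e) (Pe e) (vpsi e) (d_gt0 eM) HQ (cpsi _ eM) HP delta eta de0 de1 eta0).
    move=> H c c0 iH Hr.
    have [] := @dissipation_majorant H c c c0 iH.
      move=> r rT goo; have [u [J [s1 s2 s3 s4 _]]] := static _ _ (CE_prob ce rT) goo.
      have -> : c + c * fine (g r) = c * (1 + fine (g r)) by ring.
      apply: (Hr r (u e) (J e) _ rT).
        by apply: fine_ge0; apply: adde_ge0; [exact: rate_ge0|exact: fisher_ge0].
      split; [exact: s1|by move=> x xl; exact: s2|by move=> x y xl yl; exact: s3|exact: s4].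
    move=> N [mN N0 NU].
    have -> : c * D1 = L (fun r => c + c * gs r).
      rewrite (averagingD avL) ?(averaging_cst avL) ?(averagingZ avL)//; last 2 first.
      - exact: integrable_time_cst.
      - exact: integrable_realZ.
      by rewrite /D1 mulrDr mulr1.
    apply: (averaging_le avL) => //; last by exists N.
    by apply: integrable_realD => //; [exact: integrable_time_cst|exact: integrable_realZ].
  move=> phi [dphi [b0 [bl [Lin [K H]]]]].
  by exists (phi, dphi, b0, bl, Lin, K).
pose x e := projT1 (cid (estep e)).
pose ephi e := (x e).1.1.1.1.1; pose dphi e := (x e).1.1.1.1.2.
pose b0 e := (x e).1.1.1.2; pose bl e := (x e).1.1.2.
pose Lin e := (x e).1.2; pose K e := (x e).2.
have step e : e \in edges M -> [/\
    is_C1 (len M e) (ephi e) (dphi e) /\ 0 <= K e,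
    [/\ tint (b0 e), tint (bl e) & tint (Lin e)],
    [/\ ephi e 0 = ln (L (b0 e) + delta), ephi e (len M e) = ln (L (bl e) + delta),
        0 <= L (b0 e) & 0 <= L (bl e)],
    forall r u J g, r \in `[0, T] -> 0 <= g ->
      edge_data (len M e) (P e) C (edge_meas (mu r) e) u J g ->
      [/\ `|b0 e r - u 0| <= eta * (1 + g), `|bl e r - u (len M e)| <= eta * (1 + g) &
       d e / 2 * \int[edge_meas (mu r) e]_(x in `[0, len M e]) (dphi e x ^+ 2)
        - 2 * d e * (J (len M e) - J 0) <= Lin e r + K e * (1 + g)] &
    L (Lin e) + K e * D1 <= eta /\
    L (fun r => \int[edge_meas (mu r) e]_(x in `[0, len M e]) vpsi e x)
      - \int[leb]_(x in `[0, len M e]) (expR (vpsi e x) * expR (- P e x)) <=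
    L (fun r => \int[edge_meas (mu r) e]_(x in `[0, len M e]) ephi e x)
      + (delta * Se e + eta)
      - \int[leb]_(x in `[0, len M e]) (expR (ephi e x) * expR (- P e x))].
  have := projT2 (cid (estep e)); rewrite -/(x e) /ephi /dphi /b0 /bl /Lin /K.
  by case: (x e) => [[[[[]]]]].
clearbody ephi dphi b0 bl Lin K; move: estep @x => _ _.
pose gam v := L (fun r => node_mass (mu r) v).
have gam01 v : 0 <= gam v <= 1.
  have H r : r \in `[0, T] -> 0 <= node_mass (mu r) v <= 1.
    by move=> rT; apply: prob_node_mass_le1; exact: (CE_prob ce rT).
  have iv := node_mass_time_integrable v.
  rewrite (averaging_ge0 avL iv)/=; last by move=> r /H/andP[].
  rewrite -(averaging_cst avL 1); apply: (averaging_le_in avL iv).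
    exact: integrable_time_cst.
  by move=> r /H/andP[].
pose phi v := ln (gam v / node_mass nu v + delta).
pose be e v r := if v == e.1 then b0 e r else bl e r.
have bei e v : e \in edges M -> tint (be e v).
  by move=> /step[_ [? ? _] _ _ _]; rewrite /be; case: (v == e.1).
have be0 e v : e \in edges M -> 0 <= L (be e v).
  by move=> /step[_ _ [_ _ ? ?] _ _]; rewrite /be; case: (v == e.1).
have atE e v : e \in edges M -> at_node M (ephi e) e v = ln (L (be e v) + delta).
  by move=> /step[_ _ [? ? _ _] _ _]; rewrite /be /at_node; case: (v == e.1).
pose z e v := phi v - at_node M (ephi e) e v.
have ndi e v : e \in edges M ->
    gam v / node_mass nu v * (expR (- z e v) - 1) + L (be e v) * (expR (z e v) - 1) <= 0
    /\ `|expR (z e v) - 1| <= zb v.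
  move=> eM; have /andP[g0 g1] := gam01 v; have w0 := omega_gt0 v.
  have a0 : 0 <= gam v / node_mass nu v by rewrite divr_ge0// ltW.
  have [h1 h2] := node_dissipation a0 (be0 e v eM) de0.
  rewrite /z atE// /phi; split => //; apply: (le_trans h2); rewrite /zb lerD2r.
  by rewrite ler_wpM2r ?invr_ge0 ?(ltW de0)// lerD2r ler_piMl// invr_ge0 ltW.
pose Node r := \sum_(e in edges M) \sum_(v | ends e v) jr e v *
  (node_mass (mu r) v / node_mass nu v * (expR (- z e v) - 1) + be e v r * (expR (z e v) - 1)).
have nodei e v : e \in edges M -> tint (fun r => jr e v *
  (node_mass (mu r) v / node_mass nu v * (expR (- z e v) - 1) + be e v r * (expR (z e v) - 1))).
  move=> eM.
  have -> : (fun r => jr e v *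
      (node_mass (mu r) v / node_mass nu v * (expR (- z e v) - 1) + be e v r * (expR (z e v) - 1))) =
    (fun r => jr e v * ((expR (- z e v) - 1) / node_mass nu v) * node_mass (mu r) v
      + jr e v * (expR (z e v) - 1) * be e v r).
    by apply/funext => r; ring.
  apply: integrable_realD => //; apply: integrable_realZ => //.
    exact: node_mass_time_integrable.
  exact: bei.
have Nodei : tint Node.
  apply: integrable_real_sum => // e eM; apply: integrable_real_sum => // v _.
  exact: nodei.
have LNode : L Node <= 0.
  rewrite /Node (averaging_sum avL); last first.
    by move=> e eM; apply: integrable_real_sum => // v _; exact: nodei.
  apply: sumr_le0 => e eM; rewrite (averaging_sum avL); last by move=> v _; exact: nodei.
  apply: sumr_le0 => v ev.
  have -> : (fun r => jr e v *
      (node_mass (mu r) v / node_mass nu v * (expR (- z e v) - 1) + be e v r * (expR (z e v) - 1))) =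
    (fun r => jr e v * ((expR (- z e v) - 1) / node_mass nu v) * node_mass (mu r) v
      + jr e v * (expR (z e v) - 1) * be e v r).
    by apply/funext => r; ring.
  have iv := node_mass_time_integrable v; have ib := bei e v eM.
  rewrite (averagingD avL) ?(averagingZ avL)//; last 2 first.
  - exact: integrable_realZ.
  - exact: integrable_realZ.
  rewrite -/(gam v) (_ : _ + _ = jr e v * (gam v / node_mass nu v * (expR (- z e v) - 1)
    + L (be e v) * (expR (z e v) - 1))); last by ring.
  by apply: mulr_ge0_le0; [exact: jr0|case: (ndi e v eM)].
have Lini e : e \in edges M -> tint (Lin e) by move=> /step[_ [_ _ ?] _ _ _].
pose SLin r := \sum_(e in edges M) Lin e r.
have SLini : tint SLin by apply: integrable_real_sum.
pose SK := \sum_(e in edges M) K e.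
have SK0 : 0 <= SK by apply: sumr_ge0 => e /step[[]].
have LSLin : L SLin + SK * D1 <= eta * nE.
  rewrite /SLin (averaging_sum avL)// /SK mulr_suml -big_split/= /nE mulr_sumr.
  by apply: ler_sum => e /step[_ _ _ _ [h _]]; rewrite mulr1.
have C1 e : e \in edges M -> is_C1 (len M e) (ephi e) (dphi e) by move=> /step[[]].
pose Kt := eta * S1 + SK.
have Kt0 : 0 <= Kt by rewrite addr_ge0// mulr_ge0// ltW.
pose G r := flux_pairing M phi ephi dphi (j r).
have Gi : tint G by exact: (flux_pairing_integrable ce phi C1).
pose X r := Node r + SLin r + (Kt + (1 + Kt) * gs r).
have NSi : tint (fun r => Node r + SLin r) by exact: integrable_realD.
have gsi : tint (fun r => Kt + (1 + Kt) * gs r).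
  by apply: integrable_realD => //; [exact: integrable_time_cst|exact: integrable_realZ].
exists phi, ephi, dphi, X; split => //.
- exact: integrable_realD.
- have [] := @dissipation_majorant (fun r => `|G r| - (Node r + SLin r)) Kt (1 + Kt).
  + by rewrite ltr_wpDr.
  + by apply: integrable_realB => //; exact: integrable_norm.
  + move=> r rT goo; have pm := CE_prob ce rT.
    have [u [J [s1 s2 s3 s4 s5]]] := static _ _ pm goo.
    have cdphi e : e \in edges M -> {within `[0, len M e], continuous (dphi e)}.
      by move=> /C1[].
    have := s5 phi ephi dphi cdphi; rewrite -/(G r) -/(g r).
    have g0 : 0 <= fine (g r).
      by apply: fine_ge0; apply: adde_ge0; [exact: rate_ge0|exact: fisher_ge0].
    set gr := fine (g r) in g0 *.
    have edr e : e \in edges M ->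
        edge_data (len M e) (P e) C (edge_meas (mu r) e) (u e) (J e) gr.
      move=> eM; split; [exact: s1|by move=> x xl; exact: s2|
        by move=> x y xl yl; exact: s3|exact: s4].
    have bound1 : \sum_(e in edges M) d e / 2 *
          \int[edge_meas (mu r) e]_(x in `[0, len M e]) (dphi e x ^+ 2) <=
        \sum_(e in edges M) 2 * d e * (J e (len M e) - J e 0) + (SLin r + SK * (1 + gr)).
      rewrite /SLin /SK mulr_suml -!big_split/=; apply: ler_sum => e eM.
      have [_ _ _ /(_ r _ _ _ rT g0 (edr e eM))[_ _ h] _] := step e eM.
      by rewrite addrC -lerBlDr.
    have bound2 : \sum_(e in edges M) \sum_(v | ends e v) jr e v *
        (node_mass (mu r) v / node_mass nu v * (expR (- z e v) - 1)
          + at_node M (u e) e v * (expR (z e v) - 1)) <= Node r + eta * S1 * (1 + gr).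
      rewrite /Node /S1 mulr_sumr mulr_suml -big_split/=; apply: ler_sum => e eM.
      rewrite mulr_sumr mulr_suml -big_split/=; apply: ler_sum => v ev.
      have j0 := jr0 e v eM ev; have [_ zB] := ndi e v eM.
      have bu : `|be e v r - at_node M (u e) e v| <= eta * (1 + gr).
        have [_ _ _ /(_ r _ _ _ rT g0 (edr e eM))[h0 hl _] _] := step e eM.
        by rewrite /be /at_node; case: (v == e.1).
      rewrite (_ : eta * _ * _ = jr e v * (eta * (1 + gr) * zb v)); last by ring.
      rewrite -mulrDr ler_wpM2l// -addrA lerD2l -lerBlDl -mulrBl.
      by apply: (le_trans (ler_norm _)); rewrite normrM ler_pM// distrC.
    move: bound1 bound2; rewrite /Kt -/jr.
    move: (\sum_(e in edges M) d e / 2 * _) (\sum_(e in edges M) 2 * d e * _) => B1 B2.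
    move: (\sum_(e in edges M) \sum_(v | _) _) (Node r) (SLin r) `|G r| => B3 B4 B5 B6.
    by move: (eta * S1) => B7; rewrite !mulrDr !mulr1 !mulrDl mul1r; lra.
  move=> N [mN N0 NU]; exists N; split => // r /= nr; apply: NU => /= h; apply: nr => rT.
  by have := h rT; rewrite /X -/(G r) lerBlDl.
- rewrite /X (averagingD avL)// (averagingD avL)//.
  rewrite (averagingD avL) ?(averaging_cst avL) ?(averagingZ avL)//; last 2 first.
  + exact: integrable_time_cst.
  + exact: integrable_realZ.
  have -> : Kt + (1 + Kt) * L gs = eta * S1 * D1 + SK * D1 + L gs by rewrite /Kt /D1; ring.
  move: LNode LSLin etaS; rewrite -mulrA.
  move: (L Node) (L SLin) (SK * D1) (eta * (S1 * D1)) (eta * nE) => B1 B2 B3 B4 B5; lra.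
have cephi : edgewise_continuous ephi by move=> e /C1[].
rewrite !averaging_pairing// /legendre.
have nodes : \sum_v psi v * gam v - \sum_v node_mass nu v * (expR (psi v) - 1) <=
    \sum_v phi v * gam v - \sum_v node_mass nu v * (expR (phi v) - 1)
    + delta * \sum_v node_mass nu v * (`|psi v| + (node_mass nu v)^-1).
  rewrite -!sumrB mulr_sumr -big_split/=; apply: ler_sum => v _.
  exact: node_near_optimal.
have edgs : \sum_(e in edges M) L (fun r => \int[edge_meas (mu r) e]_(x in `[0, len M e]) vpsi e x)
    - \sum_(e in edges M) \int[edge_meas nu e]_(x in `[0, len M e]) (expR (vpsi e x) - 1) <=
    \sum_(e in edges M) L (fun r => \int[edge_meas (mu r) e]_(x in `[0, len M e]) ephi e x)
    - \sum_(e in edges M) \int[edge_meas nu e]_(x in `[0, len M e]) (expR (ephi e x) - 1)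
    + (delta * \sum_(e in edges M) Se e + eta * nE).
  rewrite -!sumrB /nE !mulr_sumr -!big_split/=; apply: ler_sum => e eM.
  have [_ _ _ _ [_ h]] := step e eM.
  rewrite !legendre_edge//; [|exact: cephi|exact: cpsi].
  move: h; rewrite mulr1.
  move: (L _) (L _) (Rintegral _ _ _) (Rintegral _ _ _) (Rintegral _ _ _) (delta * _).
  by move=> B1 B2 B3 B4 B5 B6; lra.
move: nodes edgs; rewrite -/(gam _).
have -> : \sum_v psi v * L (fun r => node_mass (mu r) v) = \sum_v psi v * gam v by [].
have -> : \sum_v phi v * L (fun r => node_mass (mu r) v) = \sum_v phi v * gam v by [].
have SDE : 0 <= eta * (S1 * D1) by rewrite mulr_ge0// ltW.
move: deS; rewrite /S2 mulrDr.
move: (delta * _) (delta * _) (eta * nE) (eta * (S1 * D1)) etaS SDE => D2 D3 D4 D5 etaS SDE.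
move: (\sum_v _) (\sum_v _) (\sum_v _) (\sum_v _) => B1 B2 B3 B4.
move: (\sum_(e in _) _) (\sum_(e in _) _) (\sum_(e in _) _) (\sum_(e in _) _) => A1 A2 A3 A4.
lra.
Qed.

End one_step.

(** * Marching backwards in time *)

Section time_chain.
Context {R : realType}.
Local Notation leb := (@lebesgue_measure R).
Implicit Types (f g F X : R -> R) (a s t T tau theta : R).

Definition cell_average a tau f := tau^-1 * \int[leb]_(r in `[a, a + tau]) f r.

Lemma subset_cell T a tau : 0 <= a -> a + tau <= T -> `[a, a + tau] `<=` `[0, T].
Proof.
move=> a0 aT r /=; rewrite !in_itv/= => /andP[ar rt].
by rewrite (le_trans a0 ar) (le_trans rt aT).
Qed.

Lemma cell_average_averaging T a tau : 0 < tau -> 0 <= a -> a + tau <= T ->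
  averaging T (cell_average a tau).
Proof.
move=> tau0 a0 aT; have sub := subset_cell a0 aT.
have S f : leb.-integrable `[0, T] (EFin \o f) -> leb.-integrable `[a, a + tau] (EFin \o f).
  by move=> fi; apply: (integrableS _ _ _ fi).
split=> [c f g /S fi /S gi|f g /S fi /S gi [N [mN N0 NU]]|].
- rewrite /cell_average RintegralD//; last exact: integrable_realZ.
  by rewrite RintegralZl//; ring.
- rewrite /cell_average ler_pM2l ?invr_gt0//; apply: ae_le_Rintegral => //.
  exists N; split => // r /= nr; apply: NU => /= h; apply: nr => /sub; exact: h.
- rewrite /cell_average Rintegral_itv_cst ?lerDl ?ltW//.
  by rewrite mul1r addrC addKr mulVf// gt_eqF.
Qed.

Lemma averaging_convex T theta L1 L2 : 0 <= theta -> theta <= 1 ->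
  averaging T L1 -> averaging T L2 ->
  averaging T (fun f => (1 - theta) * L1 f + theta * L2 f).
Proof.
move=> t0 t1 [lin1 mon1 one1] [lin2 mon2 one2]; split=> [c f g fi gi|f g fi gi fg|].
- by rewrite lin1// lin2//; ring.
- by rewrite lerD// ler_wpM2l ?subr_ge0// ?mon1 ?mon2.
- by rewrite one1 one2; ring.
Qed.

(** The increment form avoids any differentiability of [F]. *)
Definition speed_bound T F X := forall s t, 0 <= s -> s <= t -> t <= T ->
  `|F t - F s| <= \int[leb]_(r in `[s, t]) X r.

Lemma Rintegral_split (a b c : R) f : a <= b -> b <= c ->
  leb.-integrable `[a, c] (EFin \o f) ->
  \int[leb]_(r in `[a, c]) f r =
  \int[leb]_(r in `[a, b]) f r + \int[leb]_(r in `[b, c]) f r.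
Proof.
move=> ab bc fi; apply/eqP; rewrite addrC -subr_eq; apply/eqP.
rewrite Rintegral_itvB ?bnd_simp// Rintegral_itv_obnd_cbnd//.
by apply: (integrableS _ _ _ fi) => // x /=; rewrite !in_itv/= => /andP[bx ->];
  rewrite andbT (le_trans ab (ltW bx)).
Qed.

Section fixed_speed.
Variables (T : R) (F X : R -> R).
Hypotheses (iF : leb.-integrable `[0, T] (EFin \o F))
  (iX : leb.-integrable `[0, T] (EFin \o X)) (FX : speed_bound T F X).

Lemma speed_cell a tau s t : 0 <= a -> a + tau <= T ->
  s \in `[a, a + tau] -> t \in `[a, a + tau] ->
  `|F t - F s| <= \int[leb]_(r in `[a, a + tau]) X r.
Proof.
move=> a0 aT; wlog st : s t / s <= t => [H sa ta|].
  have [st|/ltW ts] := leP s t; first exact: H.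
  by rewrite distrC; exact: H.
rewrite !in_itv/= => /andP[as_ sb] /andP[at_ tb].
have sub := subset_cell a0 aT.
have iXa : leb.-integrable `[a, a + tau] (EFin \o X) by apply: (integrableS _ _ _ iX).
have iXs : leb.-integrable `[s, a + tau] (EFin \o X).
  apply: (integrableS _ _ _ iXa) => // r /=; rewrite !in_itv/= => /andP[sr ->].
  by rewrite (le_trans as_ sr).
rewrite (Rintegral_split as_ sb iXa) (Rintegral_split st tb iXs).
have h1 : 0 <= \int[leb]_(r in `[a, s]) X r.
  by apply: le_trans (FX a0 as_ (le_trans sb aT)).
have h2 : 0 <= \int[leb]_(r in `[t, a + tau]) X r.
  by apply: le_trans (FX (le_trans a0 at_) tb aT).
have := FX (le_trans a0 as_) st (le_trans tb aT).
by move: (Rintegral _ _ _) h1 (Rintegral _ _ _) (Rintegral _ _ _) h2 => *; lra.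
Qed.

Lemma cell_average_near a tau s : 0 < tau -> 0 <= a -> a + tau <= T ->
  s \in `[a, a + tau] ->
  `|cell_average a tau F - F s| <= tau * cell_average a tau X.
Proof.
move=> tau0 a0 aT sa; have av := cell_average_averaging tau0 a0 aT.
set I := tau * _.
have IE : I = \int[leb]_(r in `[a, a + tau]) X r.
  by rewrite /I /cell_average mulrA divff ?mul1r ?gt_eqF.
have sub := subset_cell a0 aT.
have iFa : leb.-integrable `[a, a + tau] (EFin \o F) by apply: (integrableS _ _ _ iF).
have near t : t \in `[a, a + tau] -> F s - I <= F t <= F s + I.
  move=> ta; have := speed_cell a0 aT sa ta; rewrite -IE ler_norml => /andP[? ?].
  by apply/andP; split; lra.
have C c : \int[leb]_(r in `[a, a + tau]) c = c * tau.
  by rewrite Rintegral_itv_cst ?lerDl ?ltW//; congr (_ * _); ring.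
have ic (c : R) : leb.-integrable `[a, a + tau] (EFin \o fun=> c).
  by apply: integrable_real_cst => //; exact: lebesgue_itv_lty.
have lo : (F s - I) * tau <= \int[leb]_(r in `[a, a + tau]) F r.
  by rewrite -C; apply: le_Rintegral => // t /near/andP[].
have hi : \int[leb]_(r in `[a, a + tau]) F r <= (F s + I) * tau.
  by rewrite -C; apply: le_Rintegral => // t /near/andP[].
rewrite ler_distl /cell_average mulrC; apply/andP; split.
  by rewrite ler_pdivlMr.
by rewrite ler_pdivrMr.
Qed.

End fixed_speed.

Section backward_averages.
Variables (T tau theta : R) (N : nat).
Hypotheses (tau0 : 0 < tau) (NT : T = N%:R * tau).
Hypotheses (th0 : 0 < theta) (th1 : theta < 1).

(* the left end of the cell number [m], counted from the final time *)
Definition cell_left m := T - m.+1%:R * tau.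

(** Geometric weights on the cells that are at least as late as cell [m]: the
    average looks forwards in time only, with most of its weight near cell [m]. *)
Fixpoint backward_average (m : nat) : (R -> R) -> R :=
  if m is k.+1 then fun f =>
    (1 - theta) * cell_average (cell_left k.+1) tau f + theta * backward_average k f
  else cell_average (cell_left 0) tau.

Lemma cell_leftS m : cell_left m.+1 + tau = cell_left m.
Proof. by rewrite /cell_left -[in LHS]addn1 natrD; ring. Qed.

Lemma cell_left0 : cell_left 0 + tau = T.
Proof. by rewrite /cell_left mul1r subrK. Qed.

Lemma cell_left_ge0 m : (m < N)%N -> 0 <= cell_left m.
Proof. by move=> mN; rewrite /cell_left subr_ge0 NT ler_pM2r// ler_nat. Qed.

Lemma cell_right_le m : cell_left m + tau <= T.
Proof.
case: m => [|m]; first by rewrite cell_left0.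
by rewrite cell_leftS /cell_left gerBl mulr_ge0// ltW.
Qed.

Lemma cell_averaging m : (m < N)%N -> averaging T (cell_average (cell_left m) tau).
Proof.
move=> mN; apply: cell_average_averaging => //; first exact: cell_left_ge0.
exact: cell_right_le.
Qed.

Lemma backward_averaging m : (m < N)%N -> averaging T (backward_average m).
Proof.
elim: m => [|m IH] mN /=; first exact: cell_averaging.
apply: averaging_convex; [exact: ltW|exact: ltW|exact: cell_averaging|].
exact/IH/ltnW.
Qed.

Section fixed_speed.
Variables (F X : R -> R).
Hypotheses (iF : leb.-integrable `[0, T] (EFin \o F))
  (iX : leb.-integrable `[0, T] (EFin \o X)) (FX : speed_bound T F X).

Let cellX m : (m < N)%N -> 0 <= cell_average (cell_left m) tau X.
Proof.
move=> mN; rewrite mulr_ge0 ?invr_ge0 ?(ltW tau0)//.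
apply: le_trans (FX (cell_left_ge0 mN) _ (cell_right_le m)) => //.
by rewrite lerDl ltW.
Qed.

Let cell_near m s : (m < N)%N -> s \in `[cell_left m, cell_left m + tau] ->
  `|cell_average (cell_left m) tau F - F s| <= tau * cell_average (cell_left m) tau X.
Proof.
by move=> mN; apply: (cell_average_near iF iX FX) => //;
  [exact: cell_left_ge0|exact: cell_right_le].
Qed.

Let left_in m : cell_left m \in `[cell_left m, cell_left m + tau].
Proof. by rewrite in_itv/= lexx lerDl ltW. Qed.

Let right_in m : cell_left m + tau \in `[cell_left m, cell_left m + tau].
Proof. by rewrite in_itv/= lexx andbT lerDl ltW. Qed.

Let cell_end m : (m < N)%N ->
  `|F (cell_left m + tau) - F (cell_left m)| <= tau * cell_average (cell_left m) tau X.
Proof.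
move=> mN; rewrite /cell_average mulrA divff ?mul1r ?gt_eqF//.
by apply: (speed_cell iX FX) => //; [exact: cell_left_ge0|exact: cell_right_le].
Qed.

(** A recursion in [m]: the distance between the average and the value at the
    start of its support grows by one cell at each step and is discounted by
    [theta], exactly as the weights in the average of [X]. *)
Lemma backward_average_start m : (m < N)%N ->
  (1 - theta) * (F (cell_left m) - backward_average m F) <= tau * backward_average m X.
Proof.
have ht : 0 < 1 - theta by rewrite subr_gt0.
elim: m => [|m IH] mN /=.
  have := cell_near mN (left_in 0); rewrite ler_norml => /andP[h _].
  have X0 : 0 <= tau * cell_average (cell_left 0) tau X.
    by rewrite mulr_ge0 ?(ltW tau0)// cellX.
  move: (tau * cell_average (cell_left 0) tau X) (cell_average (cell_left 0) tau F) h X0.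
  move: (F (cell_left 0)) => F0 B A h X0.
  have : (1 - theta) * (F0 - A) <= (1 - theta) * B by rewrite ler_wpM2l ?(ltW ht)//; lra.
  by move=> /le_trans; apply; rewrite ler_piMl// gerBl ltW.
have h1 := cell_near mN (left_in m.+1); have h2 := cell_end mN.
rewrite distrC in h2.
rewrite [leRHS](_ : _ = (1 - theta) * (tau * cell_average (cell_left m.+1) tau X)
  + theta * (tau * backward_average m X)); last by ring.
move: (IH (ltnW mN)) h1 h2; rewrite !ler_norml cell_leftS.
move: (tau * cell_average _ _ _) (tau * backward_average _ _) => B Zx.
move: (cell_average _ _ F) (backward_average m F) => A Y.
move: (F (cell_left m.+1)) (F (cell_left m)) => F1 F0 q /andP[h1 _] /andP[_ h2].
have q1 : (1 - theta) * ((1 - theta) * (F1 - A)) <= (1 - theta) * ((1 - theta) * B).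
  by rewrite !ler_wpM2l ?(ltW ht)//; lra.
have q2 : (1 - theta) * (theta * (F1 - F0)) <= (1 - theta) * (theta * B).
  by rewrite ler_wpM2l ?(ltW ht)// ler_wpM2l ?(ltW th0).
have q3 := ler_wpM2l (ltW th0) q.
lra.
Qed.

(** The change of the average is bounded by the same average of the speed.  This is
    the purpose of the geometric weights: a potential adapted to an average
    has a speed that is controlled under that average only. *)
Lemma backward_average_step m : (m.+1 < N)%N ->
  backward_average m.+1 F - backward_average m F <=
  tau / theta * backward_average m.+1 X.
Proof.
move=> mN; have ht : 0 < 1 - theta by rewrite subr_gt0.
rewrite /= [leRHS](_ : _ = ((1 - theta) * (tau * cell_average (cell_left m.+1) tau X)) / theta
  + tau * backward_average m X); last by field; rewrite gt_eqF.
have := backward_average_start (ltnW mN).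
have := cell_near mN (right_in m.+1); rewrite cell_leftS /=.
have : 0 <= tau * cell_average (cell_left m.+1) tau X.
  by rewrite mulr_ge0 ?(ltW tau0)// cellX.
move: (tau * _) (tau * _) (cell_average _ _ F) (backward_average m F) (F _).
move=> Zx B A Y F0 B0; rewrite ler_norml => /andP[_ h] q.
have q1 : (1 - theta) * (A - Y) <= (1 - theta) * (B + (F0 - Y)).
  by rewrite ler_wpM2l ?(ltW ht)//; lra.
have q2 : (1 - theta) * B <= (1 - theta) * B / theta.
  by rewrite ler_peMr ?mulr_ge0 ?(ltW ht)// -invr1 lef_pV2 ?posrE// ltW.
lra.
Qed.

Lemma backward_average0_end : (0 < N)%N ->
  backward_average 0 F <= F T + tau * backward_average 0 X.
Proof.
move=> N0; have := cell_near N0 (right_in 0); rewrite cell_left0 ler_norml /=.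
by move=> /andP[_]; move: (tau * _) => B; lra.
Qed.

End fixed_speed.

(** Summing the recursion for the averages gives a telescoping identity, in which
    the sum of the averages is the sum of the cell averages up to a boundary
    term at the final time. *)
Lemma backward_average_sum g m : (m < N)%N ->
  leb.-integrable `[0, T] (EFin \o g) -> (forall r, 0 <= g r) ->
  tau * \sum_(k < m) backward_average k.+1 g <=
  \int[leb]_(r in `[0, T]) g r
  + (1 - theta)^-1 * \int[leb]_(r in `[cell_left 0, T]) g r.
Proof.
move=> mN ig g0; have ht : 0 < 1 - theta by rewrite subr_gt0.
have cellE k : tau * cell_average (cell_left k) tau g =
    \int[leb]_(r in `[cell_left k, cell_left k + tau]) g r.
  by rewrite /cell_average mulrA divff ?mul1r ?gt_eqF.
have igk k : (k < N)%N -> leb.-integrable `[cell_left k, T] (EFin \o g).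
  move=> kN; apply: (integrableS _ _ _ ig) => // r /=; rewrite !in_itv/= => /andP[a ->].
  by rewrite (le_trans (cell_left_ge0 kN) a).
have sumE k : (k < N)%N -> \sum_(i < k) tau * cell_average (cell_left i.+1) tau g
    + tau * cell_average (cell_left 0) tau g = \int[leb]_(r in `[cell_left k, T]) g r.
  elim: k => [|k IH] kN; first by rewrite big_ord0 add0r cellE cell_left0.
  rewrite big_ord_recr/= addrAC IH; last exact: ltnW.
  rewrite cellE cell_leftS addrC -Rintegral_split//; last exact: igk.
    by rewrite -(cell_leftS k) lerDl ltW.
  by rewrite -(cell_leftS k); apply: le_trans (cell_right_le k.+1) _.
have rec k : (k < N)%N ->
    (1 - theta) * \sum_(i < k) backward_average i.+1 g + theta * backward_average k g =
    (1 - theta) * \sum_(i < k) cell_average (cell_left i.+1) tau g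
    + theta * backward_average 0 g.
  elim: k => [|k IH] kN; first by rewrite !big_ord0 !mulr0.
  rewrite !big_ord_recr/=; move: (IH (ltnW kN)) => /=.
  move: (\sum_(i < k) _) (\sum_(i < k) _) (backward_average k g) => S1 S2 Y.
  by move: (cell_average _ _ _) (cell_average _ _ _) => A B h; lra.
have := rec m mN; have := sumE m mN; rewrite -mulr_sumr.
have b0 k : (k < N)%N -> 0 <= backward_average k g.
  by move=> kN; apply: (averaging_ge0 (backward_averaging kN) ig).
have := b0 m mN; have := b0 0%N (leq_ltn_trans (leq0n m) mN).
have le1 : \int[leb]_(r in `[cell_left m, T]) g r <= \int[leb]_(r in `[0, T]) g r.
  rewrite (Rintegral_split (cell_left_ge0 mN) _ ig) ?lerDr ?Rintegral_ge0//.
  by apply: le_trans (cell_right_le m); rewrite lerDl ltW.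
have := cellE 0%N; rewrite cell_left0 => <-; move: le1.
move: (\int[_]_(_ in _) _) (\int[_]_(_ in _) _) => Im I0 /=.
move: (backward_average m g) (cell_average (cell_left 0) tau g) => Ym Y0.
move: (\sum_(i < m) _) (\sum_(i < m) _) => SY SA leI Y00 Ym0 E1 E2.
have tY0 : 0 <= theta * Ym by rewrite mulr_ge0 ?(ltW th0).
have q : (1 - theta) * SY <= (1 - theta) * SA + theta * Y0 by lra.
have q1 : SY <= SA + (1 - theta)^-1 * (theta * Y0).
  by rewrite -(ler_pM2l ht) mulrDr mulrA divff ?mul1r ?gt_eqF.
have q2 := ler_wpM2l (ltW tau0) q1.
apply: (le_trans q2); rewrite mulrDr lerD//.
  have := mulr_ge0 (ltW tau0) Y00; lra.
rewrite mulrCA ler_wpM2l ?invr_ge0 ?(ltW ht)// ler_wpM2l ?(ltW tau0)//.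
by rewrite ler_piMl// ltW.
Qed.

(** The cells after the first [p] carry the weight [theta ^+ p] only. *)
Lemma backward_average_near (F : R -> R) (B e del : R) m p :
  leb.-integrable `[0, T] (EFin \o F) -> 0 <= e ->
  (forall r, r \in `[0, T] -> F r <= B) ->
  (forall r, r \in `[0, T] -> r <= del -> F r <= e) -> 0 <= B ->
  (p <= m)%N -> (m < N)%N -> cell_left m + p%:R * tau <= del ->
  backward_average m F <= e + theta ^+ p * B.
Proof.
move=> iF e0 FB Fe B0; elim: p m => [|p IH] m pm mN.
  move=> _; rewrite expr0 mul1r; have avm := backward_averaging mN.
  rewrite -(averaging_cst avm (e + B)); apply: (averaging_le_in avm iF).
    exact: integrable_time_cst.
  by move=> r /FB; lra.
case: m pm mN => // m pm mN hdel /=.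
have avc := cell_averaging mN; have ht : 0 < 1 - theta by rewrite subr_gt0.
have h1 : cell_average (cell_left m.+1) tau F <= e.
  rewrite /cell_average mulrC ler_pdivrMr//.
  have -> : e * tau = \int[leb]_(r in `[cell_left m.+1, cell_left m.+1 + tau]) e.
    by rewrite Rintegral_itv_cst ?lerDl ?ltW//; congr (_ * _); ring.
  have sub := subset_cell (cell_left_ge0 mN) (cell_right_le m.+1).
  apply: le_Rintegral => //.
  - by apply: (integrableS _ _ _ iF).
  - by apply: integrable_real_cst => //; exact: lebesgue_itv_lty.
  - move=> r rc; apply: Fe; first exact: sub.
    move: rc; rewrite /= in_itv/= => /andP[_ h]; apply: (le_trans h).
    apply: le_trans hdel; rewrite lerD2l -[leLHS]mul1r ler_pM2r// ler1n//.
have h2 : backward_average m F <= e + theta ^+ p * B.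
  apply: IH => //; first exact: ltnW.
  apply: le_trans hdel; rewrite -(cell_leftS m) -addrA lerD2l.
  by rewrite -addn1 natrD mulrDl mul1r addrC.
have q1 := ler_wpM2l (ltW ht) h1; have q2 := ler_wpM2l (ltW th0) h2.
by rewrite exprS -mulrA; move: (theta ^+ p * B) q2 => z; lra.
Qed.

End backward_averages.
End time_chain.

(** An abstract form of the argument, with a family [F] of observables of the curve
    and their costs [E]: by duality, [HT] is the entropy at the final time and
    [gs] the dissipation. *)
Section chain.
Context {R : realType} (T : R) (Pot : Type) (F : Pot -> R -> R) (E : Pot -> R).
Variables (gs : R -> R) (HT : R).
Local Notation leb := (@lebesgue_measure R).
Hypotheses (T0 : 0 < T) (gs_int : leb.-integrable `[0, T] (EFin \o gs)).
Hypothesis gs_ge0 : forall r, 0 <= gs r.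
Hypothesis F_cont : forall psi, {within `[0, T], continuous (F psi)}.
Hypothesis step : forall L, averaging T L -> forall psi (eps : R), 0 < eps ->
  exists phi X, [/\ leb.-integrable `[0, T] (EFin \o X), speed_bound T (F phi) X,
    L X <= L gs + eps & L (F psi) - E psi <= L (F phi) - E phi + eps].
Hypothesis F_end : forall phi, F phi T - E phi <= HT.

(** Each step replaces the potential by one adapted to the current average, then
    moves to the next average at the cost allowed by [backward_average_step]. *)
Lemma chain_induction (tau theta : R) N m psi (eps : R) :
  0 < tau -> T = N%:R * tau -> 0 < theta -> theta < 1 -> (m < N)%N -> 0 < eps ->
  backward_average T tau theta m (F psi) - E psi <=
  HT + tau * backward_average T tau theta 0 gs
  + theta^-1 * (tau * \sum_(k < m) backward_average T tau theta k.+1 gs) + eps.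
Proof.
move=> tau0 NT th0 th1; have thV : 0 < theta^-1 by rewrite invr_gt0.
elim: m psi eps => [|m IH] psi eps mN eps0.
  pose e := eps / (tau + 1).
  have t1 : 0 < tau + 1 by rewrite addr_gt0.
  have e0 : 0 < e by rewrite divr_gt0.
  have eE : tau * e + e = eps by rewrite /e -[X in _ + X]mul1r -mulrDl mulrC divfK// gt_eqF.
  have [phi [X [iX FX LX Lpsi]]] :=
    step (backward_averaging tau0 NT th0 th1 mN) psi e0.
  have := backward_average0_end theta tau0 NT
    (within_itv_lebesgue (@F_cont phi)) iX FX mN.
  have := F_end phi; have := ler_wpM2l (ltW tau0) LX; rewrite big_ord0 !mulr0 mulrDr.
  move: Lpsi; clearbody e; move: (backward_average _ _ _ _ (F psi)) (tau * _) (tau * _).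
  move: (backward_average _ _ _ _ _) (F phi T) (E phi) (E psi) (tau * e) eE.
  by move=> A1 A2 A3 A4 A5 eE A6 A7 A8; lra.
pose e := eps / 2 / (tau / theta + 1).
have t1 : 0 < tau / theta + 1 by rewrite addr_gt0// divr_gt0.
have e0 : 0 < e by rewrite !divr_gt0.
have eE : tau / theta * e + e = eps / 2.
  by rewrite /e -[X in _ + X]mul1r -mulrDl mulrC divfK// gt_eqF.
have [phi [X [iX FX LX Lpsi]]] :=
  step (backward_averaging tau0 NT th0 th1 mN) psi e0.
have S := backward_average_step tau0 NT th0 th1
  (within_itv_lebesgue (@F_cont phi)) iX FX mN.
have e2 : 0 < eps / 2 by rewrite divr_gt0.
have tt0 : 0 <= tau / theta by rewrite ltW// divr_gt0.
have := ler_wpM2l tt0 LX; rewrite [leRHS]mulrDr.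
have := IH phi (eps / 2) (ltnW mN) e2; rewrite big_ord_recr.
rewrite [X in _ -> _ -> _ <= _ + X + _](_ : _ =
  theta^-1 * (tau * \sum_(k < m) backward_average T tau theta k.+1 gs)
  + tau / theta * backward_average T tau theta m.+1 gs); last by rewrite /=; ring.
move: S Lpsi eE; clearbody e.
move: (backward_average _ _ _ m.+1) (backward_average _ _ _ m) => Y1 Y0.
move: (Y1 _) (Y1 _) (Y1 _) (Y1 _) (Y0 _) => A1 A2 A3 A4 A5.
move: (theta^-1 * (tau * _)) (tau * backward_average _ _ _ _ _) (tau / theta) => A6 A7 A8.
by move: (A8 * _) (A8 * _) (A8 * _) (E phi) (E psi) => A9 A10 A11 A12 A13; lra.
Qed.

Lemma small_final_integral (e : R) : 0 < e ->
  exists2 del, 0 < del & forall tau, 0 <= tau -> tau <= del -> tau <= T ->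
    \int[leb]_(r in `[T - tau, T]) gs r <= e.
Proof.
move=> e0.
have := parameterized_integral_continuous (ltW T0) gs_int.
move=> /(continuous_within_itvP _ T0)[_ _].
move=> /cvgrPdist_le /(_ _ e0)[del /= del0 H].
exists (del / 2); first by rewrite divr_gt0.
move=> tau; rewrite le_eqVlt => /predU1P[<- _ _|tau0 td tT].
  by rewrite subr0 set_itv1 Rintegral_set1 ltW.
have := H (T - tau) _ _; rewrite /ball_/=.
have lt : T - tau < T by rewrite gtrBl.
have n1 : `|T - (T - tau)| < del by rewrite opprB addrC subrK gtr0_norm//; lra.
move=> /(_ n1 lt); rewrite /parameterized_integral => h.
rewrite (@Rintegral_split _ 0 (T - tau) T) ?subr_ge0 ?(ltW lt)// in h.
by apply: le_trans h; rewrite addrAC subrr add0r ler_norm.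
Qed.

(** As the cells shrink, the average at the first cell tends to the value at time 0
    and the boundary terms at the final time vanish; the factor [theta^-1] remains. *)
Lemma chain_theta (psi : Pot) (theta e : R) : 0 < theta -> theta < 1 -> 0 < e ->
  F psi 0 - E psi <= HT + theta^-1 * \int[leb]_(r in `[0, T]) gs r + e.
Proof.
move=> th0 th1 e0; have ht : 0 < 1 - theta by rewrite subr_gt0.
have iF := within_itv_lebesgue (@F_cont psi).
have [B B0 FB] := within_itv_bounded (@F_cont psi).
pose f r := `|F psi 0 - F psi r|.
have in0 : 0 \in `[0, T] by rewrite in_itv/= lexx ltW.
have fB r : r \in `[0, T] -> f r <= B + B.
  by move=> rT; apply: (le_trans (ler_normB _ _)); rewrite lerD ?FB.
have e4 : 0 < e / 4 by rewrite divr_gt0.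
have [del del0 fe] : exists2 del, 0 < del &
    forall r, r \in `[0, T] -> r <= del -> f r <= e / 4.
  move: (@F_cont psi) => /(continuous_within_itvP _ T0)[_ + _].
  move=> /cvgrPdist_le /(_ _ e4)[del /= del0 H].
  exists (del / 2); first by rewrite divr_gt0.
  move=> r; rewrite in_itv/= => /andP[+ _].
  rewrite le_eqVlt => /predU1P[<- _|r0 rd]; first by rewrite /f subrr normr0 ltW.
  apply: H => //; rewrite /ball_/= sub0r normrN gtr0_norm//; lra.
have [p pB] : exists p, theta ^+ p * (B + B) <= e / 4.
  have : `|theta| < 1 by rewrite gtr0_norm.
  move=> /cvg_expr /cvgrPdist_le /(_ (e / 4 / (B + B + 1))) [].
    by rewrite divr_gt0// ltr_wpDl// addr_ge0.
  move=> p _ /(_ p (leqnn p)); rewrite sub0r normrN ger0_norm ?exprn_ge0 ?(ltW th0)// => h.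
  exists p; have B1 : 0 < B + B + 1 by rewrite ltr_wpDl// addr_ge0.
  rewrite ler_pdivlMr// in h; apply: le_trans h.
  by rewrite ler_wpM2l ?exprn_ge0 ?(ltW th0)//; lra.
(* [K] collects the boundary terms, all of them integrals over the last cell *)
pose K := 1 + theta^-1 * (1 - theta)^-1.
have K0 : 0 < K by rewrite addr_gt0// mulr_gt0 ?invr_gt0.
have [del2 del20 last] := small_final_integral (divr_gt0 e4 K0).
(* enough cells for the last one to be short, and for [p + 1] of them to fit
   into the interval where [F psi] is close to its initial value *)
pose q := Num.max (T / del2) (Num.max (p.+1%:R * T / del) p.+1%:R).
pose N := (Num.truncn q).+1.
have qN : q < N%:R by rewrite truncnS_gt.
have N0 : 0 < N%:R :> R by rewrite ltr0n.
pose tau := T / N%:R.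
have tau0 : 0 < tau by rewrite divr_gt0.
have NT : T = N%:R * tau by rewrite /tau mulrC divfK// gt_eqF.
have td2 : tau <= del2.
  rewrite /tau ler_pdivrMr// mulrC -ler_pdivrMr//; apply/ltW.
  by apply: le_lt_trans qN; rewrite /q le_max lexx.
have pd : p.+1%:R * tau <= del.
  rewrite /tau mulrA ler_pdivrMr// (mulrC del) -ler_pdivrMr//; apply/ltW.
  by apply: le_lt_trans qN; rewrite /q !le_max lexx orbT.
have pdel : cell_left T tau N.-1 + p%:R * tau <= del.
  rewrite /cell_left prednK// -NT subrr add0r; apply: le_trans pd.
  by rewrite ler_pM2r// ler_nat.
have pN : (p <= N.-1)%N.
  rewrite -ltnS prednK// ltnW// -(ltr_nat R); apply: le_lt_trans qN.
  by rewrite /q !le_max lexx !orbT.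
have NN : (N.-1 < N)%N by [].
have avN := backward_averaging tau0 NT th0 th1 NN.
have fi : leb.-integrable `[0, T] (EFin \o f).
  apply: integrable_norm => //; apply: integrable_realB => //.
  exact: integrable_time_cst.
have h1 : F psi 0 - backward_average T tau theta N.-1 (F psi) <= e / 4 + e / 4.
  rewrite -[X in X - _](averaging_cst avN) -(averagingB avN)//; last exact: integrable_time_cst.
  apply: (@le_trans _ _ (backward_average T tau theta N.-1 f)).
    apply: (averaging_le_in avN) => //.
      by apply: integrable_realB => //; exact: integrable_time_cst.
    by move=> r _; exact: ler_norm.
  have := backward_average_near tau0 NT th0 th1 fi (ltW e4) fB fe _ pN NN pdel.
  by rewrite addr_ge0// => /(_ isT) h; apply: (le_trans h); rewrite lerD2l.
have h2 := chain_induction psi tau0 NT th0 th1 NN e4.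
have h3 := backward_average_sum tau0 NT th0 th1 NN gs_int gs_ge0.
have cE : tau * backward_average T tau theta 0 gs =
    \int[leb]_(r in `[cell_left T tau 0, T]) gs r.
  by rewrite /= /cell_average mulrA divff ?mul1r ?gt_eqF// cell_left0.
have lastE : \int[leb]_(r in `[cell_left T tau 0, T]) gs r <= e / 4 / K.
  rewrite /cell_left mul1r; apply: last => //; first exact: ltW.
  by rewrite /tau ler_pdivrMr// ler_peMr ?(ltW T0)// ler1n.
have h4 : K * \int[leb]_(r in `[cell_left T tau 0, T]) gs r <= e / 4.
  by rewrite mulrC -ler_pdivlMr.
have thV : 0 <= theta^-1 by rewrite invr_ge0 ltW.
have := ler_wpM2l thV h3; rewrite [leRHS]mulrDr [X in _ <= _ + X]mulrA.
move: h1 h2 h4; rewrite cE /K [(1 + _) * _]mulrDl mul1r.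
move: (theta^-1 * (tau * _)) (theta^-1 * Rintegral _ _ _) (theta^-1 / _ * _) => A1 A2 A3.
move: (backward_average _ _ _ _ (F psi)) (Rintegral _ _ _) (F psi 0) (E psi).
by move=> A4 A5 A6 A7; lra.
Qed.

(** Letting [theta] tend to 1 in [chain_theta], at the explicit value
    [D / (D + e)] that makes a gap [e] contradictory. *)
Lemma chain (psi : Pot) : F psi 0 - E psi <= HT + \int[leb]_(r in `[0, T]) gs r.
Proof.
set G := Rintegral _ _ _.
have G0 : 0 <= G by apply: Rintegral_ge0 => r _; exact: gs_ge0.
have key theta : 0 < theta -> theta < 1 -> theta * (F psi 0 - E psi - HT) <= G.
  move=> th0 th1; rewrite mulrC -ler_pdivlMr//; apply/ler_addgt0Pr => e e0.
  have := chain_theta psi th0 th1 e0; rewrite -/G mulrC; lra.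
rewrite -lerBlDl; set D := _ - HT in key *.
have [D0|D0] := leP D 0; first exact: le_trans G0.
apply/ler_addgt0Pr => e e0.
pose th := D / (D + e).
have De : 0 < D + e by exact: addr_gt0.
have th0 : 0 < th by rewrite divr_gt0.
have th1 : th < 1 by rewrite ltr_pdivrMr// mul1r ltrDl.
have := key th th0 th1; apply: contraTT; rewrite -!ltNge => h.
rewrite /th mulrAC ltr_pdivlMr// ; nra.
Qed.

End chain.

(** * Duality for the entropy *)

Section eta.
Context {R : realType}.
Implicit Types r s t c K : R.

(** Legendre duality of [eta] and [expR - 1].  The positive part of [s] appears
    because [ln] vanishes on negative numbers, so that [eta s = 1 - s] there, and because
    a Radon-Nikodym derivative may be negative on a null set. *)
Lemma eta_young s t : Num.max 0 s * t - (expR t - 1) <= eta s.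
Proof.
rewrite /eta; have [s0|s0] := leP s 0.
  rewrite ln0//; have := expR_gt0 t; lra.
have := expR_ge1Dx (t - ln s); rewrite expRB lnK ?posrE// ler_pdivlMr// => h.
lra.
Qed.

Lemma eta_ge0 s : 0 <= eta s.
Proof. by have := eta_young s 0; rewrite mulr0 expR0 !subrr. Qed.

Lemma measurable_eta : measurable_fun (setT : set (line R)) (@eta R).
Proof.
apply: measurable_funD => //; apply: measurable_funB => //.
by apply: measurable_funM => //; exact: measurable_ln.
Qed.

(** Truncating the optimal multiplier [ln r] keeps the integrand nonnegative. *)
Definition clamp K r := Num.min (Num.max r K^-1) K.

Lemma clamp_bounds K r : 1 <= K -> K^-1 <= clamp K r <= K.
Proof.
move=> K1; have K0 : 0 < K by lra.
have KK : K^-1 <= K by rewrite (le_trans _ K1)// invf_le1.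
by rewrite /clamp le_min KK ge_min le_max !lexx orbT andbT/= orbT.
Qed.

Lemma clamp_gt0 K r : 1 <= K -> 0 < clamp K r.
Proof.
by move=> K1; have /andP[+ _] := clamp_bounds r K1; apply: lt_le_trans;
  rewrite invr_gt0; lra.
Qed.

Lemma ln_clamp_bound K r : 1 <= K -> `|ln (clamp K r)| <= ln K.
Proof.
move=> K1; have /andP[a b] := clamp_bounds r K1; have c0 := clamp_gt0 r K1.
have K0 : 0 < K by lra.
rewrite ler_norml; apply/andP; split.
  by rewrite -lnV ?posrE// ler_ln ?posrE ?invr_gt0.
by rewrite ler_ln ?posrE.
Qed.

Lemma clamp_integrand_ge0 K r : 1 <= K ->
  0 <= r * ln (clamp K r) - (clamp K r - 1).
Proof.
move=> K1; have c0 := clamp_gt0 r K1; have := eta_ge0 (clamp K r); rewrite /eta.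
suff : 0 <= (r - clamp K r) * ln (clamp K r) by lra.
have K0 : 0 < K by lra.
have lnK0 : 0 <= ln K by rewrite ln_ge0.
rewrite /clamp; have [rK|rK] := leP r K^-1.
  rewrite min_l; last by rewrite (le_trans _ K1)// invf_le1.
  by rewrite lnV ?posrE// mulr_le0// ?subr_le0// oppr_le0.
have [rK'|rK'] := leP r K; first by rewrite subrr mul0r.
by rewrite mulr_ge0// subr_ge0 ltW.
Qed.

Lemma clamp_integrand_cvg r : 0 <= r ->
  r * ln (clamp n.+1%:R r) - (clamp n.+1%:R r - 1) @[n --> \oo] --> eta r.
Proof.
rewrite le_eqVlt => /predU1P[<-|r0].
  have -> : (fun n => 0 * ln (clamp n.+1%:R 0) - (clamp n.+1%:R 0 - 1)) =
      (fun n => 1 - n.+1%:R^-1 : R).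
    apply/funext => n; rewrite mul0r sub0r opprB /clamp max_r ?invr_ge0// min_l//.
    by rewrite (@le_trans _ _ 1)// ?invf_le1// ler1n.
  rewrite /eta mul0r subr0 add0r -[X in _ --> X]subr0.
  by apply: cvgB; [exact: cvg_cst|exact: cvg_harmonic].
apply: (@cvg_trans _ ((fun=> eta r) @ \oo)); last exact: cvg_cst.
apply: near_eq_cvg; near=> n.
suff -> : clamp n.+1%:R r = r by rewrite /eta; ring.
have a : r^-1 <= n.+1%:R.
  by near: n; exists (Num.truncn r^-1) => // n /= h; rewrite ltW// (lt_le_trans (truncnS_gt _))// ler_nat.
have b : r <= n.+1%:R.
  by near: n; exists (Num.truncn r) => // n /= h; rewrite ltW// (lt_le_trans (truncnS_gt _))// ler_nat.
by rewrite /clamp max_l ?min_l// -[r]invrK lef_pV2 ?posrE ?invr_gt0 ?ltr0n.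
Unshelve. all: by end_near. Qed.

End eta.

Section edge_entropy.
Context {R : realType} (l : R) (P : R -> R).
Variables rho pi : {finite_measure set (line R) -> \bar R}.
Hypotheses (l0 : 0 < l) (lipP : [lipschitz P x | x in `[0, l]]).
Hypothesis gibbs : forall A : set (line R), measurable A -> pi A =
  (\int[@lebesgue_measure R]_(x in A `&` `[0%R, l]%classic) (expR (- P x))%:E)%E.

Lemma edge_entropy_ge0 (r p : {finite_measure set (line R) -> \bar R}) :
  (0 <= edge_entropy r p)%E.
Proof.
rewrite /edge_entropy; case: ifP => // _.
by apply: integral_ge0 => x _; rewrite lee_fin eta_ge0.
Qed.

Let D : set (line R) := `[0, l]%classic.
Let mD : measurable D. Proof. exact: measurable_itv. Qed.

(** The positive part of the integrand lies below [eta] everywhere, also outside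
    [[0, l]], so the two integrals over different sets compare directly. *)
Lemma edge_entropy_ge (f : R -> R) : {within `[0, l], continuous f} ->
  ((\int[rho]_(x in `[0, l]) f x - \int[pi]_(x in `[0, l]) (expR (f x) - 1))%:E
    <= edge_entropy rho pi)%E.
Proof.
move=> cf; rewrite /edge_entropy; case: asboolP => [rp|_]; last exact: leey.
have h := RN_has_density rp; set r := fun x => _ in h.
have [mr r0 _] := h.
have fi := within_itv_integrable rho cf.
have cef : {within `[0, l], continuous (fun x => expR (f x) - 1)}.
  apply: within_itvB; last exact/continuous_subspaceT/cst_continuous.
  by apply: within_itv_comp => //; exact: continuous_expR.
have ei := within_itv_integrable pi cef.
have fri : pi.-integrable `[0, l] (EFin \o (fun x => f x * r x)).
  by rewrite -(integrable_density h)//; exact: within_itv_measurable.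
rewrite (Rintegral_density h)// -RintegralB//.
pose k x := f x * r x - (expR (f x) - 1).
have ki : pi.-integrable `[0, l] (EFin \o k) by exact: integrable_realB.
have mk : measurable_fun (`[0, l] : set (line R)) k.
  by case/integrableP : ki => /measurable_EFinP.
have kpi : pi.-integrable `[0, l] (EFin \o (fun x => Num.max 0 (k x))).
  apply: (le_integrable _ _ _ ki) => //.
    by apply/measurable_EFinP; exact: measurable_maxr.
  move=> x _; rewrite /= lee_fin ger0_norm ?le_max ?lexx// ge_max normr_ge0.
  exact: ler_norm.
apply: (@le_trans _ _ (\int[pi]_(x in `[0, l]) Num.max 0 (k x))%:E).
  by rewrite lee_fin; apply: le_Rintegral => // x _; rewrite le_max lexx orbT.
rewrite /Rintegral fineK ?integrable_fin_num// integral_mkcond.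
apply: ge0_le_lower_integral => x _.
  by rewrite patchE; case: ifP => // _; rewrite lee_fin le_max lexx.
rewrite patchE; case: ifP => _; rewrite lee_fin ?eta_ge0//.
by rewrite ge_max eta_ge0/= /k mulrC; exact: eta_young.
Qed.

(** Density of continuous functions in L^1; truncating the approximation at the
    bound [Lam] of [f] can only bring it closer. *)
Lemma continuous_approximation (f : R -> R) (Lam e : R) :
  measurable_fun (D : set (line R)) f -> (forall x, `|f x| <= Lam) -> 0 < e ->
  exists g : R -> R, [/\ {within `[0, l], continuous g}, forall x, `|g x| <= Lam &
    \int[pi]_(x in `[0, l]) `|f x - g x| <= e].
Proof.
move=> mf fL e0; have [Q Q0 PQ] := potential_bounds lipP.
have Lam0 : 0 <= Lam by apply: le_trans (fL 0).
have Dlty : (@lebesgue_measure R D < +oo)%E by exact: lebesgue_itv_lty.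
have fi : (@lebesgue_measure R).-integrable D (EFin \o f).
  by apply: (integrable_real_bounded (C := Lam)).
have [g_ [cg gi glim]] := approximation_continuous_integrable mD Dlty fi.
have e1 : 0 < e / Q by rewrite divr_gt0.
have [n] : exists n, (\int[@lebesgue_measure R]_(z in D) `|(f z - g_ n z)%:E| <= (e / Q)%:E)%E.
  move: glim => /fine_cvgP[[m _ fin] /cvgrPdist_le /(_ _ e1)[m' _ H]].
  exists (maxn m m'); have := H _ (leq_maxr m m'); rewrite sub0r normrN /=.
  rewrite ger0_norm ?fine_ge0 ?integral_ge0// -lee_fin fineK//.
  exact: fin _ (leq_maxl m m').
move=> hn; pose g x := Num.max (- Lam) (Num.min Lam (g_ n x)).
have gL x : `|g x| <= Lam.
  by rewrite ler_norml /g le_max lexx/= ge_max ge_min lexx andbT; lra.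
have cgw : continuous g.
  move=> x; apply: (@continuous_max R R (cst (- Lam)) (fun x => Num.min Lam (g_ n x))).
    exact: cst_continuous.
  by apply: (@continuous_min R R (cst Lam) (g_ n)); [exact: cst_continuous|exact: cg].
exists g; split => //; first exact: continuous_subspaceT.
have mg : measurable_fun (D : set (line R)) g.
  by apply: within_itv_measurable; exact: continuous_subspaceT.
have mfg : measurable_fun D (fun x => `|f x - g x|).
  by apply: measurableT_comp => //; exact: measurable_funB.
have fgL x : `|(fun x => `|f x - g x|) x| <= Lam + Lam.
  by rewrite normr_id (le_trans (ler_normB _ _))// lerD.
have hg := gibbs_has_density lipP gibbs.
have fgi : pi.-integrable D (EFin \o (fun x => `|f x - g x|)).
  apply: (integrable_real_bounded (C := Lam + Lam)) => //.
  by rewrite -ge0_fin_numE// fin_num_measure.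
rewrite (Rintegral_density hg)// -lee_fin.
have ii : (@lebesgue_measure R).-integrable D (EFin \o (fun x => `|f x - g x| * gibbs_density l P x)).
  by rewrite -(integrable_density hg)//.
rewrite /Rintegral fineK ?integrable_fin_num//.
apply: (@le_trans _ _ (\int[@lebesgue_measure R]_(z in D) (Q%:E * `|(f z - g_ n z)%:E|))%E).
  apply: ge0_le_lower_integral => x Dx.
    by rewrite lee_fin mulr_ge0// /gibbs_density patchE; case: ifP => // _; exact: expR_ge0.
  rewrite /= lee_fin mulrC /gibbs_density patchE mem_set// ler_pM ?expR_ge0//.
    by case: (PQ x Dx).
  have := fL x; rewrite ler_norml => /andP[a b].
  rewrite /g; have [c1|c1] := leP Lam (g_ n x).
    rewrite max_r; last lra.
    by rewrite distrC ger0_norm ?subr_ge0// distrC ger0_norm; lra.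
  have [c2|c2] := leP (- Lam) (g_ n x) => //.
  by rewrite ger0_norm ?ger0_norm; lra.
rewrite ge0_integralZl//; last 2 first.
- apply/measurable_EFinP; apply: measurableT_comp => //; apply: measurable_funB => //.
  by have /integrableP[/measurable_EFinP] := gi n.
- by rewrite lee_fin ltW.
by rewrite muleC -lee_pdivlMr// -EFinM.
Qed.

End edge_entropy.

Section edge_entropy_dual.
Context {R : realType} (l : R) (P : R -> R).
Variables rho pi : {finite_measure set (line R) -> \bar R}.
Hypotheses (l0 : 0 < l) (lipP : [lipschitz P x | x in `[0, l]]).
Hypothesis gibbs : forall A : set (line R), measurable A -> pi A =
  (\int[@lebesgue_measure R]_(x in A `&` `[0%R, l]%classic) (expR (- P x))%:E)%E.

Let D : set (line R) := `[0, l]%classic.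
Let mD : measurable D. Proof. exact: measurable_itv. Qed.

Let fin_lty (A : set (line R)) : measurable A -> (pi A < +oo)%E.
Proof. by move=> mA; rewrite -ge0_fin_numE// fin_num_measure. Qed.

Lemma tail_truncation (r : R -> R) (e : R) : 0 < e -> (forall x, 0 <= r x) ->
  pi.-integrable D (EFin \o r) ->
  exists2 K : R, 0 <= K & \int[pi]_(x in D) (r x - Num.min (r x) K) <= e.
Proof.
move=> e0 r0 ir; have mr : measurable_fun D r by case/integrableP : ir => /measurable_EFinP.
pose t n x := r x - Num.min (r x) n%:R.
have t0 n x : 0 <= t n x <= r x.
  by rewrite /t subr_ge0 ge_min lexx/= gerBl le_min r0 ler0n.
have mt n : measurable_fun D (t n).
  by apply: measurable_funB => //; exact: measurable_minr.
have lim : \int[pi]_(x in D) t n x @[n --> \oo] --> (0 : R).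
  have [] := @dominated_convergence _ _ _ pi D mD (fun n => EFin \o t n) (cst 0%E) (EFin \o r).
  - by move=> n; apply/measurable_EFinP.
  - exact: measurable_cst.
  - apply: aeW => x _; apply: (@cvg_trans _ ((fun=> 0%E) @ \oo)); last exact: cvg_cst.
    apply: near_eq_cvg; near=> n.
    suff : r x <= n%:R by move=> h; rewrite /= /t min_l// subrr.
    near: n; exists (Num.truncn (r x)).+1 => // n /= h.
    by rewrite ltW// (lt_le_trans (truncnS_gt _))// ler_nat.
  - exact: ir.
  - apply: aeW => x n _; rewrite /= lee_fin; have /andP[a b] := t0 n x.
    by rewrite ger0_norm.
  move=> _ _; rewrite integral0 => /fine_cvgP[_]; exact.
move: lim => /cvgrPdist_le /(_ _ e0)[n _ /(_ n (leqnn n))].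
rewrite sub0r normrN => hn; exists n%:R => //.
exact: le_trans (ler_norm _) hn.
Unshelve. all: by end_near. Qed.

(** The optimal multiplier is the logarithm of the density.  It is truncated by
    [clamp], which keeps the integrand between 0 and [eta] so that dominated
    convergence applies, and then approximated by a continuous function.
    The approximation is close in L^1 of [pi] but is integrated against [rho], so
    the density is cut at a level [K] beyond which it has small mass. *)
Lemma edge_entropy_le (e : R) : 0 < e -> (edge_entropy rho pi < +oo)%E ->
  exists2 g : R -> R, {within `[0, l], continuous g} &
  (edge_entropy rho pi <=
    (\int[rho]_(x in `[0, l]) g x - \int[pi]_(x in `[0, l]) (expR (g x) - 1) + e)%:E)%E.
Proof.
move=> e0; rewrite /edge_entropy; case: asboolP => [rp|_]; last by rewrite ltxx.
set dn := density rho pi => Eoo.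
have h := RN_has_density rp; set r := fun x => _ in h.
have [mr r0 _] := h.
have ri := has_density_integrable h.
have mdn : measurable_fun (setT : set (line R)) dn.
  have rni := @Radon_Nikodym_integrable _ _ _ (charge_of_finite_measure rho) pi rp.
  by apply: measurableT_comp => //; exact: measurable_int rni.
have meta : measurable_fun (setT : set (line R)) (fun x => eta (dn x)).
  by apply: measurableT_comp => //; exact: measurable_eta.
have ieta : pi.-integrable setT (EFin \o (fun x => eta (dn x))).
  apply/integrableP; split; first exact/measurable_EFinP.
  by under eq_integral do rewrite /= ger0_norm ?eta_ge0//.
have dnr : {ae pi, forall x, dn x = r x}.
  have := has_density_unique h; case=> N [mN N0 NU]; exists N; split => // x /= nx.
  by apply: NU => /= hx; apply: nx; rewrite /dn /density hx.
pose f n x := ln (clamp n.+1%:R (r x)).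
pose k n x := r x * f n x - (clamp n.+1%:R (r x) - 1).
have mcl n : measurable_fun (setT : set (line R)) (fun x => clamp n.+1%:R (r x)).
  by apply: measurable_minr => //; exact: measurable_maxr.
have mf n : measurable_fun (setT : set (line R)) (f n).
  by apply: measurableT_comp => //; exact: measurable_ln.
have mk n : measurable_fun (setT : set (line R)) (k n).
  by apply: measurable_funB; [exact: measurable_funM|exact: measurable_funB].
have n1 n : 1 <= n.+1%:R :> R by rewrite ler1n.
have ef n x : expR (f n x) = clamp n.+1%:R (r x).
  by rewrite /f lnK// posrE clamp_gt0.
have young n x : 0 <= k n x <= eta (dn x).
  rewrite /k clamp_integrand_ge0//= -[clamp _ _]ef.
  exact: eta_young.
have ki n : pi.-integrable setT (EFin \o k n).
  apply: (le_integrable _ _ _ ieta) => //; first exact/measurable_EFinP.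
  by move=> x _; have /andP[a b] := young n x; rewrite /= lee_fin !ger0_norm ?eta_ge0.
have lim : \int[pi]_x k n x @[n --> \oo] --> \int[pi]_x eta (dn x).
  have [] := @dominated_convergence _ _ _ pi setT measurableT (fun n => EFin \o k n)
    (EFin \o (fun x => eta (dn x))) (EFin \o (fun x => eta (dn x))).
  - by move=> n; apply/measurable_EFinP.
  - exact/measurable_EFinP.
  - case: dnr => N [mN N0 NU]; exists N; split => // x /= nx; apply: NU => /= hx.
    apply: nx => _; apply/fine_cvgP; split; first exact: nearW.
    by rewrite /= hx; exact: clamp_integrand_cvg.
  - exact: ieta.
  - apply: aeW => x n _; rewrite /= lee_fin; have /andP[a b] := young n x.
    by rewrite ger0_norm.
  move=> i1 _; rewrite -(fineK (integrable_fin_num measurableT i1)).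
  by move=> /fine_cvgP[_]; exact.
have e2 : 0 < e / 2 by rewrite divr_gt0.
move: lim => /cvgrPdist_le /(_ _ e2)[n _ /(_ n (leqnn n))].
rewrite ler_norml => /andP[_ lim].
pose Lam : R := ln n.+1%:R.
have fL x : `|f n x| <= Lam by exact: ln_clamp_bound.
have Lam0 : 0 <= Lam by apply: le_trans (fL 0).
have rD : pi.-integrable D (EFin \o r) by apply: (integrableS _ _ _ ri).
have e8 : 0 < e / 4 / (2 * Lam + 1) by rewrite !divr_gt0// ltr_wpDl// mulr_ge0.
have [K K0 tail] := tail_truncation e8 r0 rD.
have e9 : 0 < e / 4 / (K + expR Lam) by rewrite !divr_gt0// ltr_wpDl ?expR_gt0.
have [g [cg gL gE]] := continuous_approximation lipP gibbs
  (measurable_funTS (mf n)) fL e9.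
exists g => //.
have ceg : {within `[0, l], continuous (fun x => expR (g x) - 1)}.
  apply: within_itvB; last exact/continuous_subspaceT/cst_continuous.
  by apply: within_itv_comp => //; exact: continuous_expR.
have gi := within_itv_integrable rho cg.
have mg := within_itv_measurable cg.
have egi := within_itv_integrable pi ceg.
have gri : pi.-integrable D (EFin \o (fun x => g x * r x)).
  by rewrite -(integrable_density h).
rewrite (Rintegral_density h)// -RintegralB//.
have eN : (\int[pi]_x (eta (dn x))%:E = (\int[pi]_x eta (dn x))%:E)%E.
  by rewrite /Rintegral fineK// integrable_fin_num.
rewrite eN lee_fin.
have kD : \int[pi]_x k n x = \int[pi]_(x in D) k n x.
  rewrite /Rintegral (negligible_integral (N := ~` D)) ?setDE ?setTI ?setCK//.
  - exact: measurableC.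
  - exact: ki.
  by apply: etrans (gibbs (measurableC mD)) _; rewrite setICl integral_set0.
rewrite kD in lim.
have kDi : pi.-integrable D (EFin \o k n) by apply: (integrableS _ _ _ (ki n)).
pose kg x := g x * r x - (expR (g x) - 1).
have kgi : pi.-integrable D (EFin \o kg) by exact: integrable_realB.
have fgi : pi.-integrable D (EFin \o (fun x => `|f n x - g x|)).
  apply: (integrable_real_bounded (C := Lam + Lam)) => //; first exact: fin_lty.
    by apply: measurableT_comp => //; apply: measurable_funB => //; exact: measurable_funTS.
  by move=> x _; rewrite normr_id (le_trans (ler_normB _ _))// lerD.
have ti : pi.-integrable D (EFin \o (fun x => r x - Num.min (r x) K)).
  apply: (le_integrable _ _ _ rD) => //.
    apply/measurable_EFinP; apply: measurable_funB; first exact: measurable_funTS.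
    by apply: measurable_minr => //; exact: measurable_funTS.
  move=> x _; rewrite /= lee_fin (ger0_norm (r0 x)) ger0_norm ?subr_ge0 ?ge_min ?lexx//.
  by rewrite gerBl le_min r0 K0.
have pw x : k n x - kg x <= (K + expR Lam) * `|f n x - g x|
    + 2 * Lam * (r x - Num.min (r x) K).
  have a1 : r x * (f n x - g x) <= K * `|f n x - g x| + 2 * Lam * (r x - Num.min (r x) K).
    have b1 : `|f n x - g x| <= 2 * Lam.
      by apply: (le_trans (ler_normB _ _)); rewrite mulrC mulr_natr mulr2n lerD.
    have b2 : 0 <= r x - Num.min (r x) K by rewrite subr_ge0 ge_min lexx.
    have b3 : Num.min (r x) K <= K by rewrite ge_min lexx orbT.
    have b4 := ler_wpM2l (r0 x) (ler_norm (f n x - g x)).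
    have b5 := ler_wpM2r b2 b1.
    have b6 := ler_wpM2r (normr_ge0 (f n x - g x)) b3.
    move: b4 b5 b6; move: `|f n x - g x| (Num.min (r x) K) => A m b4 b5 b6.
    by rewrite (mulrC A) mulrBl in b5; lra.
  have a2 : expR (g x) - expR (f n x) <= expR Lam * `|f n x - g x|.
    have c1 := expR_ge1Dx (f n x - g x).
    rewrite expRB ler_pdivlMr ?expR_gt0// in c1.
    have c2 : (g x - f n x) * expR (g x) <= `|f n x - g x| * expR Lam.
      apply: (le_trans (ler_norm _)); rewrite normrM distrC ler_pM//.
      rewrite ger0_norm ?expR_ge0// ler_expR; apply: le_trans (gL x).
      exact: ler_norm.
    by rewrite (mulrC (expR Lam)); lra.
  by rewrite /k /kg -[clamp _ _]ef mulrDl; lra.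
have int : \int[pi]_(x in D) k n x - \int[pi]_(x in D) kg x <= e / 4 + e / 4.
  rewrite -RintegralB//.
  apply: (@le_trans _ _ (\int[pi]_(x in D) ((K + expR Lam) * `|f n x - g x|
    + 2 * Lam * (r x - Num.min (r x) K)))).
    apply: le_Rintegral => //; first exact: integrable_realB.
    by apply: integrable_realD => //; exact: integrable_realZ.
  rewrite RintegralD//; last 2 first.
  - exact: integrable_realZ.
  - exact: integrable_realZ.
  rewrite !RintegralZl//; apply: lerD.
    by rewrite mulrC -ler_pdivlMr// ltr_wpDl ?expR_gt0.
  have L1 : 0 < 2 * Lam + 1 by rewrite ltr_wpDl// mulr_ge0.
  rewrite ler_pdivlMr// in tail; apply: le_trans tail.
  rewrite mulrC ler_wpM2l ?lerDl//; apply: Rintegral_ge0 => x _.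
  by rewrite subr_ge0 ge_min lexx.
rewrite -/D -/kg.
move: lim int; move: (Rintegral _ _ _) (Rintegral _ _ _) (Rintegral _ _ _).
by move=> A1 A2 A3; lra.
Qed.

End edge_entropy_dual.

Section graph_entropy.
Context {R : realType} {V : finType} (M : metric_graph R V).
Variables (nu : state R V) (P : V * V -> R -> R).
Hypothesis omega_gt0 : forall v, 0 < node_mass nu v.
Hypothesis nu_gibbs : is_gibbs M P nu.

Lemma node_entropyE (g w : R) : 0 < w -> node_entropy g w = (w * eta (g / w))%:E.
Proof. by move=> w0; rewrite /node_entropy gt_eqF. Qed.

Lemma entropy_ge0 (m : state R V) : (0 <= entropy M nu m)%E.
Proof.
apply: adde_ge0; apply: sume_ge0 => i _; first exact: edge_entropy_ge0.
by rewrite node_entropyE// lee_fin mulr_ge0 ?eta_ge0// ltW.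
Qed.

Lemma entropy_ge_legendre (m : state R V) phi vphi :
  is_prob M m -> edgewise_continuous M vphi ->
  ((pairing M phi vphi m - legendre M nu phi vphi)%:E <= entropy M nu m)%E.
Proof.
move=> [m0 _ _] cv; rewrite /pairing /legendre opprD addrACA -!sumrB addrC EFinD.
rewrite -!sumEFin; apply: leeD.
  apply: lee_sum => e eM; have [lipP gibbs] := nu_gibbs eM.
  exact: edge_entropy_ge (cv e eM).
apply: lee_sum => v _; have w0 := omega_gt0 v; rewrite node_entropyE// lee_fin.
have := eta_young (node_mass m v / node_mass nu v) (phi v).
rewrite max_r ?divr_ge0 ?(ltW w0)// => h; have := ler_wpM2l (ltW w0) h.
apply: le_trans; rewrite le_eqVlt; apply/orP; left; apply/eqP; field.
by rewrite gt_eqF.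
Qed.

(** For [g = 0] the supremum is reached only in the limit [phi -> -oo]; the value
    [ln (e / w)] is within [e] of it. *)
Lemma node_entropy_le (g w e : R) : 0 < w -> 0 <= g -> 0 < e ->
  exists phi, w * eta (g / w) <= phi * g - w * (expR phi - 1) + e.
Proof.
move=> w0; rewrite le_eqVlt => /predU1P[<-|g0] e0.
  exists (ln (e / w)); rewrite lnK ?posrE ?divr_gt0// /eta !mul0r mulr0.
  rewrite (_ : w * (e / w - 1) = e - w); last by field; rewrite gt_eqF.
  by lra.
have gw : 0 < g / w by rewrite divr_gt0.
exists (ln (g / w)); rewrite lnK ?posrE// /eta.
rewrite (_ : w * (g / w * ln (g / w) - g / w + 1) = ln (g / w) * g - w * (g / w - 1)).
  by rewrite lerDl ltW.
by move: (ln _) => L; field; rewrite gt_eqF.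
Qed.

Lemma entropy_le_legendre (m : state R V) (e : R) :
  is_prob M m -> (entropy M nu m < +oo)%E -> 0 < e ->
  exists phi vphi, edgewise_continuous M vphi /\
  (entropy M nu m <= (pairing M phi vphi m - legendre M nu phi vphi + e)%:E)%E.
Proof.
move=> [m0 _ _] foo e0.
pose n : R := \sum_(v : V) 1 + \sum_(e in edges M) 1.
have n0 : 0 <= n by rewrite addr_ge0// sumr_ge0.
pose e1 := e / (n + 1).
have n1 : 0 < n + 1 by rewrite ltr_wpDl.
have e10 : 0 < e1 by rewrite divr_gt0.
have ne : n * e1 <= e.
  by rewrite /e1 mulrCA ler_piMr ?(ltW e0)// ler_pdivrMr// mul1r lerDl.
have nodex v : exists phi, node_mass nu v * eta (node_mass m v / node_mass nu v) <=
    phi * node_mass m v - node_mass nu v * (expR phi - 1) + e1.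
  by apply: node_entropy_le.
have edgex x : exists g : R -> R, x \in edges M -> {within `[0, len M x], continuous g} /\
    (edge_entropy (edge_meas m x) (edge_meas nu x) <=
     (\int[edge_meas m x]_(y in `[0, len M x]) g y
      - \int[edge_meas nu x]_(y in `[0, len M x]) (expR (g y) - 1) + e1)%:E)%E.
  have [eM|] := boolP (x \in edges M); last by exists (fun=> 0).
  have [lipP gibbs] := nu_gibbs eM.
  have xoo : (edge_entropy (edge_meas m x) (edge_meas nu x) < +oo)%E.
    apply: (@sume_lty_term _ _ (fun x => x \in edges M)
      (fun x => edge_entropy (edge_meas m x) (edge_meas nu x)) x) => //.
      by move=> i _; exact: edge_entropy_ge0.
    apply: le_lt_trans foo; rewrite /entropy leeDl//.
    apply: sume_ge0 => v _.
    by rewrite node_entropyE// lee_fin mulr_ge0 ?eta_ge0// ltW.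
  have [g cg hg] := edge_entropy_le lipP gibbs e10 xoo.
  by exists g.
exists (fun v => projT1 (cid (nodex v))), (fun x => projT1 (cid (edgex x))); split.
  by move=> x xM; case: (projT2 (cid (edgex x)) xM).
rewrite /pairing /legendre opprD addrACA -!sumrB.
apply: (@le_trans _ _ ((\sum_v (projT1 (cid (nodex v)) * node_mass m v -
   node_mass nu v * (expR (projT1 (cid (nodex v))) - 1) + e1) +
   \sum_(x in edges M) (\int[edge_meas m x]_(y in `[0, len M x]) projT1 (cid (edgex x)) y -
     \int[edge_meas nu x]_(y in `[0, len M x]) (expR (projT1 (cid (edgex x)) y) - 1) + e1))%:E)).
  rewrite /entropy addeC EFinD -!sumEFin; apply: leeD.
    apply: lee_sum => v _; rewrite node_entropyE// lee_fin.
    exact: (projT2 (cid (nodex v))).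
  by apply: lee_sum => x xM; case: (projT2 (cid (edgex x)) xM).
rewrite lee_fin !big_split/= addrACA lerD2l.
apply: le_trans ne; rewrite /n mulrDl !mulr_suml le_eqVlt; apply/orP; left; apply/eqP.
by congr (_ + _); apply: eq_bigr => i _; rewrite mul1r.
Qed.

End graph_entropy.

(** * The energy dissipation inequality *)

Theorem corollary3p13 (R : realType) (V : finType) (M : metric_graph R V)
    (nu : state R V) (P : V * V -> R -> R)
    (d : V * V -> R) (kappa : V * V -> V -> R) (T : R)
    (nu_prob : is_prob M nu)
    (omega_gt0 : forall v, 0 < node_mass nu v)
    (nu_gibbs : is_gibbs M P nu)
    (d_gt0 : forall e, e \in edges M -> 0 < d e)
    (kappa_gt0 : forall e v, e \in edges M -> ends e v -> 0 < kappa e v)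
    (T_gt0 : 0 < T)
    (mu : R -> state R V) (j : R -> flux R V) :
  CE M T mu j ->
  (entropy M nu (mu 0%R) < +oo)%E ->
  (0 <= energy_dissipation M nu P d kappa T mu j)%E.
Proof.
move=> ce E0oo.
have T_in : T \in `[0, T] by rewrite in_itv/= lexx ltW.
have in0 : 0 \in `[0, T] by rewrite in_itv/= lexx ltW.
have E0 := entropy_ge0 M omega_gt0 (mu 0); have ET := entropy_ge0 M omega_gt0 (mu T).
set g := fun r => (rate M d kappa (mu r) (j r) + fisher M nu P d kappa (mu r))%E.
have g0 r : (0 <= g r)%E.
  by apply: adde_ge0; [exact: rate_ge0|exact: fisher_ge0].
have E0f : entropy M nu (mu 0) \is a fin_num by rewrite ge0_fin_numE.
rewrite /energy_dissipation /dissipation -/g.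
(* if the final entropy or the dissipation is infinite, so is the left hand side *)
have [ETf|] := boolP (entropy M nu (mu T) \is a fin_num); last first.
  rewrite ge0_fin_numE// -leNgt leye_eq => /eqP ->.
  apply: adde_ge0; last by apply: integral_ge0 => r _; exact: g0.
  by rewrite -(fineK E0f) -EFinN addye.
have [Doo|] := boolP (\int[@lebesgue_measure R]_(t in `[0%R, T]) g t < +oo)%E; last first.
  rewrite -leNgt leye_eq => /eqP ->.
  by rewrite -(fineK E0f) -(fineK ETf) -EFinB addey.
have mI : measurable (`[0, T]%classic : set (line R)) by exact: measurable_itv.
have [gs [mgs gs0 gsi gsle gsmax]] :=
  measurable_minorant mI (fun r _ => g0 r) Doo.
pose Pot := {p : (V -> R) * (V * V -> R -> R) | edgewise_continuous M p.2}.
pose F (p : Pot) r := pairing M (projT1 p).1 (projT1 p).2 (mu r).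
pose L (p : Pot) := legendre M nu (projT1 p).1 (projT1 p).2.
have key : forall p : Pot, F p 0 - L p <=
    fine (entropy M nu (mu T)) + \int[@lebesgue_measure R]_(r in `[0, T]) gs r.
  apply: (chain T_gt0 gsi gs0) => [p|A avA p eps eps0|p].
  - by apply: (CE_narrow ce); exact: projT2 p.
  - have [phi [vphi [dvphi [X [C1 iX GX AX opt]]]]] := one_step omega_gt0 nu_gibbs
      d_gt0 kappa_gt0 ce gsi gs0 gsmax avA (projT1 p).1 (projT2 p) eps0.
    have cv : edgewise_continuous M vphi by move=> e /C1[].
    exists (exist _ (phi, vphi) cv), X; split => //.
    exact: (pairing_increment ce C1 iX GX).
  - rewrite -lee_fin fineK//.
    exact: (entropy_ge_legendre omega_gt0 nu_gibbs (projT1 p).1 (CE_prob ce T_in) (projT2 p)).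
have main : fine (entropy M nu (mu 0)) <= fine (entropy M nu (mu T))
    + \int[@lebesgue_measure R]_(r in `[0, T]) gs r.
  apply/ler_addgt0Pr => eps eps0.
  have [phi [vphi [cv h]]] := entropy_le_legendre omega_gt0 nu_gibbs (CE_prob ce in0) E0oo eps0.
  rewrite -(fineK E0f) lee_fin in h; apply: (le_trans h); rewrite lerD2r.
  exact: (key (exist _ (phi, vphi) cv)).
have gsE : (\int[@lebesgue_measure R]_(r in `[0%R, T]) (gs r)%:E =
    (\int[@lebesgue_measure R]_(r in `[0, T]) gs r)%:E)%E.
  by rewrite /Rintegral fineK// integrable_fin_num.
rewrite gsE in gsle.
apply: le_trans (leeD (lexx _) gsle).
rewrite -(fineK E0f) -(fineK ETf) -EFinB -EFinD lee_fin; move: main.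
by move: (fine _) (fine _) (Rintegral _ _ _) => x y z; lra.
Qed.
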